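(* (i) The set $\mathcal{IC}_\infty(C^k(S))$, $k=2,3,\ldots$, is not cube prevalent. (ii) For $\delta>0$, the set $\mathcal{IC}^e_1(C^\omega_\delta(S))$, as well as the set $\mathcal{IC}_{\rm fin}(C^\omega_\delta(S))$, is not cube prevalent.
   Context: Let $S=\mathbb{R}/2\pi\mathbb{Z}$ be the circle. $C^k(S)$ is the space of real $2\pi$-periodic $C^k$ functions with the usual $C^k$ norm. $C^\omega_\delta(S)$ denotes the space of real analytic $2\pi$-periodic functions which can be analytically continued to the strip $\mathbb{R}\times(-\delta i,\delta i)\subset\mathbb{C}$, with norm $\|f\|_{C^\omega_\delta(S)}=\sup_{|\mathrm{Im}\, z|<\delta}|f(z)|$. Cube null sets: let $X$ be a complete separable normed linear space. Consider the Hilbert cube $[0,1]^{\aleph_0}$ and a map $T:[0,1]^{\aleph_0}\to X$ defined by $T((t_1,t_2,\ldots))=x_0+\sum_{n=1}^\infty t_n x_n$, where $x_0,x_1,\ldots\in X$ are such that the vectors $x_1,x_2,\ldots$ are linearly independent, have a dense linear span in $X$, and $\sum_{n=1}^\infty\|x_n\|<\infty$. The image $\mu_T$ under $T$ of the standard product measure on $[0,1]^{\aleph_0}$ is called a cube measure. A set $E$ is cube null if $\mu_T(E)=0$ for any cube measure; the complement of a cube null set is called cube prevalent. For a $2\pi$-periodic function $f$, the corresponding family is the family of circle diffeomorphisms $F_{r,a}: x\mapsto x+2\pi r+a f(x) \pmod{2\pi}$, where $r\in\mathbb{R}$ and $a\in[-a_0,a_0]$. For a circle diffeomorphism $g$,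 $N(g)$ is the number of attracting periodic trajectories of $g$ and $\rho(g)$ is the rotation number of $g$ (the rotation $x\mapsto x+2\pi r$ has rotation number $r$). Define $$B(F,\rho_0)=\limsup_{a_1\to 0+}\ \sup_{\rho(F_{r,a})=\rho_0,\ |a|<a_1} N(F_{r,a}).$$ For a space $X$ of real functions on the circle: $\mathcal{IC}_N(X)$ is the set of $f\in X$ whose corresponding family satisfies $B(F,\rho)\le N$ for all $\rho\in\mathbb{R}$; $\mathcal{IC}_{\rm fin}(X)=\bigcup_{N=1}^\infty \mathcal{IC}_N(X)$; $\mathcal{IC}_\infty(X)=X\setminus \mathcal{IC}_{\rm fin}(X)$; and $\mathcal{IC}^e_N(X)$ is the set of $f\in X$ whose corresponding family has infinitesimal cyclicity essentially bounded by $N$, i.e. there exists $Q\in\mathbb{N}$ such that $B(F,\tfrac pq)\le N$ for all coprime $p,q\in\mathbb{N}$ with $q\ge Q$.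
   Formalization: In the space of part (ii) the analytic continuation is also required to be continuous up to the closed strip |Im z| ≤ δ; without this the space is not separable, no cube measure exists, and the claim fails. *)

(* Defs.v *)
From HB Require Import structures.
From mathcomp Require Import all_boot all_order all_algebra.
From mathcomp Require Import complex ring.
From mathcomp Require Import all_classical all_reals all_analysis.
Set Implicit Arguments.
Unset Strict Implicit.
Unset Printing Implicit Defensive.
Import Order.TTheory GRing.Theory Num.Theory.
Import numFieldNormedType.Exports.
Local Open Scope classical_set_scope.
Local Open Scope ring_scope.

Section cube_null.
Context (R : realType).

Definition coord_cylinders : set (set (nat -> R)) :=
  [set A | exists n, exists2 B : set R, measurable B & A = [set t | B (t n)]].

Definition Rseq := g_sigma_algebraType coord_cylinders.

(* By uniqueness of measures these values on finite-dimensional boxes single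
   out the product of the uniform laws on [0, 1]; it is viewed as a probability
   on R^nat, carried by the cube. *)
Definition is_unit_cube_measure (P : probability Rseq R) : Prop :=
  forall (n : nat) (B : nat -> set R), (forall i, measurable (B i)) ->
    P [set t : Rseq | forall i, (i < n)%N -> B i (t i)] =
    (\prod_(i < n) lebesgue_measure (B i `&` `[0%R, 1%R]))%E.

Definition hilbert_cube : set Rseq := [set t | forall n, 0 <= t n <= 1].

Context (X : normedModType R).

(* [x n] is the vector written x_{n+1} in x_0 + \sum_{n >= 1} t_n x_n. *)
Definition lin_indep (x : nat -> X) : Prop :=
  forall (n : nat) (c : nat -> R),
    \sum_(i < n) c i *: x i = 0 -> forall i, (i < n)%N -> c i = 0.

Definition lin_span (x : nat -> X) : set X :=
  [set y | exists n, exists c : nat -> R, y = \sum_(i < n) c i *: x i].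

Definition cube_admissible (x : nat -> X) : Prop :=
  [/\ lin_indep x, dense (lin_span x) & cvgn (series (fun n => `|x n|))].

Definition cube_map (x0 : X) (x : nat -> X) (t : Rseq) : X :=
  x0 + limn (series (fun n => t n *: x n)).

(* mu_T(E) = 0, where mu_T is the image under T of the completed product
   measure. Completeness of X is only used to know that the series defining T
   converges, so it is not a parameter of the definition. *)
Definition cube_null (E : set X) : Prop :=
  forall (x0 : X) (x : nat -> X) (P : probability Rseq R),
    cube_admissible x -> is_unit_cube_measure P ->
    P.-negligible (hilbert_cube `&` cube_map x0 x @^-1` E).

Definition cube_prevalent (E : set X) : Prop := cube_null (~` E).

End cube_null.

Section cyclicity.
Context (R : realType).
Implicit Types (G : R -> R) (f : R -> R).

(* A circle diffeomorphism is given by a lift G : R -> R with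
   G (x + 2 * pi) = G x + 2 * pi, and points of the circle by reals modulo
   2 * pi.  "Attracting" means asymptotically stable (from both sides), not
   necessarily hyperbolic. *)
Definition attracting_fixpoint G (x : R) : Prop :=
  [/\ G x = x,
      forall e : R, 0 < e -> \forall y \near x, forall n, `|iter n G y - x| < e
    & \forall y \near x, (fun n => iter n G y) @ \oo --> x].

Definition attracting_periodic G (x : R) : Prop :=
  exists q : nat, exists2 p : int, (0 < q)%N &
    attracting_fixpoint (fun y => iter q G y - 2 * pi * p%:~R) x.

(* Saturated under translation by 2 * pi, so that distinct trajectories on the
   circle are exactly distinct sets. *)
Definition trajectory G (x : R) : set R :=
  [set y | exists n : nat, exists m : int, y = iter n G x + 2 * pi * m%:~R].

Definition nb_attracting G : \bar R :=
  counting [set trajectory G x | x in attracting_periodic G].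

(* Rotation number of the lift: a real number, equal to r for
   x |-> x + 2 * pi * r. *)
Definition rotation_number G : R :=
  limn (fun n => iter n G 0 / (2 * pi * n%:R)).

Definition circle_family f (r a : R) : R -> R :=
  fun x => x + 2 * pi * r + a * f x.

(* Only arbitrarily small a matter, and then (for C^1 functions f) every
   [circle_family f r a] is the lift of a diffeomorphism. *)
Definition inf_cyclicity f (rho0 : R) : \bar R :=
  limf_esup (fun a1 : R => ereal_sup
    [set nb_attracting (circle_family f ra.1 ra.2) | ra in
      [set ra : R * R | rotation_number (circle_family f ra.1 ra.2) = rho0
                        /\ `|ra.2| < a1]])
    0^'+.

(* X is a space of functions on the circle, ev f x the value of f at x. *)
Context (X : Type) (ev : X -> R -> R).

Definition IC_bounded (N : nat) : set X :=
  [set f | forall rho : R, (inf_cyclicity (ev f) rho <= N%:R%:E)%E].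

Definition IC_fin : set X := \bigcup_(N in [set N | (0 < N)%N]) IC_bounded N.

Definition IC_infty : set X := ~` IC_fin.

Definition IC_ess (N : nat) : set X :=
  [set f | exists Q : nat, forall p q : nat,
     (0 < q)%N -> coprime p q -> (Q <= q)%N ->
     (inf_cyclicity (ev f) (p%:R / q%:R) <= N%:R%:E)%E].

End cyclicity.

Section sup_norm.
Context (R : realType) (T : Type) (V : normedZmodType R).
Implicit Types (D : set T) (g h : T -> V).

Definition sup_norm D g : R := sup [set `|g x| | x in D].

Definition bounded_over D g := exists M : R, forall x, D x -> `|g x| <= M.

Lemma sup_norm_ub D g x : bounded_over D g -> D x -> `|g x| <= sup_norm D g.
Proof.
move=> [M gM] Dx; apply: ub_le_sup; last by exists x.
by exists M => _ [y Dy <-]; exact: gM.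
Qed.

Lemma sup_norm_le D g (M : R) : D !=set0 ->
  (forall x, D x -> `|g x| <= M) -> sup_norm D g <= M.
Proof.
move=> [x Dx] gM; apply: ge_sup; first by exists `|g x|, x.
by move=> _ [y Dy <-]; exact: gM.
Qed.

Lemma sup_normD D g h : D !=set0 -> bounded_over D g -> bounded_over D h ->
  sup_norm D (fun x => g x + h x) <= sup_norm D g + sup_norm D h.
Proof.
move=> D0 bg bh; apply: sup_norm_le => // x Dx.
by rewrite (le_trans (ler_normD _ _))// lerD// sup_norm_ub.
Qed.

Lemma sup_norm_ge0 D g : 0 <= sup_norm D g.
Proof.
rewrite /sup_norm; set A := [set _ | _ in _].
have [[[y [x Dx yE]] Au]|] := pselect (has_sup A); last by move/sup_out->.
by apply: le_trans (ub_le_sup Au (_ : A y)); [rewrite -yE|exists x].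
Qed.

Lemma sup_norm_eq0 D g x : bounded_over D g -> sup_norm D g = 0 -> D x -> g x = 0.
Proof.
by move=> bg g0 Dx; apply/eqP; rewrite -normr_le0 -g0; exact: sup_norm_ub.
Qed.

Lemma sup_norm_scale D g h (l : R) : D !=set0 -> bounded_over D g ->
  (forall x, D x -> `|h x| = `|l| * `|g x|) -> sup_norm D h = `|l| * sup_norm D g.
Proof.
move=> D0 bg hE.
have bh : bounded_over D h.
  by have [M gM] := bg; exists (`|l| * M) => x Dx; rewrite hE// ler_wpM2l// gM.
apply/eqP; rewrite eq_le; apply/andP; split.
  by apply: sup_norm_le => // x Dx; rewrite hE// ler_wpM2l// sup_norm_ub.
have [l0|l0] := eqVneq `|l| 0; first by rewrite l0 mul0r sup_norm_ge0.
have lp : 0 < `|l| by rewrite lt0r l0 /=.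
rewrite -ler_pdivlMl//; apply: sup_norm_le => // x Dx.
by rewrite ler_pdivlMl// -hE// sup_norm_ub.
Qed.

End sup_norm.

Section Ck.
Context (R : realType).

Definition Ck_pred (k : nat) : {pred (R -> R)} := fun f =>
  `[< [/\ forall x, f (x + 2 * pi) = f x,
          forall i, (i < k)%N -> forall x, derivable (derive1n i f) x 1
        & continuous (derive1n k f)] >].

Variable k : nat.

Lemma derive1n_lin (a : R) (f g : R -> R) :
  f \in Ck_pred k -> g \in Ck_pred k -> forall i, (i <= k)%N ->
  derive1n i (a *: f + g) = a *: derive1n i f + derive1n i g.
Proof.
move=> /asboolP[_ df _] /asboolP[_ dg _]; elim=> [//|i IH ik].
rewrite derive1nS IH 1?ltnW// !derive1nS; apply/funext => x.
rewrite derive1E deriveD; [|exact/derivableZ/df|exact: dg].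
rewrite deriveZ; last exact: df.
by rewrite -!derive1E.
Qed.

Lemma derive1n_0 i : derive1n i (0 : R -> R) = 0.
Proof.
elim: i => [//|i IH]; rewrite derive1nS IH; apply/funext => x.
exact: derive1_cst.
Qed.

Lemma Ck_submod_closed : submod_closed (Ck_pred k).
Proof.
split.
  apply/asboolP; split => [//|i ik x|]; rewrite derive1n_0.
    exact: derivable_cst.
  by move=> x; exact: cvg_cst.
move=> a f g fk gk; have fgE := derive1n_lin a fk gk.
move: fk gk => /asboolP[pf df cf] /asboolP[pg dg cg].
apply/asboolP; split => [x|i ik x|].
- by rewrite !fctE pf pg.
- rewrite fgE 1?ltnW//; apply: derivableD; last exact: dg.
  exact/derivableZ/df.
- rewrite fgE// => x; apply: cvgD; last exact: cg.
  exact: cvgZl_tmp (cf x).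
Qed.

HB.instance Definition _ := GRing.isSubmodClosed.Build _ _ (Ck_pred k)
  Ck_submod_closed.

Record CkS := MkCkS { CkS_fun :> R -> R; CkS_funP : CkS_fun \in Ck_pred k }.

HB.instance Definition _ := [isSub for CkS_fun].
HB.instance Definition _ := [Choice of CkS by <:].
HB.instance Definition _ := [SubChoice_isSubLmodule of CkS by <:].

Lemma periodic_int (g : R -> R) (m : int) x : (forall x, g (x + 2 * pi) = g x) ->
  g (x + 2 * pi * m%:~R) = g x.
Proof.
move=> pg; have H n y : g (y + 2 * pi * n%:R) = g y.
  elim: n y => [|n IH] y; first by rewrite mulr0 addr0.
  by rewrite -[n.+1]addn1 natrD mulrDr mulr1 addrA pg IH.
case: m => n; first exact: H.
by rewrite NegzE mulrNz mulrN -(H n.+1) subrK.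
Qed.

Lemma periodic_bounded (g : R -> R) : (forall x, g (x + 2 * pi) = g x) ->
  continuous g -> bounded_over setT g.
Proof.
move=> pg cg; have tpi0 : 0 < 2 * pi :> R by rewrite mulr_gt0// pi_gt0.
have [||c _ cP] := @EVT_max R (fun x => `|g x|) 0 (2 * pi); first exact: ltW.
  by apply: continuous_subspaceT => x; exact: (continuous_comp (cg x) (@norm_continuous _ _ _)).
exists `|g c| => x _; pose m := Num.floor (x / (2 * pi)).
have -> : g x = g (x + 2 * pi * (- m)%:~R) by rewrite periodic_int.
apply: cP; rewrite in_itv/= mulrNz mulrN.
have {1 2}-> : x = 2 * pi * (x / (2 * pi)).
  by rewrite mulrC divfK// gt_eqF.
have /andP[mx xm] := real_floor_itv (num_real (x / (2 * pi))).
rewrite -mulrBr mulr_ge0 ?(ltW tpi0) ?subr_ge0//= ler_piMr ?(ltW tpi0)//.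
by rewrite lerBlDl (le_trans (ltW xm))// intrD.
Qed.

Lemma derive1n_periodic (g : R -> R) i : (forall x, g (x + 2 * pi) = g x) ->
  forall x, derive1n i g (x + 2 * pi) = derive1n i g x.
Proof.
move=> pg; elim: i => // i IH x; rewrite !derive1nS /derive1.
by under eq_fun do rewrite addrA !IH.
Qed.

Lemma derive1n_continuous (f : CkS) i : (i <= k)%N -> continuous (derive1n i f).
Proof.
have /asboolP[_ df cf] := CkS_funP f.
rewrite leq_eqVlt => /predU1P[-> //|ik] x.
by apply: differentiable_continuous; apply/derivable1_diffP/df.
Qed.

Lemma derive1n_bounded (f : CkS) i : (i <= k)%N ->
  bounded_over setT (derive1n i f).
Proof.
have /asboolP[pf _ _] := CkS_funP f => ik.
by apply: periodic_bounded; [exact: derive1n_periodic|exact: derive1n_continuous].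
Qed.

Definition Ck_norm (f : CkS) : R :=
  \sum_(i < k.+1) sup_norm setT (derive1n i f).

Let setT0 : [set: R] !=set0. Proof. by exists 0. Qed.

Lemma Ck_normD f g : Ck_norm (f + g) <= Ck_norm f + Ck_norm g.
Proof.
rewrite /Ck_norm -big_split/=; apply: ler_sum => i _.
have ik : (i <= k)%N by rewrite -ltnS.
rewrite -[X in derive1n i X]/((f : R -> R) + g) -[X in X + _]scale1r.
rewrite derive1n_lin ?CkS_funP// scale1r.
by apply: sup_normD => //; exact: derive1n_bounded.
Qed.

Lemma Ck_normZ (l : R) f : Ck_norm (l *: f) = `|l| * Ck_norm f.
Proof.
rewrite /Ck_norm mulr_sumr; apply: eq_bigr => i _.
have ik : (i <= k)%N by rewrite -ltnS.
apply: sup_norm_scale => //; first exact: derive1n_bounded.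
move=> x _; rewrite -normrM; congr (`|_|).
have := derive1n_lin l (CkS_funP f) (CkS_funP 0) ik.
by rewrite derive1n_0 !addr0 => /(congr1 (@^~ x)).
Qed.

Lemma Ck_norm_eq0 f : Ck_norm f = 0 -> f = 0.
Proof.
move=> /eqP; rewrite psumr_eq0 => [|i _]; last exact: sup_norm_ge0.
move=> /allP/(_ ord0); rewrite mem_index_enum => /(_ isT)/eqP f0.
apply/val_inj/funext => x; rewrite -[RHS]/(0 : R).
by apply: (sup_norm_eq0 _ f0) => //; exact: (@derive1n_bounded f 0).
Qed.

HB.instance Definition _ :=
  Lmodule_isNormed.Build R CkS Ck_normD Ck_normZ Ck_norm_eq0.

End Ck.

Section analytic.
Context (K : numFieldType).
Implicit Types (F G : K -> K) (z : K).

Definition analytic_at F (z0 : K) : Prop :=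
  exists c : nat -> K, \forall z \near z0,
    series (fun n => c n * (z - z0) ^+ n) @ \oo --> F z.

Lemma analytic_atD F G z : analytic_at F z -> analytic_at G z ->
  analytic_at (fun z => F z + G z) z.
Proof.
move=> [c cF] [d dG]; exists (c + d).
near=> w; rewrite (_ : series _ = series (fun n => c n * (w - z) ^+ n) +
  series (fun n => d n * (w - z) ^+ n)).
  by apply: cvgD; near: w.
by rewrite -seriesD; congr series; apply/funext => n; rewrite !fctE mulrDl.
Unshelve. all: by end_near. Qed.

Lemma analytic_atZ (l : K) F z : analytic_at F z ->
  analytic_at (fun z => l * F z) z.
Proof.
move=> [c cF]; exists (fun n => l * c n).
near=> w; rewrite (_ : series _ = l *: series (fun n => c n * (w - z) ^+ n)).
  by apply: (cvgZl_tmp (k := l)); near: w.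
by rewrite -seriesZ; congr series; apply/funext => n; rewrite !fctE -mulrA.
Unshelve. all: by end_near. Qed.

Lemma analytic_at0 z : analytic_at (fun=> 0) z.
Proof.
exists (fun=> 0); near=> w; rewrite (_ : series _ = fun=> 0); first exact: cvg_cst.
by apply/funext => n; rewrite /series/= big1// => i _; rewrite mul0r.
Unshelve. all: by end_near. Qed.

Lemma within_continuous_lin (A : set K) (l : K) F G :
  {within A, continuous F} -> {within A, continuous G} ->
  {within A, continuous (fun z => l * F z + G z)}.
Proof.
move=> cF cG z; apply: cvgD; last exact: cG.
by apply: (cvgZl_tmp (k := l)); exact: cF.
Qed.

Lemma within_continuous_eq0 (A D : set K) F z :
  {within A, continuous F} -> A z -> D `<=` A -> (forall w, D w -> F w = 0) ->
  (forall e : K, 0 < e -> exists2 w, D w & `|z - w| < e) -> F z = 0.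
Proof.
move=> /subspace_continuousP cF Az DA F0 De.
apply/eqP/negPn/negP => Fz; have Fz0 : 0 < `|F z| by rewrite normr_gt0.
have /cvgrPdist_lt/(_ _ Fz0) := cF z Az.
rewrite near_withinE => /nbhs_ballP[e/= e0 eF].
have [w Dw zw] := De e e0.
have : `|F z - F w| < `|F z| := eF w zw (DA w Dw).
by rewrite (F0 w Dw) subr0 ltxx.
Qed.

Lemma within_continuous0 (A : set K) :
  {within A, continuous (fun=> 0 : K)}.
Proof. by apply: continuous_subspaceT => z; exact: cst_continuous. Qed.

End analytic.

Section Comega.
Context (R : realType).

Local Notation C := (R[i]^o).

Definition open_strip (delta : R) : set C := [set z | `|complex.Im z| < delta].

Definition closed_strip (delta : R) : set C :=
  [set z | `|complex.Im z| <= delta].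

(* An element of C^omega_delta is stored as its (unique) analytic continuation
   F, extended by 0 outside the closed strip to make the representative unique;
   the function itself is the restriction of F to the real axis. Continuity up
   to the boundary is needed for the space to be separable: the space of all
   bounded analytic functions on the open strip is not, so it carries no cube
   measure at all, and all its subsets would be vacuously cube null. *)
Definition strip_pred (delta : {posnum R}) : {pred (C -> Rcomplex R)} :=
  fun F =>
  `[< [/\ forall z, open_strip delta%:num z ->
            analytic_at (F : R[i] -> R[i]) z,
          {within closed_strip delta%:num, continuous (F : C -> C)},
          forall z, ~ closed_strip delta%:num z -> F z = 0
        & [/\ forall z, F (z + (2 * pi)%:C%C) = F z,
              forall x : R, complex.Im (F x%:C%C) = 0
            & bounded_over setT F]] >].

Lemma Rcomplex_scaleE (a : R) (w : Rcomplex R) : a *: w = (a%:C%C : R[i]) * w.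
Proof. by case: w => x y; rewrite /GRing.scale/= /GRing.mul/= !mul0r subr0 addr0. Qed.

Lemma Rcomplex_normZ (a : R) (w : Rcomplex R) : `|a *: w| = `|a| * `|w|.
Proof.
rewrite Rcomplex_scaleE -[LHS]/(Normc.normc _) Normc.normcM.
by congr (_ * _); rewrite /Normc.normc/= expr0n/= addr0 sqrtr_sqr.
Qed.

Variable delta : {posnum R}.

Lemma strip_submod_closed : submod_closed (strip_pred delta).
Proof.
split.
  apply/asboolP; split => // [z _| |]; first exact: (@analytic_at0 R[i]).
    exact: (@within_continuous0 R[i]).
  by split => //; exists 0 => z _; rewrite normr0.
move=> a F G /asboolP[aF cF vF [pF rF [M FM]]] /asboolP[aG cG vG [pG rG [N GN]]].
have E : a *: F + G = (fun z => (a%:C%C : C) * (F z : C) + G z).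
  by apply/funext => z; rewrite !fctE Rcomplex_scaleE.
apply/asboolP; split.
- by move=> z Dz; rewrite E; apply: analytic_atD; [apply: analytic_atZ; exact: aF|exact: aG].
- by rewrite E; exact: (@within_continuous_lin R[i]).
- by move=> z Dz; rewrite !fctE vF// vG// scaler0 addr0.
split=> [z|x|]; first by rewrite !fctE pF pG.
  rewrite E; move: (rF x) (rG x); case: (F _) => ? ? /= ->; case: (G _) => ? ? /= ->.
  by rewrite !mulr0 mul0r !addr0.
exists (`|a| * M + N) => z _; rewrite !fctE (le_trans (ler_normD _ _))//.
by rewrite lerD ?GN// Rcomplex_normZ ler_wpM2l// FM.
Qed.

HB.instance Definition _ := GRing.isSubmodClosed.Build _ _ (strip_pred delta)
  strip_submod_closed.

Record ComegaS := MkComegaS {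
  continuation :> R[i] -> Rcomplex R;
  continuationP : continuation \in strip_pred delta }.

HB.instance Definition _ := [isSub for continuation].
HB.instance Definition _ := [Choice of ComegaS by <:].
HB.instance Definition _ := [SubChoice_isSubLmodule of ComegaS by <:].

Definition Comega_norm (F : ComegaS) : R := sup_norm (open_strip delta%:num) F.

Lemma open_strip_neq0 : open_strip delta%:num !=set0.
Proof. by exists 0; rewrite /open_strip/= normr0. Qed.

Lemma continuation_bounded (F : ComegaS) :
  bounded_over (open_strip delta%:num) F.
Proof.
by have /asboolP[_ _ _ [_ _ [M FM]]] := continuationP F; exists M => x _; exact: FM.
Qed.

Definition real_restriction (F : ComegaS) (x : R) : R :=
  complex.Re (F x%:C%C).

Lemma Comega_normD F G : Comega_norm (F + G) <= Comega_norm F + Comega_norm G.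
Proof.
by apply: sup_normD; [exact: open_strip_neq0|exact: continuation_bounded..].
Qed.

Lemma Comega_normZ (l : R) F : Comega_norm (l *: F) = `|l| * Comega_norm F.
Proof.
apply: sup_norm_scale; [exact: open_strip_neq0|exact: continuation_bounded|].
by move=> z _; exact: Rcomplex_normZ.
Qed.

Lemma Comega_norm_eq0 F : Comega_norm F = 0 -> F = 0.
Proof.
move=> F0; apply/val_inj/funext => z; rewrite -[RHS]/(0 : Rcomplex R).
have o0 w : open_strip delta%:num w -> F w = 0.
  by move=> Dw; exact: (sup_norm_eq0 (@continuation_bounded F) F0).
have /asboolP[_ cF vF _] := continuationP F.
have [zc|/vF//] := pselect (closed_strip delta%:num z).
apply: (@within_continuous_eq0 R[i] _ (open_strip delta%:num) F z cF zc _ o0).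
  by move=> w; rewrite /open_strip/closed_strip/= => /ltW.
move=> e e0; have [r r0 er] : exists2 r : R, 0 < r & e = r%:C%C.
  by move: e e0 => [r s]; rewrite ltcE/= => /andP[/eqP -> r0]; exists r.
have d0 : 0 < delta%:num :> R by [].
set d := delta%:num in d0 zc *.
move: zc; rewrite /closed_strip/=; case: z => x y /= yd.
have rd : 0 < r + d by exact: addr_gt0.
exists (x +i* (d / (r + d) * y))%C.
  rewrite /open_strip/= normrM gtr0_norm ?divr_gt0//.
  apply: (@le_lt_trans _ _ (d / (r + d) * d)).
    by apply: ler_wpM2l => //; rewrite divr_ge0// ltW.
  by rewrite gtr_pMl// ltr_pdivrMr// mul1r ltrDr.
rewrite er; have -> : (x +i* y - x +i* (d / (r + d) * y))%C =
    (0 +i* (r / (r + d) * y))%C.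
  apply/eqP; rewrite eq_complex/= subrr eqxx/= -[X in X - _]mul1r -mulrBl.
  by apply/eqP; congr (_ * _); field; rewrite gt_eqF.
rewrite normc_def/= expr0n/= add0r sqrtr_sqr ltcR normrM gtr0_norm ?divr_gt0//.
apply: (@le_lt_trans _ _ (r / (r + d) * d)).
  by apply: ler_wpM2l => //; rewrite divr_ge0// ltW.
by rewrite mulrAC ltr_pdivrMr// ltr_pM2l// ltrDr.
Qed.

HB.instance Definition _ := Lmodule_isNormed.Build R ComegaS
  Comega_normD Comega_normZ Comega_norm_eq0.

End Comega.

(* Main.v *)
(* Each of the three sets misses a whole cube. Let c_k = kap^(k^2), and take
   for x_0 a series \sum_(k in S) c_k cos (k x) and for x_n multiples eps_n e_n of
   the functions cos (k x), sin (k x), with eps_n so small that the coefficient of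
   every point of the cube at a frequency k in S stays close to c_k, and that its
   other coefficients are negligible compared with the c_k of lower frequency.
   At rotation number p / q, the q-th iterate of x |-> x + 2 pi r + a f x is, up to
   O(a^2), the translation by 2 pi q r plus a times the sum of f over the orbit of
   the rotation; that sum only keeps the frequencies divisible by q, and the lowest
   one in S dominates.
   - If S contains all frequencies, it is cos (q x): the displacement has the
     sign pattern of one wave per period 2 pi / q, so there is at most one attracting
     trajectory, and the infinitesimal cyclicity is at most 1 everywhere.
   - If S consists of the frequencies m * m!, then at 1 / m! it is cos (m m! x) and
     there are m attracting trajectories for suitable r, so the cyclicity is neither
     bounded nor essentially bounded by 1.
   The cube is admissible because trigonometric polynomials are dense. In a closed
   strip this follows from the Fejer kernel, discretized over the rotations of order
   N: the coefficients are then means of G over z + 2 pi j / N, which tend to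
   constants because they are almost invariant under horizontal translations and
   satisfy the Cauchy-Riemann equations. The strip of width 0 gives density in C^0,
   and integration gives it in C^k. *)
Require Import Defs.
From HB Require Import structures.
From mathcomp Require Import all_boot all_order all_algebra.
From mathcomp Require Import complex finmap.
From mathcomp Require Import all_classical all_reals all_analysis.
From mathcomp Require Import measurable_realfun.
From mathcomp Require Import zify ring lra.
Set Implicit Arguments.
Unset Strict Implicit.
Unset Printing Implicit Defensive.
Import Order.TTheory GRing.Theory Num.Theory.
Import numFieldNormedType.Exports.
Local Open Scope classical_set_scope.
Local Open Scope ring_scope.

(** * Series with geometrically decaying terms *)

Section tsum.
Context {R : realType}.
Implicit Types (u v b : nat -> R).

(** Cube nullity quantifies over all laws with the product values on boxes, so refuting it requires
    such a law: it is built from the binary digits of one uniform number. Every point of the cube,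
    not only almost every one, then lies in the set under study, so full mass of the cube suffices.

    A displacement known up to a small relative error does not by itself bound the number of
    attracting cycles: r may shift it towards an extremum of the cosine, where small errors could
    create many zeros. Two derivatives settle this. Zeros of the first derivative stay near those of
    sin (q x), zeros of the second near those of cos (q x), whatever the shift; by Rolle, five zeros
    of the displacement force six alternations between the two, which take 9 pi / (4 q), whereas two
    distinct attracting trajectories would give five zeros within 17 pi / (8 q). The relative errors
    1/20 and 1/10 are small enough for this comparison, and q is fixed before a, so the O(a^2) error
    is harmless.

    The lower bound has no such difficulty: r is chosen there, and transversal zeros persist. *)

Definition tsum u : R := limn (series u).

Definition geo u := exists M : R, forall n, `|u n| <= M / 2 ^+ n.

Lemma geo_le u (M : R) : (forall n, `|u n| <= M / 2 ^+ n) ->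
  [/\ 0 <= M, cvgn (series u) & `|tsum u| <= 2 * M].
Proof.
move=> uM; have M0 : 0 <= M.
  by have := le_trans (normr_ge0 _) (uM 0%N); rewrite expr0 divr1.
have half : `|2^-1 : R| < 1 by rewrite ger0_norm ?invr_ge0// invf_lt1// ltr1n.
have gE n : geometric M 2^-1 n = M / 2 ^+ n by rewrite /geometric/= exprVn.
have cg := @cvg_geometric_series R M 2^-1 half.
have cn : cvgn [normed series u].
  apply: (@series_le_cvg _ _ (geometric M 2^-1)) => [n|n|n|].
  - exact: normr_ge0.
  - by rewrite [leRHS](gE n) divr_ge0// exprn_ge0.
  - by rewrite [leRHS](gE n); exact: uM.
  - exact: is_cvg_geometric_series.
split=> //; first exact: (@normed_cvg R R^o).
apply: le_trans (@lim_series_norm R R^o u cn) _.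
have <- : limn (series (geometric M 2^-1)) = 2 * M.
  rewrite (cvg_lim _ cg)//; have -> : (1 - 2^-1 : R) = 2^-1 by field.
  by rewrite invrK mulrC.
apply: lim_series_le => [//||n]; first exact: is_cvg_geometric_series.
by rewrite [leRHS](gE n); exact: uM.
Qed.

Lemma geo_cvg u : geo u -> cvgn (series u).
Proof. by move=> [M /geo_le[]]. Qed.

Lemma le_geo u v (c : R) : geo v -> (forall n, `|u n| <= c * `|v n|) -> geo u.
Proof.
move=> [M vM] uv; exists (`|c| * M) => n; rewrite (le_trans (uv n))// -mulrA.
apply: (@le_trans _ _ (`|c| * `|v n|)); first by rewrite ler_wpM2r ?ler_norm.
by rewrite ler_wpM2l.
Qed.

Lemma geoD u v : geo u -> geo v -> geo (fun n => u n + v n).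
Proof.
move=> [M uM] [N vN]; exists (M + N) => n.
by rewrite mulrDl (le_trans (ler_normD _ _))// lerD.
Qed.

Lemma geoZ (c : R) u : geo u -> geo (fun n => c * u n).
Proof. by move=> ug; apply: (@le_geo _ u `|c|) => // n; rewrite normrM. Qed.

Lemma geoN u : geo u -> geo (fun n => - u n).
Proof. by move=> [M uM]; exists M => n; rewrite normrN. Qed.

Lemma geo0 : geo (fun=> 0).
Proof. by exists 0 => n; rewrite normr0 mul0r. Qed.

Lemma tsumD u v : geo u -> geo v -> tsum (fun n => u n + v n) = tsum u + tsum v.
Proof. by move=> /geo_cvg ug /geo_cvg vg; exact: lim_seriesD. Qed.

Lemma tsumZ (c : R) u : geo u -> tsum (fun n => c * u n) = c * tsum u.
Proof. by move=> /geo_cvg ug; exact: lim_seriesZ. Qed.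

Lemma tsumN u : geo u -> tsum (fun n => - u n) = - tsum u.
Proof. by move=> /geo_cvg ug; exact: lim_seriesN. Qed.

Lemma tsumB u v : geo u -> geo v -> tsum (fun n => u n - v n) = tsum u - tsum v.
Proof. by move=> ug vg; rewrite tsumD ?tsumN//; exact: geoN. Qed.

Lemma eq_tsum u v : (forall n, u n = v n) -> tsum u = tsum v.
Proof. by move=> uv; congr (limn (series _)); exact/funext. Qed.

Lemma tsum0 : tsum (fun=> 0) = 0.
Proof.
rewrite -[RHS](mul0r (tsum (fun=> 0))) -tsumZ; last exact: geo0.
by apply: eq_tsum => n; rewrite mul0r.
Qed.

Lemma ler_tsum u v : geo u -> geo v -> (forall n, u n <= v n) -> tsum u <= tsum v.
Proof. by move=> /geo_cvg ug /geo_cvg vg uv; exact: lim_series_le. Qed.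

Lemma tsum_norm u v : geo v -> (forall n, `|u n| <= v n) -> `|tsum u| <= tsum v.
Proof.
move=> vg uv; have v0 n : 0 <= v n by exact: le_trans (uv n).
have ug : geo u by apply: (@le_geo _ v 1) => // n; rewrite mul1r (ger0_norm (v0 n)).
rewrite ler_norml -tsumN// !ler_tsum//; [|exact: geoN|] => n.
- by have := uv n; rewrite ler_norml => /andP[].
- by have := uv n; rewrite ler_norml => /andP[].
Qed.

Lemma tsum_ge0 u : geo u -> (forall n, 0 <= u n) -> 0 <= tsum u.
Proof. by move=> ug u0; rewrite -tsum0 ler_tsum//; exact: geo0. Qed.

Lemma tsum_sum (I : Type) (r : seq I) (u : I -> nat -> R) :
  (forall i, geo (u i)) ->
  geo (fun n => \sum_(i <- r) u i n) /\
  tsum (fun n => \sum_(i <- r) u i n) = \sum_(i <- r) tsum (u i).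
Proof.
move=> ug; elim: r => [|i r [gr IH]].
  rewrite big_nil; split; last by rewrite -[RHS]tsum0; apply: eq_tsum => n; rewrite big_nil.
  by under eq_fun do rewrite big_nil; exact: geo0.
have E n : \sum_(j <- i :: r) u j n = u i n + \sum_(j <- r) u j n by rewrite big_cons.
split; first by under eq_fun do rewrite E; exact: geoD.
by rewrite (eq_tsum E) tsumD// IH big_cons.
Qed.

Lemma tsum_cvg u : geo u -> series u @ \oo --> tsum u.
Proof. by move/geo_cvg. Qed.

Lemma geo_shift u : geo u -> geo (fun n => u n.+1).
Proof.
move=> [M uM]; exists (M / 2) => n; rewrite (le_trans (uM _))//.
by rewrite exprS invfM mulrA.
Qed.

Lemma tsum_recl u : geo u -> tsum u = u 0%N + tsum (fun n => u n.+1).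
Proof.
move=> ug; apply/cvg_lim => //; rewrite -(@cvg_shiftS R).
rewrite (_ : [sequence _]_n = (fun n => u 0%N + series (fun n => u n.+1) n)).
  by apply: cvgD; [exact: cvg_cst|exact/tsum_cvg/geo_shift].
by apply/funext => n; rewrite /= /series/= big_nat_recl//.
Qed.

Lemma geo_delta (m : nat) (c : R) : geo (fun n => c *+ (n == m)).
Proof.
exists (`|c| * 2 ^+ m) => n; have [->|] := eqVneq n m.
  by rewrite mulr1n mulfK.
by rewrite mulr0n normr0 divr_ge0// mulr_ge0.
Qed.

Lemma tsum_delta (m : nat) (c : R) : tsum (fun n => c *+ (n == m)) = c.
Proof.
apply/cvg_lim => //; apply: cvg_near_cst; near=> n.
have mn : (m < n)%N by near: n; exact: nbhs_infty_gt.
rewrite /series/= big_mkord (bigD1 (Ordinal mn))//=.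
by rewrite eqxx mulr1n big1 ?addr0// => i; rewrite -val_eqE/= => /negbTE ->.
Unshelve. all: by end_near. Qed.

(** Decay faster than every exponential. The class is stable under the polynomial weights of
    differentiation and the exponential weights of a complex strip, so one notion serves both
    function spaces. *)
Definition rapid b := forall L : R, exists M : R,
  forall n, `|b n| * expR (L * n%:R) <= M.

Lemma pow2_le_expR n : 2 ^+ n <= expR (n%:R) :> R.
Proof.
rewrite -[n%:R]mulr1 expRM_natl lerXn2r ?nnegrE ?expR_ge0//.
by rewrite (le_trans _ (expR_ge1Dx 1)).
Qed.

Lemma rapid_geo b u (C L : R) : rapid b ->
  (forall n, `|u n| <= C * (`|b n| * expR (L * n%:R))) -> geo u.
Proof.
move=> /(_ (L + 1))[M bM] uC; exists (`|C| * M) => n.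
rewrite (le_trans (uC n))// ler_pdivlMr ?exprn_gt0// -mulrA.
apply: (@le_trans _ _ (`|C| * (`|b n| * expR (L * n%:R) * 2 ^+ n))).
  by rewrite ler_wpM2r ?ler_norm// !mulr_ge0 ?expR_ge0 ?exprn_ge0.
rewrite ler_wpM2l// (le_trans _ (bM n))// mulrDl mul1r expRD mulrA.
by rewrite ler_wpM2l ?pow2_le_expR// mulr_ge0// expR_ge0.
Qed.

Lemma le_rapid b b' (C L : R) : rapid b ->
  (forall n, `|b' n| <= C * (`|b n| * expR (L * n%:R))) -> rapid b'.
Proof.
move=> rb bb L'; have [M bM] := rb (L + L'); exists (`|C| * M) => n.
rewrite (le_trans (ler_wpM2r (expR_ge0 _) (bb n)))//.
apply: (@le_trans _ _ (`|C| * (`|b n| * expR (L * n%:R)) * expR (L' * n%:R))).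
  by rewrite !ler_wpM2r ?expR_ge0 ?ler_norm// mulr_ge0// expR_ge0.
by rewrite -!mulrA ler_wpM2l// -expRD -mulrDl.
Qed.

End tsum.

(** * The uniform law on the Hilbert cube *)

Section binary_digits.
Context {R : realType}.

Definition unit_law : probability (measurableTypeR R) R := uniform_prob (@ltr01 R).

Lemma unit_lawE (A : set R) : measurable A ->
  unit_law A = lebesgue_measure (A `&` `[0%R, 1%R]).
Proof.
move=> mA; rewrite /unit_law/= /uniform_prob integral_uniform_pdf.
rewrite (eq_integral (fun=> 1%E)); last first.
  move=> x; rewrite inE/= in_itv/= => -[_ /= x01].
  by rewrite /uniform_pdf x01 subr0 invr1.
by rewrite integral_cst/= ?mul1e//; apply: measurableI.
Qed.

(** The tail function of the uniform law on [0, 1]. *)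
Definition ray_mass (s : R) : R := if s < 0 then 1 else if s < 1 then 1 - s else 0.

Lemma ray_massE s : unit_law `]s, +oo[%classic = (ray_mass s)%:E.
Proof.
rewrite unit_lawE//= /ray_mass; case: (ltP s 0) => s0.
  have -> : `]s, +oo[ `&` `[0%R, 1%R] = `[0%R, 1%R]%classic :> set R.
    by apply/seteqP; split => [x []//|x] /= x01; split => //; move: x01; rewrite !in_itv/= =>
        /andP[x0 _]; rewrite andbT (lt_le_trans s0).
  by rewrite lebesgue_measure_itv/= lte_fin ltr01 oppr0 adde0.
have -> : `]s, +oo[ `&` `[0%R, 1%R] = `]s, 1%R]%classic :> set R.
  apply/seteqP; split => [x|x] /=; rewrite !in_itv/= ?andbT.
    by move=> [-> /andP[]].
  by move=> /andP[sx ->]; rewrite sx (ltW (le_lt_trans s0 sx)).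
rewrite lebesgue_measure_itv/= lte_fin; case: ifP => // _.
Qed.

Local Opaque unit_law.

(** The refinement equation of the tail function: the first binary digit is fair and what follows it
    is again uniform. *)
Lemma ray_mass_half s : ray_mass s = 2^-1 * (ray_mass (2 * s) + ray_mass (2 * s - 1)).
Proof.
rewrite /ray_mass; case: (ltP s 0) => s0; case: (ltP (2 * s) 0) => s1;
  case: (ltP (2 * s - 1) 0) => s2; case: (ltP s 1) => s3;
  case: (ltP (2 * s) 1) => s4; case: (ltP (2 * s - 1) 1) => s5; lra.
Qed.

Lemma preimage_measurable (f : R -> R) (A : set R) : measurable_fun setT f ->
  measurable A -> measurable (f @^-1` A).
Proof. by move=> mf mA; rewrite -[X in measurable X]setTI; exact: mf. Qed.

(** Open rays are stable under intersection and generate the Borel sets, so two finite measures that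
    agree on them agree everywhere. *)
Lemma law_of_rays (f : R -> R) (C : set R) (c : R) :
  measurable_fun setT f -> measurable C -> 0 <= c ->
  (forall s, unit_law (C `&` f @^-1` `]s, +oo[) = (c * ray_mass s)%:E) ->
  forall A : set R, measurable A -> unit_law (C `&` f @^-1` A) = (c%:E * unit_law A)%E.
Proof.
move=> mf mC c0 H A mA.
have mf' : measurable_fun [set: measurableTypeR R] (f : measurableTypeR R -> measurableTypeR R) :=
    mf.
pose m0 : {measure set (measurableTypeR R) -> \bar R} := mrestr unit_law mC.
pose m1 : {measure set (measurableTypeR R) -> \bar R} :=
  measure_function_pushforward__canonical__measure_function_Measure m0 mf'.
pose m2 : {measure set (measurableTypeR R) -> \bar R} := mscale (NngNum c0) unit_law.
have E1 B : m1 B = unit_law (C `&` f @^-1` B) by rewrite setIC.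
rewrite -E1; have -> : (c%:E * unit_law A)%E = m2 A by [].
have H0 := RGenOInfty.measurableE R.
pose g (k : nat) : set (measurableTypeR R) := `](- k%:R : R), +oo[%classic.
have H1 := @measure_unique _ R (measurableTypeR R) (@RGenOInfty.G R) g H0.
apply: (H1 _ _ _ m1 m2) => //.
- move=> _ _ [x ->] [y ->]; exists (Num.max x y); apply/seteqP; split => z /=.
    by rewrite !in_itv/= !andbT gt_max => -[-> ->].
  by rewrite !in_itv/= !andbT gt_max => /andP.
- by move=> k; eexists.
- apply/seteqP; split => // x _; exists (Num.truncn `|x|).+1 => //=.
  rewrite /g/= in_itv/= andbT ltrNl (le_lt_trans (ler_norm _))// normrN.
  by rewrite truncnS_gt.
- by move=> _ [s ->]; rewrite E1 H/= /mscale/= ray_massE EFinM.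
- move=> k; rewrite E1 (@le_lt_trans _ _ 1%E)// ?ltry//.
  apply: probability_le1; apply: measurableI => //.
  by apply: (preimage_measurable mf); exact: measurable_itv.
Qed.

Definition bit (u : R) : bool := 2^-1 <= u.

(** The doubling map: it removes the first binary digit, read by [bit]. The endpoint 1 is fixed,
    with all digits equal to 1. *)
Definition dbl (u : R) : R := 2 * u - (bit u)%:R.

Lemma measurable_bit (b : bool) : measurable [set u | bit u = b].
Proof.
case: b.
  rewrite (_ : [set _ | _] = `[2^-1, +oo[%classic)//.
  by apply/seteqP; split => x /=; rewrite in_itv/= andbT.
rewrite (_ : [set _ | _] = `]-oo, 2^-1[%classic)//.
by apply/seteqP; split => x /=; rewrite in_itv/= /bit; case: leP.
Qed.

Lemma measurable_fun_bit : measurable_fun setT (fun u => (bit u)%:R : R).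
Proof.
rewrite (_ : (fun u => _) = (fun u : R => if 2^-1 <= u then 1 else 0)); last first.
  by apply/funext => u; rewrite /bit; case: ifP.
apply: measurable_fun_if => //=.
by apply: measurable_fun_ler.
Qed.

Lemma measurable_dbl : measurable_fun setT dbl.
Proof.
apply: measurable_funB; last exact: measurable_fun_bit.
exact: measurable_funM.
Qed.

Lemma measurable_iter_dbl n : measurable_fun setT (iter n dbl).
Proof.
elim: n => [|n IH]; first exact: measurable_id.
exact: (measurableT_comp measurable_dbl IH).
Qed.


(** Independence of the first digit and the remaining ones. On rays it is a computation with
    explicit intervals, one for each digit and each position of s with respect to 0 and 1. *)
Lemma law_dbl (b : bool) (A : set R) : measurable A ->
  unit_law ([set u | bit u = b] `&` dbl @^-1` A) = (2^-1%:E * unit_law A)%E.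
Proof.
move=> mA; apply: law_of_rays => //.
- exact: measurable_dbl.
- exact: measurable_bit.
move=> s; rewrite unit_lawE; last first.
  apply: measurableI; first exact: measurable_bit.
  by apply: preimage_measurable => //; exact: measurable_dbl.
rewrite /ray_mass; case: ltP => s0; last case: ltP => s1.
- case: b.
    rewrite (_ : _ `&` _ = `[2^-1, 1]%classic); last first.
      apply/seteqP; split => x /=; rewrite !in_itv/= /dbl /bit ?andbT.
        by move=> [[-> _] /andP[_ ->]].
      by move=> /andP[x1 x2]; rewrite x1/=; repeat split => //; lra.
    by rewrite lebesgue_measure_itv/= lte_fin ifT; [congr (_%:E); lra|lra].
  rewrite (_ : _ `&` _ = `[0, 2^-1[%classic); last first.
    apply/seteqP; split => x /=; rewrite !in_itv/= /dbl /bit ?andbT.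
      by move=> [[x2 _] /andP[-> _]]; lra.
    move=> /andP[x1 x2]; have -> : (2^-1 <= x) = false by lra.
    by repeat split => //=; lra.
  by rewrite lebesgue_measure_itv/= lte_fin ifT; [congr (_%:E); lra|lra].
- case: b.
    rewrite (_ : _ `&` _ = `](s + 1) / 2, 1]%classic); last first.
      apply/seteqP; split => x /=; rewrite !in_itv/= /dbl /bit ?andbT.
        by move=> [[-> /= x1] /andP[_ x2]]; lra.
      move=> /andP[x1 x2]; have -> : (2^-1 <= x) by lra.
      by repeat split => //=; lra.
    by rewrite lebesgue_measure_itv/= lte_fin ifT; [congr (_%:E); lra|lra].
  rewrite (_ : _ `&` _ = `]s / 2, 2^-1[%classic); last first.
    apply/seteqP; split => x /=; rewrite !in_itv/= /dbl /bit ?andbT.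
      by move=> [[xb]]; rewrite xb/= => x1 /andP[x2 _]; move: xb; case: leP => // *; lra.
    move=> /andP[x1 x2]; have -> : (2^-1 <= x) = false by lra.
    by repeat split => //=; lra.
  by rewrite lebesgue_measure_itv/= lte_fin ifT; [congr (_%:E); lra|lra].
rewrite (_ : _ `&` _ = set0) ?measure0 ?mulr0//.
apply/seteqP; split => x //=; rewrite !in_itv/= /dbl /bit ?andbT.
by move=> [[_ x1] /andP[x2 x3]]; move: x1; case: (leP 2^-1 x) => /= *; lra.
Qed.

Lemma law_split (A : set R) : measurable A ->
  unit_law A = (unit_law ([set u | bit u = true] `&` A) +
                unit_law ([set u | bit u = false] `&` A))%E.
Proof.
move=> mA; rewrite -measureU; first by rewrite -setIUl; congr (unit_law _); apply/seteqP; split =>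
    x /=; [case: (bit x); tauto|tauto].
- by apply: measurableI => //; exact: measurable_bit.
- by apply: measurableI => //; exact: measurable_bit.
- by apply/seteqP; split => x //= [[-> _] []].
Qed.


Lemma law_dbl2 (a b : bool) (A : set R) : measurable A ->
  unit_law ([set u | bit u = a] `&`
    dbl @^-1` ([set u | bit u = b] `&` dbl @^-1` A)) = (4^-1%:E * unit_law A)%E.
Proof.
move=> mA; have mA' : measurable (dbl @^-1` A).
  by apply: preimage_measurable => //; exact: measurable_dbl.
rewrite law_dbl; last by apply: measurableI => //; exact: measurable_bit.
by rewrite law_dbl// muleA -EFinM; congr (_%:E * _)%E; field.
Qed.

Lemma law_split2 (A : set R) : measurable A ->
  unit_law A = (\sum_(ab <- [:: (true, true); (true, false); (false, true); (false, false)])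
     unit_law ([set u | bit u = ab.1] `&` ([set u | bit (dbl u) = ab.2] `&` A)))%E.
Proof.
move=> mA; have mB b : measurable [set u | bit (dbl u) = b].
  apply: (preimage_measurable measurable_dbl (measurable_bit b)).
have mBA b : measurable ([set u | bit (dbl u) = b] `&` A) by exact: measurableI.
have mb b : measurable [set u | bit u = b] by exact: measurable_bit.
rewrite !big_cons big_nil adde0 /=.
have E b : unit_law ([set u | bit u = b] `&` A) =
    (unit_law ([set u | bit u = b] `&` ([set u | bit (dbl u) = true] `&` A)) +
     unit_law ([set u | bit u = b] `&` ([set u | bit (dbl u) = false] `&` A)))%E.
  have mbBA b' := measurableI _ _ (mb b) (mBA b').
  apply: (etrans _ (measureU unit_law (mbBA true) (mbBA false) _)).
    congr (unit_law _); apply/seteqP; split => x /=; last by tauto.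
    by case: (bit (dbl x)); tauto.
  by apply/seteqP; split => x //= [[_ [-> _]] [_ []]].
by rewrite law_split// !E -!addeA.
Qed.

(* [deinterleave d u] has as binary digits the digits of [u] at positions
   congruent to [d] modulo 2. *)
Definition deinterleave (d : nat) (u : R) : R :=
  tsum (fun n => (bit (iter (2 * n + d) dbl u))%:R / 2 * 2^-1 ^+ n).

Lemma geo_digits d u : geo (fun n => (bit (iter (2 * n + d) dbl u))%:R / 2 * 2^-1 ^+ n : R).
Proof.
exists 1 => n; rewrite -exprVn ger0_norm; last by rewrite !mulr_ge0// exprn_ge0// invr_ge0.
rewrite ler_wpM2r// ?exprn_ge0 ?invr_ge0//.
by case: (bit _) => /=; lra.
Qed.

Lemma deinterleave_ge0 d u : 0 <= deinterleave d u.
Proof.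
apply: tsum_ge0 => [|n]; first exact: geo_digits.
by rewrite !mulr_ge0 ?exprn_ge0 ?invr_ge0.
Qed.

Lemma deinterleave_rec d u :
  deinterleave d u = (bit (iter d dbl u))%:R / 2 + 2^-1 * deinterleave d (dbl (dbl u)).
Proof.
rewrite {1}/deinterleave tsum_recl; last exact: geo_digits.
rewrite muln0 add0n expr0 mulr1; congr (_ + _).
rewrite -tsumZ; last exact: geo_digits.
apply: eq_tsum => n; rewrite -iterSr -iterSr exprS.
have -> : (2 * n.+1 + d = (2 * n + d).+2)%N by lia.
by ring.
Qed.

Lemma deinterleave_le1 d u : deinterleave d u <= 1.
Proof.
have cg : geo (fun n => 2^-1 * 2^-1 ^+ n : R).
  exists 1 => n; rewrite -exprVn ger0_norm ?mulr_ge0 ?exprn_ge0 ?invr_ge0//.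
  by rewrite ler_wpM2r ?exprn_ge0 ?invr_ge0//; lra.
have E : tsum (fun n => 2^-1 * 2^-1 ^+ n : R) = 1.
  have := @cvg_geometric_series R 2^-1 2^-1 _.
  rewrite ger0_norm ?invr_ge0// invf_lt1// ltr1n => /(_ isT) /cvg_lim H.
  by rewrite /tsum [LHS]H//; field.
rewrite -E; apply: ler_tsum => // [|n]; first exact: geo_digits.
by rewrite ler_wpM2r ?exprn_ge0 ?invr_ge0//; case: (bit _) => /=; lra.
Qed.

Lemma measurable_deinterleave d : measurable_fun setT (deinterleave d).
Proof.
apply: (@measurable_fun_cvg _ _ R setT (fun m u => series (fun n =>
    (bit (iter (2 * n + d) dbl u))%:R / 2 * 2^-1 ^+ n) m)); last first.
  by move=> u _; exact/tsum_cvg/geo_digits.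
move=> m; apply: measurable_sum => n.
apply: measurable_funM => //; apply: measurable_funM => //.
exact: (measurableT_comp measurable_fun_bit (measurable_iter_dbl _)).
Qed.

(** The event whose probability is the joint tail function of the two deinterleaved numbers. *)
Let box (s s' : R) : set R :=
  deinterleave 0 @^-1` `]s, +oo[ `&` deinterleave 1 @^-1` `]s', +oo[.

Let mbox s s' : measurable (box s s').
Proof. by apply: measurableI; apply: preimage_measurable => //; exact: measurable_deinterleave. Qed.

Let boxE s s' (a b : bool) :
  [set u | bit u = a] `&` ([set u | bit (dbl u) = b] `&` box s s') =
  [set u | bit u = a] `&` dbl @^-1` ([set u | bit u = b] `&`
     dbl @^-1` (box (2 * s - a%:R) (2 * s' - b%:R))).
Proof.
by apply/seteqP; split => u; rewrite /box/= !in_itv/= !andbT;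
  move=> [ua [ub]]; rewrite (deinterleave_rec 0 u) (deinterleave_rec 1 u)/= ua ub => -[h h'];
  do ! split => //; lra.
Qed.

Let boxF s s' : unit_law (box s s') \is a fin_num.
Proof. by apply: fin_num_measure; exact: mbox. Qed.

Let mass s s' := fine (unit_law (box s s')).

Let massF s s' : unit_law (box s s') = (mass s s')%:E.
Proof. by rewrite /mass fineK. Qed.

(** The two-dimensional refinement equation: the first digit of u is the leading digit of one
    deinterleaved number, the second digit that of the other, and the four pairs are equally
    likely. *)
Let mass_rec s s' : mass s s' = 4^-1 *
  (mass (2 * s - 1) (2 * s' - 1) + mass (2 * s - 1) (2 * s') +
   mass (2 * s) (2 * s' - 1) + mass (2 * s) (2 * s')).
Proof.
rewrite {1}/mass law_split2; last exact: mbox.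
rewrite !big_cons big_nil/= adde0 !boxE !law_dbl2; try exact: mbox.
by rewrite /= !subr0 !massF -!EFinM -!EFinD/=; ring.
Qed.

Let mass_le1 s s' : 0 <= mass s s' <= 1.
Proof.
rewrite -!lee_fin -massF measure_ge0/=.
exact: (@probability_le1 _ _ _ unit_law _ (mbox s s')).
Qed.

Let mass_ge1l s s' : 1 <= s -> mass s s' = 0.
Proof.
move=> s1; rewrite /mass (_ : box _ _ = set0) ?measure0//.
apply/seteqP; split => u //= [] /=; rewrite !in_itv/= andbT => + _.
by rewrite ltNge (le_trans (deinterleave_le1 _ _)).
Qed.

Let mass_ge1r s s' : 1 <= s' -> mass s s' = 0.
Proof.
move=> s1; rewrite /mass (_ : box _ _ = set0) ?measure0//.
apply/seteqP; split => u //= [] /=; rewrite !in_itv/= !andbT => _.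
by rewrite ltNge (le_trans (deinterleave_le1 _ _)).
Qed.

Let mass_lt0 s s' : s < 0 -> s' < 0 -> mass s s' = 1.
Proof.
move=> s0 s0'; rewrite /mass (_ : box _ _ = setT) ?probability_setT//.
apply/seteqP; split => u //= _; rewrite /box/= !in_itv/= !andbT.
by rewrite !(lt_le_trans _ (deinterleave_ge0 _ _)).
Qed.

(* The difference of the two sides solves the same refinement equation, and one
   of its four terms always vanishes, so it contracts by 3/4. *)
Let massE s s' : mass s s' = ray_mass s * ray_mass s'.
Proof.
have r0 (x : R) : 1 <= x -> ray_mass x = 0.
  by move=> x1; rewrite /ray_mass !ltNge x1 (le_trans ler01 x1).
have r1 (x : R) : x < 0 -> ray_mass x = 1 by move=> x0; rewrite /ray_mass x0.
have r01 (x : R) : 0 <= ray_mass x <= 1.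
  by rewrite /ray_mass; case: (ltP x 0); case: (ltP x 1); lra.
pose d x y := mass x y - ray_mass x * ray_mass y.
have d0l x y : 1 <= x -> d x y = 0 by move=> x1; rewrite /d mass_ge1l// r0// mul0r subrr.
have d0r x y : 1 <= y -> d x y = 0 by move=> x1; rewrite /d mass_ge1r// (r0 y)// mulr0 subrr.
have d00 x y : x < 0 -> y < 0 -> d x y = 0.
  by move=> x0 y0; rewrite /d mass_lt0// !r1// mulr1 subrr.
have drec x y : d x y = 4^-1 * (d (2 * x - 1) (2 * y - 1) + d (2 * x - 1) (2 * y) +
    d (2 * x) (2 * y - 1) + d (2 * x) (2 * y)).
  by rewrite /d mass_rec (ray_mass_half x) (ray_mass_half y); field.
have dn n x y : `|d x y| <= (3 / 4) ^+ n.
  elim: n x y => [|n IH] x y.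
    rewrite expr0 /d; have /andP[m0 m1] := mass_le1 x y.
    have : 0 <= ray_mass x * ray_mass y <= 1.
      have /andP[? ?] := r01 x; have /andP[? ?] := r01 y.
      by rewrite mulr_ge0//= mulr_ile1.
    by rewrite ler_norml; lra.
  have sum3 (a b c : R) : `|a| <= (3 / 4) ^+ n -> `|b| <= (3 / 4) ^+ n ->
      `|c| <= (3 / 4) ^+ n -> `|4^-1 * (a + b + c)| <= (3 / 4) ^+ n.+1.
    move=> ha hb hc; rewrite exprS; move: ha hb hc; rewrite !ler_norml; lra.
  rewrite drec; have [x1|x1] := leP 2^-1 x.
    rewrite (d0l (2 * x) (2 * y)) ?(d0l (2 * x) (2 * y - 1)); [|lra|lra].
    by rewrite -[X in 4^-1 * X]addrA; apply: sum3 => //; rewrite addr0 normr0 exprn_ge0//; lra.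
  have [y1|y1] := leP 2^-1 y.
    by rewrite (d0r (2 * x) (2 * y)) ?addr0; [exact: sum3|lra].
  rewrite (d00 (2 * x - 1) (2 * y - 1)) ?add0r; [exact: sum3|lra|lra].
suff /eqP : `|d s s'| = 0 by rewrite normr_eq0 subr_eq0 => /eqP.
apply/eqP; rewrite eq_le normr_ge0 andbT.
apply: (@ler_cvg_to nat \oo _ R (fun=> `|d s s'|) (fun n => (3 / 4) ^+ n)).
- exact: cvg_cst.
- by apply: cvg_expr; rewrite ger0_norm; lra.
- exact: nearW.
Qed.

(** Independence of the two digit subsequences. It is known for pairs of rays and is extended to
    Borel sets one variable at a time. *)
Lemma law_deinterleave (A B : set R) : measurable A -> measurable B ->
  unit_law (deinterleave 0 @^-1` A `&` deinterleave 1 @^-1` B) =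
  (unit_law A * unit_law B)%E.
Proof.
move=> mA mB; have md d := measurable_deinterleave d.
have H s (C : set R) : measurable C ->
    unit_law (deinterleave 0 @^-1` `]s, +oo[ `&` deinterleave 1 @^-1` C) =
    ((ray_mass s)%:E * unit_law C)%E.
  move=> mC; apply: law_of_rays => //; first exact: preimage_measurable.
    by rewrite -lee_fin -ray_massE.
  by move=> s'; rewrite -massE /mass fineK.
have fB : unit_law B = (fine (unit_law B))%:E by rewrite fineK// fin_num_measure.
rewrite setIC fB muleC; apply: law_of_rays => //; first exact: preimage_measurable.
  by rewrite fine_ge0.
by move=> s; rewrite setIC H// fB -EFinM mulrC.
Qed.

End binary_digits.

(** * Infinitely many independent uniform numbers from a single one *)

Section unit_cube_law.
Context {R : realType}.

(** Each step outputs the number made of the digits at even positions and passes on the number made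
    of those at odd positions, which is uniform and independent of the output. *)
Definition coordinates (u : measurableTypeR R) : Rseq R :=
  fun n => deinterleave 0 (iter n (deinterleave 1) u).

Lemma measurable_iter_deinterleave n :
  measurable_fun setT (iter n (deinterleave 1) : R -> R).
Proof.
elim: n => [|n IH]; first exact: measurable_id.
exact: (measurableT_comp (measurable_deinterleave 1) IH).
Qed.

Lemma measurable_coordinates : measurable_fun setT coordinates.
Proof.
refine (@measurability _ _ (measurableTypeR R) (Rseq R) setT coordinates (@coord_cylinders R)
    erefl _).
move=> _ [_ [n [B mB ->]] <-]; rewrite setTI.
have := measurableT_comp (@measurable_deinterleave R 0) (measurable_iter_deinterleave n).
by move=> mf; exact: (preimage_measurable mf mB).
Qed.

HB.instance Definition _ :=
  isMeasurableFun.Build _ _ _ _ coordinates measurable_coordinates.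

Definition unit_cube_law : probability (Rseq R) R :=
  distribution (@unit_law R) coordinates.

(** Induction on the number of coordinates: the first one is [deinterleave 0] and the others are the
    coordinates of [deinterleave 1], so independence of these two splits off one factor. *)
Lemma unit_cube_lawP : is_unit_cube_measure unit_cube_law.
Proof.
move=> n B mB.
transitivity (\prod_(i < n) unit_law (B i))%E; last first.
  by apply: eq_bigr => i _; rewrite unit_lawE.
rewrite /unit_cube_law/= /distribution/= /pushforward.
have mC m (B' : nat -> set R) : (forall i, measurable (B' i)) ->
    measurable [set u : R | forall i, (i < m)%N -> B' i (coordinates u i)].
  move=> mB'; rewrite (_ : [set _ | _] = \bigcap_(i in [set i | (i < m)%N])
      ((fun u => coordinates u i) @^-1` B' i)).
    apply: fin_bigcap_measurable => // i _; apply: preimage_measurable => //.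
    exact: (measurableT_comp (@measurable_deinterleave R 0) (measurable_iter_deinterleave i)).
  by apply/seteqP; split => u /=.
elim: n B mB => [|n IH] B mB.
  rewrite big_ord0 (_ : _ @^-1` _ = setT) ?probability_setT//.
  by apply/seteqP; split.
rewrite big_ord_recl/= -(IH (fun i => B i.+1))//.
rewrite -law_deinterleave//; last exact: (mC n (fun i => B i.+1)).
congr (unit_law _); apply/seteqP; split => u /=.
  move=> H; split; first exact: (H 0%N).
  by move=> i im; have := H i.+1 im; rewrite /coordinates iterSr.
move=> [H0 H] [_//|i] im; have := H i im.
by rewrite /coordinates iterSr.
Qed.

(** [coordinates] takes its values in the cube everywhere, so a measurable set covering [E] has the
    whole line as preimage. *)
Lemma hilbert_cube_not_negligible (E : set (Rseq R)) :
  @hilbert_cube R `<=` E -> ~ unit_cube_law.-negligible E.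
Proof.
move=> cE [N [mN PN0 EN]]; have : unit_cube_law N = 1%E.
  rewrite /unit_cube_law/= /distribution/= /pushforward.
  rewrite (_ : _ @^-1` _ = setT) ?probability_setT//.
  apply/seteqP; split => // u _; apply/EN/cE => n.
  by rewrite deinterleave_ge0 deinterleave_le1.
by rewrite PN0 => /eqP; rewrite eqe eq_sym oner_eq0.
Qed.

End unit_cube_law.

(** * Trigonometric series *)

Section calculus.
Context {R : realType}.
Implicit Types f df : R -> R.

Lemma mvt_between f df (x y : R) : (forall z : R, is_derive z 1 f (df z)) -> x < y ->
  exists2 c, x < c < y & f y - f x = df c * (y - x).
Proof.
move=> fd xy; have [|c cxy E] := @MVT R f df x y xy (fun z _ => fd z).
  apply: continuous_subspaceT => z; apply: differentiable_continuous.
  by apply/derivable1_diffP; have [] := fd z.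
by exists c; [rewrite in_itv/= in cxy|].
Qed.

Lemma lipschitz_of_derive f df (K : R) : (forall z : R, is_derive z 1 f (df z)) ->
  (forall z, `|df z| <= K) -> forall x y, `|f x - f y| <= K * `|x - y|.
Proof.
move=> fd dK; have H x y : x < y -> `|f x - f y| <= K * `|x - y|.
  move=> xy; have [c _ E] := mvt_between fd xy.
  by rewrite distrC E normrM (distrC x) ler_wpM2r.
move=> x y; have [xy|yx|->] := ltgtP x y; first exact: H.
  by rewrite distrC (distrC x); exact: H.
by rewrite !subrr normr0 mulr0.
Qed.

Lemma taylor1 f df (K : R) : (forall z : R, is_derive z 1 f (df z)) ->
  (forall x y, `|df x - df y| <= K * `|x - y|) ->
  forall x h, `|f (x + h) - f x - h * df x| <= K * h ^+ 2.
Proof.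
move=> fd dK x h.
have K0 : 0 <= K by have := le_trans (normr_ge0 _) (dK 1 0); rewrite subr0 normr1 mulr1.
pose g z := f z - z * df x; pose dg z := df z - df x.
have gd (z : R) : is_derive z 1 g (dg z).
  have := fd z => fz; apply: is_derive_eq.
  by rewrite /dg scaler0 add0r /GRing.scale/= mulr1.
have -> : f (x + h) - f x - h * df x = g (x + h) - g x by rewrite /g; ring.
rewrite -real_normK ?num_real// expr2 mulrA.
have bd c : `|c - x| <= `|h| -> `|dg c| <= K * `|h|.
  by move=> ch; rewrite (le_trans (dK _ _))// ler_wpM2l.
have [h0|h0|h0] := ltgtP h 0.
- have /(mvt_between gd)[c /andP[c1 c2] E] : x + h < x by lra.
  rewrite distrC E (_ : x - (x + h) = - h); last by ring.
  rewrite normrM normrN ler_wpM2r// bd//.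
  by rewrite ltr0_norm ?(ltr0_norm h0); lra.
- have /(mvt_between gd)[c /andP[c1 c2] E] : x < x + h by lra.
  rewrite E (_ : x + h - x = h); last by ring.
  rewrite normrM ler_wpM2r// bd//.
  by rewrite gtr0_norm ?(gtr0_norm h0); lra.
- by rewrite h0 addr0 subrr normr0 !mulr0.
Qed.

(** A quadratic bound on the remainder adds up over the terms of a series, which makes this
    criterion convenient for differentiating term by term. *)
Lemma is_derive_of_quadratic f (x d K : R) :
  (forall h, `|f (x + h) - f x - h * d| <= K * h ^+ 2) -> is_derive x 1 f d.
Proof.
move=> H.
suff D : h^-1 *: ((f \o shift x) (h *: (1 : R)) - f x) @[h --> 0^'] --> d.
  by split; [apply/cvg_ex; exists d|exact: cvg_lim D].
apply/cvgrPdist_le => e e0; near=> h.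
have h0 : h != 0 by near: h; exact: nbhs_dnbhs_neq.
have hK : `|h| <= e / (`|K| + 1).
  near: h; apply: dnbhs0_le; rewrite divr_gt0// ltr_wpDl//.
rewrite /= [h *: 1]mulr1 [h + x]addrC /GRing.scale/=.
rewrite (_ : _ - _ = - (h^-1 * (f (x + h) - f x - h * d))); last by field.
rewrite normrN normrM normfV ler_pdivrMl ?normr_gt0//.
rewrite (le_trans (H h))// -real_normK ?num_real// expr2 mulrCA ler_wpM2l//.
apply: (@le_trans _ _ ((`|K| + 1) * (e / (`|K| + 1)))).
  rewrite (le_trans (ler_wpM2r (normr_ge0 h) (ler_norm K)))//.
  by rewrite ler_pM// lerDl.
by rewrite mulrC divfK// gt_eqF// ltr_wpDl.
Unshelve. all: by end_near. Qed.

End calculus.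

Section trigonometry.
Context {R : realType}.

Lemma cos_2pi_ratio (q r : nat) : (0 < r < q)%N -> cos (2 * pi * (r%:R / q%:R)) != 1 :> R.
Proof.
move=> /andP[r0 rq]; have q0 : 0 < q%:R :> R by rewrite ltr0n (ltn_trans r0).
have rq1 : 0 < (r%:R / q%:R : R) < 1.
  by apply/andP; split; [rewrite divr_gt0// ltr0n|rewrite ltr_pdivrMr// mul1r ltr_nat].
have : sin (pi * (r%:R / q%:R)) != 0 :> R.
  rewrite gt_eqF// sin_gt0_pi//; have := @pi_gt0 R; case/andP: rq1 => h1 h2 p0.
  by rewrite mulr_gt0//= gtr_pMr.
apply: contra_neq; rewrite -mulrA mulr_natl cos_mulr2n cos2sin2 => h.
have : sin (pi * (r%:R / q%:R)) ^+ 2 = 0 :> R by lra.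
by move/eqP; rewrite sqrf_eq0 => /eqP.
Qed.

Lemma cos_periodic_int (m : int) (x : R) : cos (x + 2 * pi * m%:~R) = cos x.
Proof. by apply: periodic_int => y; rewrite mulr_natl cosD2pi. Qed.

Lemma sin_periodic_int (m : int) (x : R) : sin (x + 2 * pi * m%:~R) = sin x.
Proof. by apply: periodic_int => y; rewrite mulr_natl sinD2pi. Qed.

(** Shifting every angle by a permutes the terms modulo 2 pi, so the vector of the cosine sum and
    the sine sum is invariant under the plane rotation by a, which fixes only 0 when cos a is not
    1. *)
Lemma sum_cos_progression (q : nat) (m : int) (t a : R) :
  cos a != 1 -> a * q%:R = 2 * pi * m%:~R -> \sum_(j < q) cos (t + a * j%:R) = 0.
Proof.
move=> ca aq.
pose S := \sum_(j < q) cos (t + a * j%:R); pose T := \sum_(j < q) sin (t + a * j%:R).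
have shift (g : R -> R) : g (t + a * q%:R) = g t ->
    \sum_(j < q) g (t + a * j%:R + a) = \sum_(j < q) g (t + a * j%:R).
  move=> gq; apply: (addIr (g t)).
  rewrite -[X in _ = _ + X]gq.
  transitivity (\sum_(j < q.+1) g (t + a * j%:R)); last by rewrite big_ord_recr.
  rewrite big_ord_recl/= mulr0 addr0 addrC; congr (_ + _).
  by apply: eq_bigr => j _; rewrite /bump/= natrD mulrDr mulr1 addrA addrAC.
have ES : S = cos a * S - sin a * T.
  rewrite {1}/S -shift ?aq ?cos_periodic_int// /S /T !mulr_sumr -sumrB.
  by apply: eq_bigr => j _; rewrite cosD; ring.
have ET : T = cos a * T + sin a * S.
  rewrite {1}/T -shift ?aq ?sin_periodic_int// /S /T !mulr_sumr -big_split/=.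
  by apply: eq_bigr => j _; rewrite sinD; ring.
have H : (1 - cos a) * S = 0.
  have c2 := cos2Dsin2 a.
  have E1 : (1 - cos a) * S = - sin a * T by move: ES => /(congr1 (fun u => u - cos a * S)); lra.
  have E2 : (1 - cos a) * T = sin a * S by move: ET => /(congr1 (fun u => u - cos a * T)); lra.
  have E3 : (1 - cos a) * ((1 - cos a) * S) = - sin a ^+ 2 * S.
    by rewrite E1 mulrCA E2; ring.
  rewrite sin2cos2 in E3; nra.
move/eqP: H; rewrite mulf_eq0 subr_eq0 eq_sym (negbTE ca)/= => /eqP.
by [].
Qed.

(** Orthogonality of characters. When q does not divide k, neither does it divide k p, so the common
    angle is 2 pi r / q with 0 < r < q modulo 2 pi; otherwise all terms are equal. *)
Lemma sum_cos_rotation (q k : nat) (p : int) (x t : R) : (0 < q)%N -> coprime `|p| q ->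
  \sum_(j < q) cos (k%:R * (x + 2 * pi * (p%:~R / q%:R) * j%:R) + t) =
  if (q %| k)%N then q%:R * cos (k%:R * x + t) else 0.
Proof.
move=> q0 pq; have qR : q%:R != 0 :> R by rewrite pnatr_eq0 -lt0n.
pose a : R := 2 * pi * (k%:R * p%:~R / q%:R).
have E j : k%:R * (x + 2 * pi * (p%:~R / q%:R) * j) + t = (k%:R * x + t) + a * j.
  by rewrite /a; ring.
under eq_bigr do rewrite E.
case: ifPn => qk.
  have [k' kE] := dvdnP qk.
  have aE : a = 2 * pi * (k'%:Z * p)%:~R.
    by rewrite /a kE natrM intrM/=; move: (pi) => P; field.
  rewrite (eq_bigr (fun=> cos (k%:R * x + t))); last first.
    move=> j _; rewrite aE (_ : _ * _ * j%:R = 2 * pi * (k'%:Z * p * j%:Z)%:~R :> R).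
      by rewrite cos_periodic_int.
    by rewrite -mulrA; congr (_ * _); rewrite [in RHS]intrM.
  by rewrite sumr_const card_ord [RHS]mulr_natl.
apply: (@sum_cos_progression _ (k%:Z * p)); last first.
  by rewrite /a intrM/=; move: (pi) => P; field.
have qZ : q%:Z != 0 by rewrite eqz_nat -lt0n.
have r0 : 0 <= ((k%:Z * p) %% q%:Z)%Z by exact: modz_ge0.
have [r rE] : exists r : nat, ((k%:Z * p) %% q%:Z)%Z = r.
  by move: r0; case: ((k%:Z * p) %% q%:Z)%Z => // r _; exists r.
have rq : (r < q)%N by have := ltz_pmod (k%:Z * p) (_ : 0 < q%:Z); rewrite rE; apply.
have rn0 : (0 < r)%N.
  rewrite lt0n; apply: contra qk => /eqP r00.
  have : (q%:Z %| k%:Z * p)%Z by apply/dvdz_mod0P; rewrite rE r00.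
  by rewrite dvdzE abszM Gauss_dvdl// coprime_sym.
have -> : a = 2 * pi * (r%:R / q%:R) + 2 * pi * ((k%:Z * p) %/ q%:Z)%Z%:~R.
  rewrite -mulrDr /a; congr (_ * _).
  have -> : k%:R * p%:~R = (k%:Z * p)%:~R :> R by rewrite intrM.
  rewrite {1}(divz_eq (k%:Z * p) q%:Z) rE intrD intrM/= mulrDl mulfK//.
  by rewrite addrC.
by rewrite cos_periodic_int cos_2pi_ratio// rn0.
Qed.

End trigonometry.

Section trigonometric_series.
Context {R : realType}.
Implicit Types b : nat -> R.

Definition freq (n : nat) : nat := uphalf n.

(** A sine is a cosine delayed by a quarter turn; differentiation only adds further quarter turns,
    so sines and cosines share one formula. *)
Definition phase (n : nat) : R := - ((odd n)%:R * (pi / 2)).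

(* The [j]-th derivative of the [n]-th function of the basis
   1, sin x, cos x, sin 2x, cos 2x, ... *)
Definition trig (j n : nat) (x : R) : R :=
  (freq n)%:R ^+ j * cos ((freq n)%:R * x + (phase n + j%:R * (pi / 2))).

Lemma is_derive_trig j n (x : R) : is_derive x 1 (trig j n) (trig j.+1 n x).
Proof.
rewrite /trig; set k : R := (freq n)%:R; set t := phase n + _.
have -> : phase n + j.+1%:R * (pi / 2) = t + pi / 2 by rewrite /t -natr1; ring.
rewrite addrA cosDpihalf.
have H : is_derive x 1 (fun y : R => k * y + t) k.
  apply: is_derive_eq.
  by rewrite addr0 /GRing.scale/= mulr1.
have := @is_derive1_comp R (@cos R) (fun y => k * y + t) x _ _ (is_derive_cos _) H.
move=> H2; have := @is_deriveZ R _ _ (cos \o (fun y => k * y + t)) (k ^+ j) x 1 _ H2.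
rewrite (_ : k ^+ j.+1 * _ = k ^+ j *: (- sin (k * x + t) * k))//.
by rewrite exprSr /GRing.scale/=; ring.
Qed.

Lemma trig_le j n (x : R) : `|trig j n x| <= (freq n)%:R ^+ j.
Proof.
by rewrite /trig normrM ger0_norm ?exprn_ge0// ler_piMr ?exprn_ge0 ?cos_max.
Qed.

Lemma freq_le n : (freq n <= n)%N.
Proof. by rewrite /freq uphalfE; lia. Qed.

Lemma freqX_le j n : (freq n)%:R ^+ j <= expR (j%:R * n%:R) :> R.
Proof.
rewrite expRM_natl lerXn2r ?nnegrE ?expR_ge0//.
apply: le_trans (_ : 1 + n%:R <= _); last exact: expR_ge1Dx.
by rewrite -[leLHS]add0r lerD// ler_nat freq_le.
Qed.

Lemma geo_freqX b j : rapid b -> geo (fun n => `|b n| * (freq n)%:R ^+ j).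
Proof.
move=> rb; apply: (rapid_geo (C := 1) (L := j%:R) rb) => n.
by rewrite mul1r normrM normr_id ger0_norm ?exprn_ge0// ler_wpM2l// freqX_le.
Qed.

Lemma geo_trig b j x : rapid b -> geo (fun n => b n * trig j n x).
Proof.
move=> rb; apply: (le_geo (c := 1) (geo_freqX j rb)) => n.
rewrite mul1r normrM [leRHS]ger0_norm ?mulr_ge0 ?exprn_ge0// ler_wpM2l//.
exact: trig_le.
Qed.

Definition trigsum b (j : nat) (x : R) : R := tsum (fun n => b n * trig j n x).

Definition trignorm b (j : nat) : R := tsum (fun n => `|b n| * (freq n)%:R ^+ j).

Lemma trigsum_le b j x : rapid b -> `|trigsum b j x| <= trignorm b j.
Proof.
move=> rb; apply: tsum_norm => [|n]; first exact: geo_freqX.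
by rewrite normrM ler_wpM2l// trig_le.
Qed.

Lemma trig_lipschitz j n (x y : R) :
  `|trig j n x - trig j n y| <= (freq n)%:R ^+ j.+1 * `|x - y|.
Proof.
apply: (lipschitz_of_derive (df := trig j.+1 n)) => z; first exact: is_derive_trig.
exact: trig_le.
Qed.

(** The quadratic Taylor remainders of the terms are summable, with sum [trignorm b j.+2]. *)
Lemma is_derive_trigsum b j (x : R) : rapid b ->
  is_derive x 1 (trigsum b j) (trigsum b j.+1 x).
Proof.
move=> rb; apply: (is_derive_of_quadratic (K := trignorm b j.+2)) => h.
have g j' y := geo_trig j' y rb.
rewrite /trigsum -tsumB// -tsumZ// -tsumB//; last exact: geoZ; last first.
  by apply: geoD => //; exact: geoN.
rewrite mulrC -tsumZ; last exact: geo_freqX.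
apply: tsum_norm => [|n]; first by apply: geoZ; exact: geo_freqX.
rewrite -mulrBr mulrCA -mulrBr normrM [leRHS]mulrCA ler_wpM2l// [leRHS]mulrC.
apply: (taylor1 (df := trig j.+1 n)) => [z|y z]; first exact: is_derive_trig.
exact: trig_lipschitz.
Qed.

Lemma trigsum_periodic b j (x : R) : trigsum b j (x + 2 * pi) = trigsum b j x.
Proof.
apply: eq_tsum => n; congr (_ * (_ * _)).
rewrite mulrDr addrAC (mulrC _ (2 * pi)).
exact: (cos_periodic_int (freq n)%:Z).
Qed.

Lemma trigsum_rotation b j (q : nat) (p : int) (x : R) : rapid b ->
  (0 < q)%N -> coprime `|p| q ->
  \sum_(i < q) trigsum b j (x + 2 * pi * (p%:~R / q%:R) * i%:R) =
  q%:R * tsum (fun n => (if (q %| freq n)%N then b n else 0) * trig j n x).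
Proof.
move=> rb q0 pq; rewrite /trigsum.
have [_ <-] := tsum_sum (index_enum 'I_q)
  (fun i : 'I_q => geo_trig j (x + 2 * pi * (p%:~R / q%:R) * i%:R) rb).
rewrite -tsumZ; last first.
  apply: (le_geo (c := 1) (geo_trig j x rb)) => n; rewrite mul1r.
  by case: ifP => // _; rewrite mul0r normr0.
apply: eq_tsum => n; rewrite -mulr_sumr /trig -mulr_sumr sum_cos_rotation//.
by case: ifP => _; [ring|rewrite !(mulr0, mul0r)].
Qed.

End trigonometric_series.

(** * Lifts of circle maps and their periodic trajectories *)

Section circle_lifts.
Context {R : realType}.
Variable G : R -> R.
Hypothesis G_shift : forall x, G (x + 2 * pi) = G x + 2 * pi.
Hypothesis G_incr : forall x y, x < y -> G x < G y.

Lemma lift_shift (m : int) x : G (x + 2 * pi * m%:~R) = G x + 2 * pi * m%:~R.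
Proof.
have H := @periodic_int R (fun y => G y - y) m x.
have /H : forall y, G (y + 2 * pi) - (y + 2 * pi) = G y - y by move=> y; rewrite G_shift; ring.
by lra.
Qed.

Lemma iter_lift_shift n (m : int) x :
  iter n G (x + 2 * pi * m%:~R) = iter n G x + 2 * pi * m%:~R.
Proof. by elim: n => [//|n IH]; rewrite !iterS IH lift_shift. Qed.

Lemma iter_lift_incr n x y : x < y -> iter n G x < iter n G y.
Proof. by move=> xy; elim: n => [//|n IH]; rewrite !iterS G_incr. Qed.

Lemma iter_lift_le n x y : x <= y -> iter n G x <= iter n G y.
Proof. by rewrite le_eqVlt => /predU1P[->//|/(@iter_lift_incr n)/ltW]. Qed.

Lemma iter_period_mul q (p : int) x k : iter q G x = x + 2 * pi * p%:~R ->
  iter (k * q) G x = x + 2 * pi * (k%:Z * p)%:~R.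
Proof.
move=> qx; elim: k => [|k IH]; first by rewrite mul0n /= mul0r mulr0 addr0.
rewrite mulSn iterD IH iter_lift_shift qx -addrA -mulrDr -intrD; congr (_ + _ * _%:~R).
by lia.
Qed.

(** Along the orbit of x the deviation from the translation by 2 pi p / q per step is q-periodic,
    hence bounded. By monotonicity the orbit of 0 stays within M turns of that of x, so both have
    the same mean speed. *)
Lemma rotation_number_periodic q (p : int) x : (0 < q)%N ->
  iter q G x = x + 2 * pi * p%:~R -> rotation_number G = p%:~R / q%:R.
Proof.
move=> q0 qx; have qR : q%:R != 0 :> R by rewrite pnatr_eq0 -lt0n.
have pi0 := @pi_gt0 R.
pose u n := iter n G x - x - 2 * pi * (p%:~R / q%:R) * n%:R.
have uq n : u (n + q)%N = u n.
  rewrite /u iterD qx iter_lift_shift natrD; move: (pi) => P; field => //.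
pose B := \sum_(i < q) `|u i|.
have uB n : `|u n| <= B.
  elim/ltn_ind: n => n IH; have [nq|qn] := ltnP n q.
    rewrite /B (bigD1 (Ordinal nq))//= lerDl.
    by apply: sumr_ge0.
  rewrite -(subnK qn) uq IH// -subn_gt0 subKn//.
pose M : int := (Num.truncn `|x|).+1.
have xM : `|x| <= 2 * pi * M%:~R.
  have h1 : `|x| < M%:~R by rewrite /M; exact: truncnS_gt.
  have h2 : (2 : R) <= pi := pi_ge2 R.
  have : 0 <= `|x| by []. nra.
have d0 n : `|iter n G 0 - iter n G x| <= 2 * pi * M%:~R.
  have : iter n G (x + 2 * pi * (- M)%:~R) <= iter n G 0.
    by apply: iter_lift_le; move: xM; rewrite mulrNz ler_norml; lra.
  have : iter n G 0 <= iter n G (x + 2 * pi * M%:~R).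
    by apply: iter_lift_le; move: xM; rewrite ler_norml; lra.
  rewrite !iter_lift_shift mulrNz ler_norml; lra.
pose C := (B + `|x| + 2 * pi * M%:~R) / (2 * pi).
have bd n : (0 < n)%N -> `|iter n G 0 / (2 * pi * n%:R) - p%:~R / q%:R| <= C / n%:R.
  move=> n0; have nR : 0 < n%:R :> R by rewrite ltr0n.
  have -> : iter n G 0 / (2 * pi * n%:R) - p%:~R / q%:R =
     (u n + x + (iter n G 0 - iter n G x)) / (2 * pi * n%:R).
    rewrite /u; move: (pi) pi0 => P P0; field.
    by rewrite qR !gt_eqF.
  have P0 : 0 < 2 * pi * n%:R :> R by rewrite !mulr_gt0.
  rewrite normrM normfV (gtr0_norm P0) /C -[leRHS]mulrA -(invfM (2 * pi)) ler_pM2r ?invr_gt0//.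
  rewrite (le_trans (ler_normD _ _))// lerD// (le_trans (ler_normD _ _))// lerD//.
apply/cvg_lim => //; apply/cvgrPdist_le => e e0; near=> n.
have n0 : (0 < n)%N by near: n; exact: nbhs_infty_gt.
rewrite distrC (le_trans (bd n n0))// ler_pdivrMr ?ltr0n// mulrC -ler_pdivrMr//.
by near: n; exact: nbhs_infty_ger.
Unshelve. all: by end_near. Qed.

Section fixed_rotation_number.
Variables (q : nat) (p : int).
Hypotheses (q0 : (0 < q)%N) (pq : coprime `|p| q).
Hypothesis rotG : rotation_number G = p%:~R / q%:R.

(** The q-th iterate lowered by p turns: the periodic points of rotation number p / q become fixed
    points of an increasing map. *)
Let h x := iter q G x - 2 * pi * p%:~R.

Lemma first_return_incr x y : x < y -> h x < h y.
Proof. by move=> xy; rewrite /h ltrD2r iter_lift_incr. Qed.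

Lemma iter_first_return d x : iter d h x = iter (d * q) G x - 2 * pi * (d%:Z * p)%:~R.
Proof.
elim: d x => [|d IH] x; first by rewrite mul0n/= mul0r mulr0 subr0.
rewrite iterSr IH /h -mulrN -intrN iter_lift_shift mulSn addnC iterD.
rewrite -addrA; congr (_ + _).
have -> : (d.+1%:Z * p) = p + d%:Z * p by lia.
by rewrite intrD intrN; ring.
Qed.

Lemma periodic_dvd q' (p' : int) x : (0 < q')%N ->
  iter q' G x = x + 2 * pi * p'%:~R ->
  exists2 d : nat, (0 < d)%N & q' = (d * q)%N /\ p' = d%:Z * p.
Proof.
move=> q'0 qx; have := rotation_number_periodic q'0 qx.
rewrite rotG => E.
have qR : q%:R != 0 :> R by rewrite pnatr_eq0 -lt0n.
have qR' : q'%:R != 0 :> R by rewrite pnatr_eq0 -lt0n.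
have E2 : p * q'%:Z = p' * q%:Z.
  apply: (@intr_inj R); rewrite !intrM/=.
  move/eqP: E; rewrite eqr_div// => /eqP ->; ring.
have dq : (q %| q')%N.
  have : (q %| `|(p * q'%:Z)%R|)%N by rewrite E2 abszM dvdn_mull.
  by rewrite abszM Gauss_dvdr// coprime_sym.
have [d dE] := dvdnP dq.
exists d; first by move: q'0; rewrite dE; case: (d).
split => //; move: E2; rewrite dE => E2.
have qZ : q%:Z != 0 by rewrite eqz_nat -lt0n.
by apply: (mulIf qZ); rewrite -E2 PoszM; ring.
Qed.

Lemma increasing_iter_fixed (k : R -> R) d x : (forall y z, y < z -> k y < k z) ->
  (0 < d)%N -> iter d k x = x -> k x = x.
Proof.
move=> kincr; case: d => // d _ dx.
have up : x < k x -> x < iter d.+1 k x.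
  move=> xk; elim: (d) => [//|m IH]; rewrite iterS (lt_trans xk)// kincr//.
have dn : k x < x -> iter d.+1 k x < x.
  move=> xk; elim: (d) => [//|m IH]; rewrite iterS (lt_trans _ xk)// kincr//.
by have [/dn|/up|//] := ltgtP (k x) x; rewrite dx ltxx.
Qed.

(** A period (q', p') of x is a multiple of (q, p), and an increasing map has no periodic points
    other than fixed points, so [h] fixes x. If [h] did not move a nearby point strictly towards x,
    monotonicity would keep its whole orbit away from x. *)
Lemma attracting_periodic_crossing x : attracting_periodic G x ->
  [/\ h x = x, \forall y \near x^'+, h y < y & \forall y \near x^'-, y < h y].
Proof.
move=> [q' [p' q'0 [/eqP gx _ att]]].
move: gx; rewrite subr_eq => /eqP gx.
have [d d0 [qE pE]] := periodic_dvd q'0 gx.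
have gE y : iter q' G y - 2 * pi * p'%:~R = iter d h y.
  by rewrite iter_first_return -qE -pE.
have hx : h x = x.
  apply: (increasing_iter_fixed first_return_incr d0).
  by rewrite -gE gx addrK.
have iterE n y : iter n (fun z => iter q' G z - 2 * pi * p'%:~R) y = iter (n * d) h y.
  elim: n => [//|n IH]; rewrite iterS gE IH mulSn iterD//.
split => //.
- near=> y; have xy : x < y by near: y; exact: nbhs_right_gt.
  have : (fun n => iter n (fun z => iter q' G z - 2 * pi * p'%:~R) y) @ \oo --> x.
    near: y; exact: cvg_within.
  move=> cy; rewrite ltNge; apply/negP => yh.
  have ge n : y <= iter n h y.
    elim: n => [//|n IH]; rewrite iterS (le_trans yh)//.
    by move: IH; rewrite le_eqVlt => /predU1P[<-//|/first_return_incr/ltW].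
  have : y <= x.
    apply: (@ler_cvg_to nat \oo _ R (fun=> y) _ _ _ (cvg_cst _) cy).
    by apply: nearW => n; rewrite iterE.
  by rewrite leNgt xy.
- near=> y; have xy : y < x by near: y; exact: nbhs_left_lt.
  have : (fun n => iter n (fun z => iter q' G z - 2 * pi * p'%:~R) y) @ \oo --> x.
    near: y; exact: cvg_within.
  move=> cy; rewrite ltNge; apply/negP => yh.
  have ge n : iter n h y <= y.
    elim: n => [//|n IH]; rewrite iterS (le_trans _ yh)//.
    by move: IH; rewrite le_eqVlt => /predU1P[->//|/first_return_incr/ltW].
  have : x <= y.
    apply: (@ler_cvg_to nat \oo _ R _ (fun=> y) _ _ cy (cvg_cst _)).
    by apply: nearW => n; rewrite iterE.
  by rewrite leNgt xy.
Unshelve. all: by end_near. Qed.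

Lemma trajectory_mem x y : h x = x -> trajectory G x y -> trajectory G y = trajectory G x.
Proof.
move=> hx [n [m yE]].
have qx : iter q G x = x + 2 * pi * p%:~R by rewrite -{2}hx /h subrK.
apply/seteqP; split => z [k [l ->]].
  exists (k + n)%N, (m + l); rewrite yE iter_lift_shift iterD -addrA; congr (_ + _).
  by rewrite -mulrDr -intrD.
(* Going n steps back along an orbit of period q is going n q - n steps forward. *)
exists (k + (n * q - n))%N, (l - (n%:Z * p) - m); rewrite yE iter_lift_shift -iterD.
rewrite -addnA subnK ?leq_pmulr// iterD (iter_period_mul _ qx) iter_lift_shift.
rewrite -!addrA; congr (_ + _); rewrite -!mulrDr -!intrD; congr (_ * _%:~R).
by lia.
Qed.

End fixed_rotation_number.
End circle_lifts.

(** * Averaging: expansion of the iterates in the parameter a *)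

Section circle_family_iterates.
Context {R : realType}.
Variables (f f1 f2 : R -> R) (K : R).
Hypothesis f_periodic : forall x, f (x + 2 * pi) = f x.
Hypothesis f_deriv : forall x : R, is_derive x 1 f (f1 x).
Hypothesis f1_deriv : forall x : R, is_derive x 1 f1 (f2 x).
Hypothesis f2_lip : forall x y, `|f2 x - f2 y| <= K * `|x - y|.
Hypothesis f_le : forall x, `|f x| <= K.
Hypothesis f1_le : forall x, `|f1 x| <= K.
Hypothesis f2_le : forall x, `|f2 x| <= K.

Local Notation F := (circle_family f).

Lemma f_bound_ge0 : 0 <= K. Proof. exact: le_trans (f_le 0). Qed.
Local Notation K0 := f_bound_ge0.

Lemma circle_family_shift r a x : F r a (x + 2 * pi) = F r a x + 2 * pi.
Proof. by rewrite /circle_family f_periodic; ring. Qed.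

Lemma circle_family_incr r a x y : `|a| * K < 1 -> x < y -> F r a x < F r a y.
Proof.
move=> aK xy; have [c _ E] := mvt_between f_deriv xy.
rewrite -subr_gt0 /circle_family.
have -> : y + 2 * pi * r + a * f y - (x + 2 * pi * r + a * f x) = (1 + a * f1 c) * (y - x).
  by rewrite [RHS]mulrDl mul1r -(mulrA a) -E; ring.
rewrite mulr_gt0 ?subr_gt0//.
have : `|a * f1 c| < 1 by rewrite (le_lt_trans _ aK)// normrM ler_wpM2l.
by rewrite ltr_norml => /andP[? _]; lra.
Qed.

(** The chain rule in closed form, so that the derivatives of the iterates can be expanded in a by
    the same induction as the iterates. *)
Fixpoint diter r a (n : nat) (x : R) : R :=
  if n is m.+1 then (1 + a * f1 (iter m (F r a) x)) * diter r a m x else 1.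

Fixpoint dditer r a (n : nat) (x : R) : R :=
  if n is m.+1 then a * f2 (iter m (F r a) x) * diter r a m x ^+ 2 +
    (1 + a * f1 (iter m (F r a) x)) * dditer r a m x else 0.

Lemma is_derive_iter r a n (x : R) : is_derive x 1 (iter n (F r a)) (diter r a n x).
Proof.
elim: n x => [|n IH] x; first exact: is_derive_id.
have Fd y : is_derive (y : R) 1 (F r a) (1 + a * f1 y).
  rewrite /circle_family; have := f_deriv y => fy; apply: is_derive_eq.
  by rewrite addr0.
exact: (is_derive1_comp (Fd _) (IH x)).
Qed.

Lemma is_derive_diter r a n (x : R) : is_derive x 1 (diter r a n) (dditer r a n x).
Proof.
elim: n x => [|n IH] x; first exact: is_derive_cst.
have /= := is_derive1_comp (f1_deriv _) (is_derive_iter r a n x) => H1.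
have H2 := IH x.
have H3 := is_deriveD (is_derive_cst (1 : R) x (1 : R)) (is_deriveZ a H1).
set d' := (X in is_derive _ _ _ X).
have -> : d' = (1 + a * f1 (iter n (F r a) x)) *: dditer r a n x +
    diter r a n x *: (0 + a *: (f2 (iter n (F r a) x) * diter r a n x)).
  by rewrite /d' /GRing.scale/=; ring.
exact: (is_deriveM H3 H2).
Qed.

Lemma iter_near_rotation n : exists2 C : R, 0 <= C & forall r a x, `|a| <= 1 ->
  [/\ `|iter n (F r a) x - x - 2 * pi * r * n%:R| <= C * `|a|,
      `|diter r a n x - 1| <= C * `|a| & `|dditer r a n x| <= C * `|a|].
Proof.
elim: n => [|n [C C0 IH]].
  exists 0 => // r a x _; rewrite /= !subrr mulr0 subrr normr0 mul0r; split => //.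
pose C' := C + K + K * (1 + C) + K * (1 + C) ^+ 2 + K * C.
have KC : 0 <= K * (1 + C) by rewrite mulr_ge0 ?K0// addr_ge0.
have KC2 : 0 <= K * (1 + C) ^+ 2 by rewrite mulr_ge0 ?K0// exprn_ge0// addr_ge0.
have KC3 : 0 <= K * C by rewrite mulr_ge0 ?K0.
exists C' => [|r a x a1]; first by rewrite /C'; have := K0; lra.
have [H0 H1 H2] := IH r a x a1; rewrite iterS /=.
set y := iter n (F r a) x in H0 *; set d := diter r a n x in H1 *.
set e := dditer r a n x in H2 *.
have dle : `|d| <= 1 + C.
  have -> : d = 1 + (d - 1) by ring.
  rewrite (le_trans (ler_normD _ _))// normr1 lerD2l (le_trans H1)//.
  by rewrite ler_piMr.
have kf (g : R) : `|g| <= K -> `|a * g| <= K * `|a| by move=> gK; rewrite normrM mulrC ler_wpM2r.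
have leC (c : R) : c <= C' -> c * `|a| <= C' * `|a| by move=> cc; rewrite ler_wpM2r.
split.
- rewrite /circle_family (_ : _ - _ = (y - x - 2 * pi * r * n%:R) + a * f y); last first.
    by rewrite -natr1; ring.
  rewrite (le_trans (ler_normD _ _))// (le_trans (lerD H0 (kf _ (f_le y))))//.
  by rewrite -mulrDl leC// /C'; lra.
- rewrite (_ : _ - 1 = (d - 1) + a * f1 y * d); last by ring.
  rewrite (le_trans (ler_normD _ _))// normrM.
  apply: (@le_trans _ _ (C * `|a| + (K * `|a|) * (1 + C))).
    by rewrite lerD// ler_pM// kf.
  by rewrite mulrAC -mulrDl leC// /C'; have := K0; lra.
- rewrite (_ : _ + _ = a * f2 y * d ^+ 2 + (e + a * f1 y * e)); last by ring.
  rewrite (le_trans (ler_normD _ _))// normrM.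
  apply: (@le_trans _ _ ((K * `|a|) * (1 + C) ^+ 2 + (C * `|a| + (K * `|a|) * C))).
    rewrite lerD//; first by rewrite ler_pM// ?kf// normrX lerXn2r ?nnegrE// addr_ge0.
    rewrite (le_trans (ler_normD _ _))// lerD// normrM ler_pM// ?kf//.
    by rewrite (le_trans H2)// ler_piMr.
  have -> : K * `|a| * (1 + C) ^+ 2 + (C * `|a| + K * `|a| * C) =
    (K * (1 + C) ^+ 2 + C + K * C) * `|a| by ring.
  by rewrite leC// /C'; have := K0; lra.
Qed.

(* First-order averaging: up to O(a^2), the displacement of the [n]-th iterate
   and its first two derivatives are [a] times the sums of [f], [f'], [f'']
   along an orbit of the rotation by [rho]. *)
Lemma iter_expansion (rho L : R) n : 0 <= L -> exists2 C : R, 0 <= C &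
  forall r a x, `|a| <= 1 -> `|r - rho| <= L * `|a| ->
  [/\ `|iter n (F r a) x - x - 2 * pi * r * n%:R
        - a * \sum_(j < n) f (x + 2 * pi * rho * j%:R)| <= C * a ^+ 2,
      `|diter r a n x - 1 - a * \sum_(j < n) f1 (x + 2 * pi * rho * j%:R)| <= C * a ^+ 2 &
      `|dditer r a n x - a * \sum_(j < n) f2 (x + 2 * pi * rho * j%:R)| <= C * a ^+ 2].
Proof.
move=> L0; elim: n => [|n [C C0 IH]].
  exists 0 => // r a x _ _; rewrite /= !big_ord0 !mulr0 !subr0 !subrr normr0 mul0r.
  by split.
have [D D0 H] := iter_near_rotation n.
(* [P] bounds, in units of |a|, the distance between the orbit and that of the rotation by [rho];
   its second term accounts for the difference between r and [rho]. *)
pose P := D + 2 * pi * L * n%:R.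
have P0 : 0 <= P by rewrite /P addr_ge0// !mulr_ge0// pi_ge0.
pose C' := C + K * P + (K * D + K * P) + (K * D * (2 + D) + K * P + K * D).
have KP : 0 <= K * P by rewrite mulr_ge0 ?K0.
have KD : 0 <= K * D by rewrite mulr_ge0 ?K0.
have KD2 : 0 <= K * D * (2 + D) by rewrite mulr_ge0// addr_ge0.
exists C' => [|r a x a1 rL]; first by rewrite /C'; lra.
have [I0 I1 I2] := IH r a x a1 rL; have [H0 H1 H2] := H r a x a1.
rewrite iterS /= !big_ord_recr/=.
set y := iter n (F r a) x in H0 I0 *; set d := diter r a n x in H1 I1 *.
set e := dditer r a n x in H2 I2 *; set y0 := x + 2 * pi * rho * n%:R.
have yy : `|y - y0| <= P * `|a|.
  have -> : y - y0 = (y - x - 2 * pi * r * n%:R) + 2 * pi * n%:R * (r - rho).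
    by rewrite /y0; ring.
  rewrite (le_trans (ler_normD _ _))// /P [leRHS]mulrDl lerD// normrM ger0_norm; last first.
    by rewrite !mulr_ge0// pi_ge0.
  have -> : 2 * pi * L * n%:R * `|a| = 2 * pi * n%:R * (L * `|a|) by ring.
  by rewrite ler_wpM2l// !mulr_ge0// pi_ge0.
have lipf (g : R -> R) : (forall u v, `|g u - g v| <= K * `|u - v|) ->
    `|g y - g y0| <= K * P * `|a|.
  by move=> gl; rewrite (le_trans (gl _ _))// -mulrA ler_wpM2l// K0.
have fy := lipf _ (lipschitz_of_derive f_deriv f1_le).
have f1y := lipf _ (lipschitz_of_derive f1_deriv f2_le).
have f2y := lipf _ f2_lip.
have aa : a ^+ 2 = `|a| * `|a| by rewrite -expr2 real_normK ?num_real.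
have comb (u v c : R) : `|u| <= C * a ^+ 2 -> `|v| <= c * `|a| -> C + c <= C' ->
    `|u + a * v| <= C' * a ^+ 2.
  move=> uC vc cC; rewrite (le_trans (ler_normD _ _))//.
  apply: (@le_trans _ _ ((C + c) * a ^+ 2)); last by rewrite ler_wpM2r// sqr_ge0.
  rewrite mulrDl lerD// normrM aa mulrC mulrA ler_wpM2r//.
have d1 : `|d| <= 1 + D.
  have -> : d = 1 + (d - 1) by ring.
  rewrite (le_trans (ler_normD _ _))// normr1 lerD2l (le_trans H1)//.
  by rewrite ler_piMr.
split.
- rewrite /circle_family (_ : _ - _ = (y - x - 2 * pi * r * n%:R -
    a * \sum_(j < n) f (x + 2 * pi * rho * j%:R)) + a * (f y - f y0)).
    by apply: (comb _ _ _ I0 fy); rewrite /C'; lra.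
  by rewrite -natr1; ring.
- rewrite (_ : _ - _ = (d - 1 - a * \sum_(j < n) f1 (x + 2 * pi * rho * j%:R)) +
    a * (f1 y * (d - 1) + (f1 y - f1 y0))); last by ring.
  apply: (comb _ _ (K * D + K * P) I1); last by rewrite /C'; lra.
  rewrite (le_trans (ler_normD _ _))// mulrDl lerD// normrM -mulrA.
  by rewrite ler_pM.
- rewrite (_ : _ - _ = (e - a * \sum_(j < n) f2 (x + 2 * pi * rho * j%:R)) +
    a * (f2 y * ((d - 1) * (d + 1)) + (f2 y - f2 y0) + f1 y * e)); last by ring.
  apply: (comb _ _ (K * D * (2 + D) + K * P + K * D) I2); last by rewrite /C'; lra.
  rewrite (le_trans (ler_normD _ _))// [leRHS]mulrDl lerD//; last first.
    by rewrite normrM -mulrA ler_pM.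
  rewrite (le_trans (ler_normD _ _))// [leRHS]mulrDl lerD//.
  rewrite !normrM.
  have -> : K * D * (2 + D) * `|a| = K * (D * `|a| * (2 + D)) by ring.
  rewrite ler_pM// ?mulr_ge0// ler_pM//.
  by rewrite (le_trans (ler_normD _ _))// normr1; lra.
Qed.

End circle_family_iterates.

Section counting_sets.
Context {R : realType} {T : choiceType}.
Implicit Types S : set T.

Lemma counting_le1 S : (forall x y, S x -> S y -> x = y) -> (counting S <= 1%:E :> \bar R)%E.
Proof.
move=> S1; have [->|/set0P[x Sx]] := eqVneq S set0.
  by rewrite /counting asboolT// fset_set0 cardfs0 lee_fin.
rewrite (_ : S = [set x]).
  by rewrite /counting asboolT// fset_set1 cardfs1.
by apply/seteqP; split => [y Sy|_ ->//]; exact: S1.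
Qed.

Lemma counting_ge (m : nat) (g : 'I_m -> T) S : injective g -> (forall i, S (g i)) ->
  (m%:R%:E <= counting S :> \bar R)%E.
Proof.
move=> ginj Sg; rewrite /counting; case: ifPn => [/asboolP fS|_]; last exact: leey.
rewrite lee_fin ler_nat.
have : uniq [seq g i | i <- enum 'I_m] by rewrite map_inj_uniq ?enum_uniq.
move=> gu; have := uniq_leq_size gu (s2 := enum_fset (fset_set S)).
rewrite size_map size_enum_ord; apply => _ /mapP[i _ ->].
have := in_fset_set fS (g i); rewrite mem_set//.
Qed.

End counting_sets.

(** * Bounds on the limit superior, and zeros of a perturbed wave *)

Section inf_cyclicity_bounds.
Context {R : realType}.
Implicit Types f : R -> R.

Lemma inf_cyclicity_le f rho (N : R) (a1 : R) : 0 < a1 ->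
  (forall r a, `|a| < a1 -> rotation_number (circle_family f r a) = rho ->
     (nb_attracting (circle_family f r a) <= N%:E)%E) ->
  (inf_cyclicity f rho <= N%:E)%E.
Proof.
move=> a10 H; rewrite /inf_cyclicity /limf_esup.
set g := fun a : R => _.
apply: (@le_trans _ _ (ereal_sup (g @` `]0, a1[%classic))).
  apply: ereal_inf_lbound; exists (`]0, a1[%classic) => //.
  near=> a; rewrite /= in_itv/=; apply/andP; split; near: a.
    exact: nbhs_right_gt.
  exact: nbhs_right_lt.
apply: ge_ereal_sup => _ [a' /= a'01 <-].
apply: ge_ereal_sup => _ [[r a] /= [rE aa] <-].
apply: H => //; rewrite (lt_trans aa)//.
by move: a'01; rewrite in_itv/= => /andP[].
Unshelve. all: by end_near. Qed.

Lemma inf_cyclicity_ge_of f rho (N : R) :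
  (forall a1 : R, 0 < a1 -> exists r a, [/\ `|a| < a1,
     rotation_number (circle_family f r a) = rho &
     (N%:E <= nb_attracting (circle_family f r a))%E]) ->
  (N%:E <= inf_cyclicity f rho)%E.
Proof.
move=> H; apply: le_ereal_inf_tmp => _ [A A0 <-].
have [a1 Aa1 a10] : exists2 a1 : R, A a1 & 0 < a1.
  near (0 : R)^'+ => a1; exists a1 => //.
  by near: a1.
have [r [a [aa rE Nle]]] := H a1 a10.
apply: le_trans (_ : _ <= ereal_sup _)%E; last first.
  by apply: ereal_sup_ubound; exists a1.
apply: le_trans Nle _; apply: ereal_sup_ubound.
by exists (r, a).
Unshelve. all: by end_near. Qed.

Lemma cos_3pi8 : 2 / 10 < cos (3 * pi / 8) :> R.
Proof.
have p0 := @pi_gt0 R.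
have h1 : cos (pi / 2) = cos (pi / 4) ^+ 2 *+ 2 - 1 :> R.
  by rewrite -cos_mulr2n; congr cos; rewrite -mulr_natr; field.
have h2 : cos (3 * pi / 4) = cos (3 * pi / 8) ^+ 2 *+ 2 - 1 :> R.
  by rewrite -cos_mulr2n; congr cos; rewrite -mulr_natr; field.
have h3 : cos (3 * pi / 4) = - cos (pi / 4) :> R.
  have -> : 3 * pi / 4 = - (pi / 4) + pi :> R by field.
  by rewrite cosDpi cosN.
have h4 : 0 < cos (3 * pi / 8) :> R by apply: cos_gt0_pihalf; lra.
have h5 : 0 < cos (pi / 4) :> R by apply: cos_gt0_pihalf; lra.
rewrite cos_pihalf in h1; rewrite h3 in h2.
have h6 : cos (pi / 4) < 75 / 100 :> R.
  rewrite ltNge; apply/negP => h; move: h1; rewrite -mulr_natr.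
  nra.
rewrite ltNge; apply/negP => h.
have : cos (3 * pi / 8) ^+ 2 <= (2 / 10) ^+ 2 :> R.
  by rewrite lerXn2r// ?nnegrE; lra.
by rewrite !expr2; move: h2; rewrite mulr2n !expr2; lra.
Qed.

(** Exact zeros of sine and cosine are at least pi / 2 apart. The tolerances only give cos (s - t)
    <= 2/10, which is less than cos (3 pi / 8); six gaps of this size still exceed one period. *)
Lemma sin_cos_gap (s t : R) : `|sin s| <= 1 / 10 -> `|cos t| <= 1 / 10 ->
  3 * pi / 8 <= `|s - t|.
Proof.
move=> hs ht; have p0 := @pi_gt0 R.
have c1 : cos `|s - t| <= 2 / 10.
  rewrite cos_norm cosB.
  have h1 : `|cos s * cos t| <= 1 / 10.
    rewrite normrM (le_trans _ ht)// ler_piMl// cos_max//.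
  have h2 : `|sin s * sin t| <= 1 / 10.
    rewrite normrM (le_trans _ hs)// ler_piMr// sin_max//.
  by move: h1 h2; rewrite !ler_norml; lra.
rewrite leNgt; apply/negP => lt.
have : cos (3 * pi / 8) < cos `|s - t|.
  rewrite ltr_cos// in_itv/=; last by apply/andP; split; lra.
  by rewrite normr_ge0/=; lra.
have := cos_3pi8; lra.
Qed.

Section crossings.
Variables (Phi Phi1 Phi2 : R -> R) (q : R).
Hypothesis q0 : 0 < q.
Hypothesis Phi_deriv : forall x : R, is_derive x 1 Phi (Phi1 x).
Hypothesis Phi1_deriv : forall x : R, is_derive x 1 Phi1 (Phi2 x).
Hypothesis Phi1_zero : forall x, Phi1 x = 0 -> `|sin (q * x)| <= 1 / 10.
Hypothesis Phi2_zero : forall x, Phi2 x = 0 -> `|cos (q * x)| <= 1 / 10.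

Let rolle (g g' : R -> R) (gd : forall x : R, is_derive x 1 g (g' x)) x y :
  x < y -> g x = 0 -> g y = 0 -> exists2 u, x < u < y & g' u = 0.
Proof.
move=> xy gx gy; have [u uxy E] := mvt_between gd xy; exists u => //.
move/eqP: E; rewrite gx gy subrr eq_sym mulf_eq0 subr_eq0 (gt_eqF xy) orbF => /eqP//.
Qed.

Let gap u v : Phi1 u = 0 -> Phi2 v = 0 -> 3 * pi / 8 <= q * `|u - v|.
Proof.
move=> /Phi1_zero hu /Phi2_zero hv; have := sin_cos_gap hu hv.
by rewrite -mulrBr normrM (gtr0_norm q0).
Qed.

(** Rolle gives four zeros u of the first derivative and, between them, three zeros v of the second.
    They interlace, u1 < v1 < u2 < v2 < u3 < v3 < u4, and each of the six gaps is at least 3 pi / (8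
    q). *)
Lemma five_zeros_gap z0 z1 z2 z3 z4 : z0 < z1 -> z1 < z2 -> z2 < z3 -> z3 < z4 ->
  Phi z0 = 0 -> Phi z1 = 0 -> Phi z2 = 0 -> Phi z3 = 0 -> Phi z4 = 0 ->
  9 * pi / 4 <= q * (z4 - z0).
Proof.
move=> l0 l1 l2 l3 h0 h1 h2 h3 h4.
have [u1 /andP[a1 b1] k1] := rolle Phi_deriv l0 h0 h1.
have [u2 /andP[a2 b2] k2] := rolle Phi_deriv l1 h1 h2.
have [u3 /andP[a3 b3] k3] := rolle Phi_deriv l2 h2 h3.
have [u4 /andP[a4 b4] k4] := rolle Phi_deriv l3 h3 h4.
have [v1 /andP[c1 d1] m1] := rolle Phi1_deriv (lt_trans b1 a2) k1 k2.
have [v2 /andP[c2 d2] m2] := rolle Phi1_deriv (lt_trans b2 a3) k2 k3.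
have [v3 /andP[c3 d3] m3] := rolle Phi1_deriv (lt_trans b3 a4) k3 k4.
have := gap k1 m1; have := gap k2 m1; have := gap k2 m2; have := gap k3 m2.
have := gap k3 m3; have := gap k4 m3.
rewrite (gtr0_norm (_ : 0 < u4 - v3)) ?subr_gt0//.
rewrite (gtr0_norm (_ : 0 < u3 - v2)) ?subr_gt0//.
rewrite (gtr0_norm (_ : 0 < u2 - v1)) ?subr_gt0//.
rewrite (ltr0_norm (_ : u3 - v3 < 0)) ?subr_lt0//.
rewrite (ltr0_norm (_ : u2 - v2 < 0)) ?subr_lt0//.
rewrite (ltr0_norm (_ : u1 - v1 < 0)) ?subr_lt0//.
have : q * (u4 - u1) <= q * (z4 - z0) by rewrite ler_pM2l//; lra.
by lra.
Qed.

Let zero_between x y : x < y -> 0 < Phi x * - Phi y -> exists2 z, x <= z <= y & Phi z = 0.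
Proof.
move=> xy xy0; have [||z zxy Pz] := @IVT R Phi x y 0 (ltW xy).
- by apply: continuous_subspaceT => z; apply: differentiable_continuous; apply/derivable1_diffP;
    have [] := Phi_deriv z.
- rewrite ge_min le_max; have [x0|x0] := leP (Phi x) 0; have [y0|y0] := leP (Phi y) 0 => //=; nra.
- by exists z => //; rewrite in_itv/= in zxy.
Qed.

(** Between two successive downward crossings the function goes from negative back to positive, so
    two further zeros separate the three given ones. *)
Lemma three_down_crossings x y w : x < y -> y < w ->
  Phi x = 0 -> Phi y = 0 -> Phi w = 0 ->
  (forall e, x < e -> exists2 t, x < t < e & Phi t < 0) ->
  (forall e, e < y -> exists2 t, e < t < y & 0 < Phi t) ->
  (forall e, y < e -> exists2 t, y < t < e & Phi t < 0) ->
  (forall e, e < w -> exists2 t, e < t < w & 0 < Phi t) ->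
  9 * pi / 4 <= q * (w - x).
Proof.
move=> xy yw Px Py Pw xR yL yR wL.
have [t1 /andP[xt1 t1y] P1] := xR _ xy.
have [t2 /andP[t12 t2y] P2] := yL _ t1y.
have [t3 /andP[yt3 t3w] P3] := yR _ yw.
have [t4 /andP[t34 t4w] P4] := wL _ t3w.
have [|z1 /andP[z11 z12] Z1] := zero_between t12; first by nra.
have [|z3 /andP[z31 z32] Z3] := zero_between t34; first by nra.
by apply: (@five_zeros_gap x z1 y z3 w) => //; lra.
Qed.

End crossings.
End inf_cyclicity_bounds.

(** * Infinitesimal cyclicity from averaged estimates *)

(** The number of steps after which an orbit of the rotation by p / q has moved by 1 / q modulo full
    turns. The Bezout coefficient u is made nonnegative by adding |u| q. *)
Lemma coprime_shift (p : int) (q : nat) : (0 < q)%N -> coprime `|p| q ->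
  exists (j : nat) (l : int), j%:Z * p = 1 + l * q%:Z.
Proof.
move=> q0 pq; have [u [v uv]] := Bezoutz p q%:Z.
have {}uv : u * p + v * q%:Z = 1.
  by rewrite uv /gcdz/=; move: pq; rewrite /coprime => /eqP ->.
have u0 : 0 <= u + `|u| * q%:Z by nia.
exists `|(u + `|u| * q%:Z)%R|%N, (`|u| * p - v).
by rewrite gez0_abs// -uv; ring.
Qed.

Section at_most_one_attractor.
Context {R : realType}.
Variables (f f1 f2 : R -> R) (K : R).
Hypothesis f_periodic : forall x, f (x + 2 * pi) = f x.
Hypothesis f_deriv : forall x : R, is_derive x 1 f (f1 x).
Hypothesis f1_deriv : forall x : R, is_derive x 1 f1 (f2 x).
Hypothesis f2_lip : forall x y, `|f2 x - f2 y| <= K * `|x - y|.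
Hypothesis f_le : forall x, `|f x| <= K.
Hypothesis f1_le : forall x, `|f1 x| <= K.
Hypothesis f2_le : forall x, `|f2 x| <= K.

Let K0 : 0 <= K. Proof. exact: le_trans (f_le 0). Qed.

(** A periodic orbit would make the rotation number rational, so there are no attracting
    trajectories at all. *)
Lemma inf_cyclicity_irrational rho :
  (forall (p : int) (q : nat), (0 < q)%N -> rho <> p%:~R / q%:R) ->
  (inf_cyclicity f rho <= 1%:E)%E.
Proof.
move=> irr; apply: (@inf_cyclicity_le _ _ _ _ (1 + K)^-1) => [|r a aK rE].
  by rewrite invr_gt0 ltr_pwDl.
have aK1 : `|a| * K < 1.
  have : `|a| * (1 + K) < 1 by rewrite -ltr_pdivlMr ?div1r// ltr_pwDl.
  by have : 0 <= `|a| by []; nra.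
apply: counting_le1 => T1 T2 [x [q [p q0 [gx _ _]]] _] _; exfalso.
move/eqP: gx; rewrite subr_eq => /eqP gx.
apply: (irr p q q0); rewrite -rE.
apply: (rotation_number_periodic _ _ q0 gx) => [z|u v uv].
  exact: circle_family_shift.
exact: (circle_family_incr f_deriv f1_le).
Qed.

Variables (p : int) (q : nat) (A : R).
Hypotheses (q0 : (0 < q)%N) (pq : coprime `|p| q) (A0 : 0 < A).
Local Notation rho := (p%:~R / q%:R : R).
(** A constant added to the averaged displacement acts like a change of r, so only derivatives are
    compared with those of the wave. *)
Hypothesis f1_avg : forall x,
  `|\sum_(j < q) f1 (x + 2 * pi * rho * j%:R) + A * sin (q%:R * x)| <= A / 20.
Hypothesis f2_avg : forall x,
  `|\sum_(j < q) f2 (x + 2 * pi * rho * j%:R) + A * q%:R * cos (q%:R * x)| <= A * q%:R / 20.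

Let qR : 0 < q%:R :> R. Proof. by rewrite ltr0n. Qed.

(** Suppose x0 and y lie on distinct attracting trajectories. The points of the trajectory of x0
    reached by repeating the j-step return [s] are less than 17 pi / (8 q) apart, and two successive
    ones enclose y. All three are downward crossings of the displacement, which needs a length of at
    least 9 pi / (4 q). *)
Lemma inf_cyclicity_le1 : (inf_cyclicity f rho <= 1%:E)%E.
Proof.
have [j [l jl]] := coprime_shift q0 pq.
have [L L0 HL] := iter_near_rotation f_le f1_le f2_le q.
have [D D0 HD] := iter_near_rotation f_le f1_le f2_le j.
have [C C0 HC] := iter_expansion f_deriv f1_deriv f2_lip f_le f1_le f2_le rho q L0.
pose E := D + 2 * pi * L * j%:R.
have pi0 := @pi_gt0 R.
have E0 : 0 <= E by rewrite addr_ge0// !mulr_ge0// ltW.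
(* The three thresholds make the maps increasing, the O(a^2) error at most |a| A / 20, and [s]
   closer than pi / (8 q) to the translation by 2 pi / q. *)
pose a1 := Num.min (1 + K)^-1 (Num.min (A / 20 / (1 + C)) (pi / (8 * q%:R) / (1 + E))).
have a10 : 0 < a1.
  rewrite /a1 !lt_min invr_gt0 ltr_pwDl//=.
  by rewrite !divr_gt0// ?mulr_gt0// ltr_pwDl.
apply: (inf_cyclicity_le a10) => r a; rewrite !lt_min => /and3P[aK aC aE] rE.
set G := circle_family f r a.
have small (X B : R) : 0 <= X -> `|a| < B / (1 + X) -> `|a| * (1 + X) < B.
  by move=> X0; rewrite ltr_pdivlMr// ltr_pwDl.
have {}aK : `|a| * (1 + K) < 1 by apply: small; rewrite ?div1r.
have {}aC := small _ _ C0 aC; have {}aE := small _ _ E0 aE.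
have an0 : 0 <= `|a| by [].
have aK1 : `|a| * K < 1 by nra.
have a_le1 : `|a| <= 1 by rewrite mulrDr mulr1 in aK; have := mulr_ge0 an0 K0; lra.
have Gs x : G (x + 2 * pi) = G x + 2 * pi by exact: circle_family_shift.
have Gi x y : x < y -> G x < G y by exact: (circle_family_incr f_deriv f1_le).
pose h x := iter q G x - 2 * pi * p%:~R.
pose Phi x := h x - x.
have hi x y : x < y -> h x < h y by exact: first_return_incr.
(* A periodic point forces r to be within O(a) of [rho], which the averaging estimate requires. *)
have rL x : h x = x -> `|r - rho| <= L * `|a|.
  move=> hx; have [H _ _] := HL r a x a_le1.
  have : `|2 * pi * q%:R * (r - rho)| <= L * `|a|.
    rewrite (le_trans _ H)// -normrN le_eqVlt; apply/orP; left; apply/eqP; congr (`|_|).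
    rewrite -{2}hx /h -/G; move: (pi) => P; field; exact: lt0r_neq0.
  apply: le_trans; rewrite normrM ler_peMl// ger0_norm; last by rewrite !mulr_ge0// ltW.
  have : 1 <= q%:R :> R by rewrite ler1n.
  by have := pi_ge2 R; nra.
have cross x : attracting_periodic G x ->
    [/\ h x = x, \forall y \near x^'+, h y < y & \forall y \near x^'-, y < h y].
  exact: attracting_periodic_crossing.
apply: counting_le1 => _ _ [x0 ax0 <-] [y ay <-].
have [hx0 _ _] := cross _ ax0; have [hy yR yL] := cross _ ay.
have rLa := rL _ hy.
(* For a = 0 the map [h] is a translation with a fixed point, hence the identity, and attracts
   nothing. *)
have [a0|ane0] := eqVneq a 0.
  exfalso; near y^'+ => t.
  have yt : y < t by near: t; exact: nbhs_right_gt.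
  have ht : h t < t by near: t.
  have iterE n s : iter n G s = s + n%:R * (2 * pi * r).
    elim: n => [|n IH]; first by rewrite mul0r addr0.
    by rewrite iterS IH /G /circle_family a0 mul0r addr0 -natr1; ring.
  by move: hy ht; rewrite /h !iterE; lra.
have a_gt0 : 0 < `|a| by rewrite normr_gt0.
apply: contrapT => neq.
(* By the choice of j and l this map is close to the translation by 2 pi / q; it commutes with [h]
   and keeps every point on its trajectory. *)
pose s x := iter j G x - 2 * pi * l%:~R.
have s_near x : `|s x - x - 2 * pi / q%:R| <= E * `|a|.
  have [H _ _] := HD r a x a_le1.
  have -> : s x - x - 2 * pi / q%:R =
      (iter j G x - x - 2 * pi * r * j%:R) + 2 * pi * j%:R * (r - rho).
    have jlR : j%:R * p%:~R = 1 + l%:~R * q%:R :> R.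
      by have := congr1 (fun z : int => z%:~R : R) jl; rewrite intrM intrD intrM.
    rewrite /s; have -> : 2 * pi * l%:~R = 2 * pi * ((1 + l%:~R * q%:R) / q%:R) - 2 *
        pi / q%:R :> R.
      by move: (pi) => P; field; exact: lt0r_neq0.
    by rewrite -jlR; ring.
  rewrite (le_trans (ler_normD _ _))// /E [leRHS]mulrDl lerD// normrM.
  rewrite (_ : 2 * pi * L * j%:R * `|a| = 2 * pi * j%:R * (L * `|a|)); last by ring.
  have h0 : 0 <= 2 * pi * j%:R :> R by rewrite !mulr_ge0// ltW.
  by rewrite ger0_norm// ler_wpM2l.
have s_lt x : s x - x < 17 * pi / (8 * q%:R).
  have : s x - x - 2 * pi / q%:R < pi / (8 * q%:R).
    by rewrite (le_lt_trans (ler_norm _))// (le_lt_trans (s_near x))//; nra.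
  have -> : 17 * pi / (8 * q%:R) = 2 * pi / q%:R + pi / (8 * q%:R) :> R.
    by move: (pi) => P; field; exact: lt0r_neq0.
  lra.
have s_gt x : pi / q%:R < s x - x.
  have : - (pi / (8 * q%:R)) < s x - x - 2 * pi / q%:R.
    by rewrite ltrNl (le_lt_trans (ler_norm _))// normrN (le_lt_trans (s_near x))//; nra.
  have -> : 2 * pi / q%:R = pi / q%:R + 8 * (pi / (8 * q%:R)) :> R.
    by move: (pi) => P; field; exact: lt0r_neq0.
  have : 0 < pi / (8 * q%:R) :> R by rewrite divr_gt0// mulr_gt0.
  lra.
have si u v : u < v -> s u < s v by move=> uv; rewrite /s ltrD2r iter_lift_incr.
have hs x : h (s x) = s (h x).
  rewrite /h /s -!mulrN -!intrN !iter_lift_shift// -!iterD addnC.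
  by rewrite addrAC.
(* Starting M turns to the left of x0 places the first point of the sequence [tau] to the left of
   y. *)
pose M : int := Num.ceil (`|x0 - y| / (2 * pi)).
pose tau k t := iter k s (t - 2 * pi * M%:~R).
have tauS k t : tau k.+1 t = s (tau k t) by [].
have tau_incr k u v : u < v -> tau k u < tau k v.
  move=> uv; rewrite /tau; elim: k => [|k IH]; first by rewrite /= ltrD2r.
  by rewrite !iterS si.
have tauh k t : h (tau k t) = tau k (h t).
  rewrite /tau; elim: k => [|k IH]; last by rewrite !iterS hs IH.
  by rewrite /= /h -mulrN -intrN iter_lift_shift// addrAC.
have tau_cont k : continuous (tau k).
  have sc : continuous s.
    move=> t; apply: cvgB; last exact: cvg_cst.
    apply: differentiable_continuous; apply/derivable1_diffP.
    by have [] := is_derive_iter f_deriv r a j t.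
  elim: k => [|k IH] t; first by apply: cvgB; [exact: cvg_id|exact: cvg_cst].
  exact: (continuous_comp (IH t) (sc _)).
(* [tau k] is increasing, continuous and commutes with [h], so it carries the sign pattern of [Phi]
   around x0 to the point [tau k x0]. *)
have right k e : tau k x0 < e -> exists2 t, tau k x0 < t < e & Phi t < 0.
  move=> xe; have N : \forall t \near x0, tau k t < e by exact: (cvgr_lt _ (tau_cont k x0)).
  near x0^'+ => t; exists (tau k t); last first.
    by rewrite /Phi tauh subr_lt0 tau_incr//; near: t; have [] := cross _ ax0.
  rewrite tau_incr/=; last by near: t; exact: nbhs_right_gt.
  by near: t; exact: (cvg_within _ N).
have left k e : e < tau k x0 -> exists2 t, e < t < tau k x0 & 0 < Phi t.
  move=> xe; have N : \forall t \near x0, e < tau k t by exact: (cvgr_gt _ (tau_cont k x0)).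
  near x0^'- => t; exists (tau k t); last first.
    by rewrite /Phi tauh subr_gt0 tau_incr//; near: t; have [] := cross _ ax0.
  rewrite tau_incr ?andbT/=; last by near: t; exact: nbhs_left_lt.
  by near: t; exact: (cvg_within _ N).
have hx k : h (tau k x0) = tau k x0 by rewrite tauh hx0.
have onT k : trajectory G x0 (tau k x0).
  rewrite /tau; elim: k => [|k [n' [m' IH]]].
    by exists 0%N, (- M); rewrite /= intrN mulrN.
  exists (j + n')%N, (m' - l); rewrite iterS /s IH iter_lift_shift// iterD -addrA.
  by congr (_ + _); rewrite intrD intrN; ring.
have far k : tau 0%N x0 + k%:R * (pi / q%:R) <= tau k x0.
  elim: k => [|k IH]; first by rewrite mul0r addr0.
  by rewrite tauS -natr1 mulrDl mul1r; have := s_gt (tau k x0); lra.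
have t0y : tau 0%N x0 <= y.
  have : `|x0 - y| / (2 * pi) <= M%:~R by exact: ceil_ge.
  rewrite ler_pdivrMr ?mulr_gt0// => H.
  rewrite /tau/=; have := ler_norm (x0 - y); lra.
have [k /andP[ky yk]] : exists k, tau k x0 <= y < tau k.+1 x0.
  have exP : exists k, y < tau k x0.
    exists (Num.truncn ((y - tau 0%N x0) / (pi / q%:R))).+1; apply: lt_le_trans (far _).
    rewrite -ltrBlDl -ltr_pdivrMr ?divr_gt0//; exact: truncnS_gt.
  have [[|k]] := ex_minnP exP; first by rewrite ltNge t0y.
  move=> Pk kmin; exists k; rewrite Pk andbT leNgt.
  by apply/negP => /kmin; rewrite ltnn.
(* Equality would put y on the trajectory of x0. *)
have {}ky : tau k x0 < y.
  rewrite lt_neqAle ky andbT; apply/eqP => xy.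
  apply: neq; rewrite -xy; apply/esym.
  exact: (@trajectory_mem R G Gs q p q0).

(* At a zero of the derivative under consideration, its average S is at most A / 20 in absolute
   value; together with the distance B / 20 from S to - B T this gives |T| <= 1/10. *)
have bound (S T B : R) : A <= B -> `|0 - a * S| <= C * a ^+ 2 ->
    `|S + B * T| <= B / 20 -> `|T| <= 1 / 10.
  move=> AB; have B0 : 0 < B by exact: lt_le_trans AB.
  rewrite sub0r normrN normrM -real_normK ?num_real// expr2 mulrCA ler_pM2l// => h1 h2.
  rewrite -(ler_pM2l B0) -{1}(gtr0_norm B0) -normrM.
  have -> : B * T = (S + B * T) - S by ring.
  have : `|a| * C <= A / 20 by rewrite mulrDr mulr1 in aC; lra.
  by rewrite (le_trans (ler_normB _ _))//; lra.
suff : 9 * pi / 4 <= q%:R * (tau k.+1 x0 - tau k x0).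
  have := s_lt (tau k x0); rewrite ltr_pdivlMr ?mulr_gt0// tauS mulrCA [_ * q%:R]mulrC.
  by move=> H; apply/negP; rewrite -ltNge; lra.
apply: (@three_down_crossings R Phi (fun t =>
    diter f f1 r a q t - 1) (dditer f f1 f2 r a q) _ qR _ _ _ _ _ y _) => //.
- move=> t.
  have H1 := is_derive_iter f_deriv r a q t.
  have H2 := is_deriveB (is_deriveB H1 (is_derive_cst (2 * pi * p%:~R : R) t (1 :
      R))) (is_derive_id t (1 : R)).
  by move: H2; rewrite subr0.
- move=> t; have H1 := is_derive_diter f_deriv f1_deriv r a q t.
  have H2 := is_deriveB H1 (is_derive_cst (1 : R) t (1 : R)).
  by move: H2; rewrite subr0.
- move=> t t1; have [_ H1 _] := HC r a t a_le1 rLa.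
  by rewrite t1 in H1; exact: (bound _ _ _ (lexx A) H1 (f1_avg t)).
- move=> t t1; have [_ _ H1] := HC r a t a_le1 rLa.
  rewrite t1 -[0]subr0 in H1; apply: (bound _ _ (A * q%:R) _ _ (f2_avg t)).
    by rewrite ler_peMr ?ler1n// ltW.
  by rewrite subr0 in H1.
- by rewrite /Phi hx subrr.
- by rewrite /Phi hy subrr.
- by rewrite /Phi hx subrr.
- exact: right.
- move=> e ey; near y^'- => t; exists t; last by rewrite /Phi subr_gt0; near: t.
  by apply/andP; split; near: t; [exact: nbhs_left_gt|exact: nbhs_left_lt].
- move=> e ey; near y^'+ => t; exists t; last by rewrite /Phi subr_lt0; near: t.
  by apply/andP; split; near: t; [exact: nbhs_right_gt|exact: nbhs_right_lt].
- exact: left.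
Unshelve. all: by end_near. Qed.

End at_most_one_attractor.

Lemma slope_range (R : realFieldType) (X P t : R) :
  X * (7 / 10) <= t <= X -> `|P + t| <= X / 10 -> - (X * 2) <= P <= - (X / 2).
Proof. by move=> /andP[t1 t2]; rewrite ler_norml => /andP[P1 P2]; apply/andP; split; lra. Qed.

Lemma contraction_of_slope (R : realFieldType) (X P : R) : 0 < X -> X < 1 / 2 ->
  - (X * 2) <= P - 1 <= - (X / 2) -> `|P| <= 1 - X / 2.
Proof.
by move=> X0 X1 /andP[P1 P2]; rewrite ler_norml; apply/andP; split; lra.
Qed.

Lemma wave_gap (R : realFieldType) (p i k L u v : R) : 0 < p ->
  2 * p * i + p / 4 < u -> u < 2 * p * i + 3 * p / 4 ->
  2 * p * k + p / 4 < v -> v < 2 * p * k + 3 * p / 4 ->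
  `|v - u - 2 * p * L| < p / 8 -> `|2 * p * (k - i - L)| < 2 * p.
Proof.
move=> p0 i1 i2 k1 k2; rewrite !ltr_norml => /andP[n1 n2].
by apply/andP; split; lra.
Qed.

Lemma contraction_attracting (R : realType) (h : R -> R) (x d lam : R) :
  0 < d -> 0 <= lam < 1 -> h x = x ->
  (forall y, `|y - x| < d -> `|h y - x| <= lam * `|y - x|) ->
  attracting_fixpoint h x.
Proof.
move=> d0 /andP[l0 l1] hx H.
have it n y : `|y - x| < d -> `|iter n h y - x| <= lam ^+ n * `|y - x|.
  move=> yd; elim: n => [|n IH]; first by rewrite expr0 mul1r.
  rewrite iterS exprS -mulrA (le_trans (H _ _))//; last by rewrite ler_wpM2l.
  by rewrite (le_lt_trans IH)// (le_lt_trans _ yd)// ler_piMl// exprn_ile1// ltW.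
have nd e : 0 < e -> \forall y \near x, `|y - x| < e.
  move=> e0; near=> y; rewrite distrC; near: y.
  by apply/nbhs_ballP; exists e.
split => //.
- move=> e e0; near=> y => n.
  have yd : `|y - x| < d by near: y; exact: nd.
  have ye : `|y - x| < e by near: y; exact: nd.
  rewrite (le_lt_trans (it n y yd))// (le_lt_trans _ ye)// ler_piMl//.
  by rewrite exprn_ile1// ltW.
- near=> y; have yd : `|y - x| < d by near: y; exact: nd.
  apply/cvgrPdist_le => e e0.
  have : (fun n => lam ^+ n * `|y - x|) @ \oo --> (0 : R).
    rewrite -(mul0r `|y - x|); apply: cvgM; last exact: cvg_cst.
    by apply: cvg_expr; rewrite ger0_norm.
  move=> /cvgrPdist_le/(_ _ e0); apply: filterS => n; rewrite sub0r normrN.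
  rewrite ger0_norm ?mulr_ge0 ?exprn_ge0// (distrC x); exact: le_trans (it n y yd).
Unshelve. all: by end_near. Qed.

Lemma int_norm_lt1 (R : realType) (z : int) : `|z%:~R : R| < 1 -> z = 0.
Proof. by rewrite -intr_norm -[1]/(1%:~R) ltr_int; lia. Qed.

Lemma int_multiple_lt (i k m : nat) (s : int) : (i < m)%N -> (k < m)%N ->
  k%:Z = i%:Z + m%:Z * s -> k = i.
Proof.
move=> im km ks; case: (ltgtP s 0) => s0; last by move: ks; rewrite s0; lia.
- have h : m%:Z * s <= m%:Z * (-1) by rewrite ler_wpM2l//; lia.
  by lia.
- have h : m%:Z * 1 <= m%:Z * s by rewrite ler_wpM2l//; lia.
  by lia.
Qed.

(** * Many attracting trajectories from a wave of higher frequency *)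

Section many_attractors.
Context {R : realType}.
Variables (f f1 f2 : R -> R) (K : R).
Hypothesis f_periodic : forall x, f (x + 2 * pi) = f x.
Hypothesis f_deriv : forall x : R, is_derive x 1 f (f1 x).
Hypothesis f1_deriv : forall x : R, is_derive x 1 f1 (f2 x).
Hypothesis f2_lip : forall x y, `|f2 x - f2 y| <= K * `|x - y|.
Hypothesis f_le : forall x, `|f x| <= K.
Hypothesis f1_le : forall x, `|f1 x| <= K.
Hypothesis f2_le : forall x, `|f2 x| <= K.

Let K0 : 0 <= K. Proof. exact: le_trans (f_le 0). Qed.

Lemma iter_near_rotation_upto N : exists2 C : R, 0 <= C & forall n r a x, (n < N)%N ->
  `|a| <= 1 -> `|iter n (circle_family f r a) x - x - 2 * pi * r * n%:R| <= C * `|a|.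
Proof.
elim: N => [|N [C C0 IH]]; first by exists 0.
have [D D0 HD] := iter_near_rotation f_le f1_le f2_le N.
exists (C + D) => [|n r a x]; first exact: addr_ge0.
rewrite ltnS leq_eqVlt => /predU1P[->|nN] a1.
  have [H _ _] := HD r a x a1; rewrite (le_trans H)// ler_wpM2r// lerDr//.
by rewrite (le_trans (IH n r a x nN a1))// ler_wpM2r// lerDl.
Qed.

Variables (q m : nat) (A kappa : R).
Hypotheses (q0 : (0 < q)%N) (m0 : (0 < m)%N) (A0 : 0 < A).
Local Notation rho := (1%:~R / q%:R : R).
Local Notation mq := ((m * q)%:R : R).
(** [kappa] is the mean of f, which the choice of r cancels below. *)
Hypothesis f_avg : forall x,
  `|\sum_(j < q) f (x + 2 * pi * rho * j%:R) - q%:R * kappa - A * cos (mq * x)| <= A / 20.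
Hypothesis f1_avg : forall x,
  `|\sum_(j < q) f1 (x + 2 * pi * rho * j%:R) + A * mq * sin (mq * x)| <= A * mq / 20.

Let qR : 0 < q%:R :> R. Proof. by rewrite ltr0n. Qed.
Let mqR : 1 <= mq. Proof. by rewrite ler1n muln_gt0 m0. Qed.

Let c4 : 7 / 10 < cos (pi / 4) :> R.
Proof.
have h1 : cos (pi / 2) = cos (pi / 4) ^+ 2 *+ 2 - 1 :> R.
  by rewrite -cos_mulr2n; congr cos; rewrite -mulr_natr; field.
have h5 : 0 < cos (pi / 4) :> R.
  by have p0 := @pi_gt0 R; apply: cos_gt0_pihalf; lra.
rewrite ltNge; apply/negP => h.
have : cos (pi / 4) ^+ 2 <= (7 / 10) ^+ 2 :> R by rewrite lerXn2r// ?nnegrE; lra.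
by move: h1; rewrite cos_pihalf mulr2n !expr2; lra.
Qed.

Let sin_ge (s : R) : pi / 4 <= s <= 3 * pi / 4 -> 7 / 10 <= sin s.
Proof.
move=> /andP[s1 s2]; have p0 := @pi_gt0 R.
apply: (le_trans (ltW c4)); rewrite -cosBpihalf -(cos_norm (s - _)) leNgt.
rewrite ltr_cos; first by rewrite -leNgt ler_norml; lra.
  by rewrite in_itv/=; apply/andP; split; lra.
by rewrite in_itv/= normr_ge0/= ler_norml; lra.
Qed.

(** Once r cancels the mean, the displacement is close to a A cos (m q x), which decreases through 0
    once in every wave, at an attracting fixed point of [h]. The iterates of such a point move by
    multiples of 2 pi / q, that is by multiples of m waves, so m consecutive waves carry distinct
    trajectories. *)
Lemma inf_cyclicity_ge : (m%:R%:E <= inf_cyclicity f rho)%E.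
Proof.
have pi0 : 0 < pi :> R := @pi_gt0 R.
have mq0 : 0 < mq := lt_le_trans ltr01 mqR.
have [C C0 HC] := iter_expansion f_deriv f1_deriv f2_lip f_le f1_le f2_le rho q (normr_ge0 kappa).
have [D D0 HD] := iter_near_rotation_upto q.
pose E := D + q%:R * `|kappa|.
have E0 : 0 <= E by rewrite addr_ge0// mulr_ge0.
apply: inf_cyclicity_ge_of => a1 a10.
(* In turn: a is below the prescribed bound, the maps are increasing, the O(a^2) error is below a A
   / 20, fewer than q iterates stay within pi / (8 m q) of the rotation, and the displacement is not
   so steep that [h] overshoots its fixed points. *)
pose B := Num.min a1 (Num.min (1 + K)^-1 (Num.min (A / 20 / (1 + C))
  (Num.min (pi / (8 * mq) / (1 + E)) (1 / (2 * (A * mq)))))).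
have B0 : 0 < B.
  rewrite /B !lt_min a10/= invr_gt0 ltr_pwDl//= !divr_gt0 ?mulr_gt0//.
    by rewrite ltr_pwDl.
  by rewrite ltr_pwDl.
have [a a0] : exists2 a : R, 0 < a & a < B by exists (B / 2); lra.
rewrite !lt_min => /and5P[aa1 aK aC aE aA].
have small (X Y : R) : 0 <= X -> a < Y / (1 + X) -> a * (1 + X) < Y.
  by move=> X0; rewrite ltr_pdivlMr// ltr_pwDl.
have {}aK : a * (1 + K) < 1 by apply: small; rewrite ?div1r.
have {}aC := small _ _ C0 aC; have {}aE := small _ _ E0 aE.
have {}aA : a * (A * mq) < 1 / 2.
  move: aA; rewrite ltr_pdivlMr; last by rewrite !mulr_gt0.
  by rewrite mulrCA; move: (a * _) => X; lra.
have an : `|a| = a by rewrite gtr0_norm.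
have aK' := mulr_ge0 (ltW a0) K0.
have aK1 : `|a| * K < 1 by rewrite an; rewrite mulrDr mulr1 in aK; lra.
have a_le1 : `|a| <= 1 by rewrite an; rewrite mulrDr mulr1 in aK; lra.
(* Over q steps this shift contributes - a q [kappa], which cancels the mean of the averaged
   displacement. *)
pose r := rho - a * kappa / (2 * pi).
exists r, a; set G := circle_family f r a.
have Gs x : G (x + 2 * pi) = G x + 2 * pi by exact: circle_family_shift.
have Gi x y : x < y -> G x < G y by exact: (circle_family_incr f_deriv f1_le).
have r_rho : r - rho = - (a * kappa / (2 * pi)) by rewrite /r; ring.
have rL : `|r - rho| <= `|kappa| * `|a|.
  have p2 : 0 < 2 * pi :> R by rewrite mulr_gt0.
  rewrite r_rho normrN normrM normfV (gtr0_norm p2) ler_pdivrMr// normrM mulrC.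
  by rewrite ler_peMr ?mulr_ge0//; have := pi_ge2 R; lra.
pose h x := iter q G x - 2 * pi * 1%:~R.
pose Phi x := h x - x; pose Phi1 x := diter f f1 r a q x - 1.
have hd (x : R) : is_derive x 1 h (diter f f1 r a q x).
  have H1 := is_derive_iter f_deriv r a q x.
  have := is_deriveB H1 (is_derive_cst (2 * pi * 1%:~R : R) x (1 : R)).
  by rewrite subr0.
have Phid (x : R) : is_derive x 1 Phi (Phi1 x).
  exact: (is_deriveB (hd x) (is_derive_id x (1 : R))).
have aCA : C * a ^+ 2 <= a * A / 20.
  rewrite expr2 mulrCA -mulrA ler_pM2l//.
  by rewrite mulrDr mulr1 in aC; lra.
have PhiE x : `|Phi x - a * A * cos (mq * x)| <= a * A / 10.
  have [H _ _] := HC r a x a_le1 rL.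
  have -> : Phi x - a * A * cos (mq * x) = (iter q (circle_family f r a) x - x - 2 * pi * r * q%:R -
      a * \sum_(j < q) f (x + 2 * pi * rho * j%:R)) +
      a * (\sum_(j < q) f (x + 2 * pi * rho * j%:R) - q%:R * kappa - A * cos (mq * x)).
    rewrite /Phi /h -/G; set S := \sum_(j < q) _.
    have -> : 2 * pi * r * q%:R = 2 * pi - a * kappa * q%:R.
      by rewrite /r; move: (pi : R) pi0 => P P0; field; rewrite !lt0r_neq0.
    by ring.
  rewrite (le_trans (ler_normD _ _))// normrM an.
  have := ler_wpM2l (ltW a0) (f_avg x); move: H aCA; lra.
have Phi1E x : `|Phi1 x + a * A * mq * sin (mq * x)| <= a * A * mq / 10.
  have [_ H _] := HC r a x a_le1 rL.
  have -> : Phi1 x + a * A * mq * sin (mq * x) = (diter f f1 r a q x - 1 -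
      a * \sum_(j < q) f1 (x + 2 * pi * rho * j%:R)) +
      a * (\sum_(j < q) f1 (x + 2 * pi * rho * j%:R) + A * mq * sin (mq * x)).
    by rewrite /Phi1; ring.
  rewrite (le_trans (ler_normD _ _))// normrM an.
  have H1 := ler_wpM2l (ltW a0) (f1_avg x).
  have H2 : a * A <= a * A * mq by rewrite ler_peMr// mulr_ge0// ltW.
  have -> : a * A * mq / 10 = a * A * mq / 20 + a * (A * mq / 20) by field.
  rewrite lerD// (le_trans H)// (le_trans aCA)//; lra.
(* Between the phases pi / 4 and 3 pi / 4 the cosine goes from above 7/10 to below - 7/10 while the
   sine stays above 7/10: the errors spoil neither the change of sign nor the negative slope. *)
pose lo (i : nat) := (2 * pi * i%:R + pi / 4) / mq.
pose hi (i : nat) := (2 * pi * i%:R + 3 * pi / 4) / mq.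
have lohi i : lo i < hi i by rewrite ltr_pM2r ?invr_gt0//; lra.
have cos_shift (i : nat) (s : R) : cos (2 * pi * i%:R + s) = cos s.
  by rewrite addrC; exact: (cos_periodic_int i%:Z).
have sin_shift (i : nat) (s : R) : sin (2 * pi * i%:R + s) = sin s.
  by rewrite addrC; exact: (sin_periodic_int i%:Z).
have mqK (s : R) : mq * (s / mq) = s by rewrite mulrC divfK// lt0r_neq0.
have aA0 : 0 < a * A by rewrite mulr_gt0.
have lo_pos i : 0 < Phi (lo i).
  have := PhiE (lo i); rewrite mqK cos_shift ler_norml => /andP[H _].
  have H' : a * A * (7 / 10) < a * A * cos (pi / 4) by rewrite ltr_pM2l.
  by lra.
have hi_neg i : Phi (hi i) < 0.
  have := PhiE (hi i); rewrite mqK cos_shift.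
  have -> : 3 * pi / 4 = - (pi / 4) + pi :> R by field.
  rewrite cosDpi cosN ler_norml => /andP[_ H].
  have H' : a * A * (7 / 10) < a * A * cos (pi / 4) by rewrite ltr_pM2l.
  by lra.
have Phi1_in i x : lo i <= x <= hi i -> - (a * (A * mq) * 2) <= Phi1 x <= - (a * (A * mq) / 2).
  move=> /andP[]; rewrite ler_pdivrMr// ler_pdivlMr// => x1 x2.
  have : (7 / 10 <= sin (mq * x)) && (sin (mq * x) <= 1).
    rewrite sin_le1 andbT.
    have -> : mq * x = 2 * pi * i%:R + (x * mq - 2 * pi * i%:R) by ring.
    by rewrite sin_shift; apply: sin_ge; lra.
  move=> /andP[s1 s2]; have := Phi1E x; rewrite -(mulrA a) => P.
  have X0 : 0 < a * (A * mq) by rewrite !mulr_gt0.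
  by apply: (slope_range _ P); rewrite ler_pM2l// s1 ler_piMr// ltW.
have xex i : exists x, lo i < x < hi i /\ h x = x.
  have [||x xi Px] := @IVT R Phi (lo i) (hi i) 0 (ltW (lohi i)).
  - apply: continuous_subspaceT => z; apply: differentiable_continuous.
    by apply/derivable1_diffP; have [] := Phid z.
  - by rewrite ge_min le_max (ltW (lo_pos i)) (ltW (hi_neg i)) orbT.
  exists x; split; last by apply/eqP; rewrite -subr_eq0; apply/eqP.
  move: xi; rewrite in_itv/= => /andP[x1 x2]; rewrite !lt_neqAle x1 x2 !andbT.
  by apply/andP; split; apply/eqP => xE; [have := lo_pos i; rewrite xE Px ltxx|
    have := hi_neg i; rewrite -xE Px ltxx].
have [x xP] := choice xex.
have att i : attracting_fixpoint h (x i).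
  have [/andP[x1 x2] hx] := xP i.
  have X0 : 0 < a * (A * mq) by rewrite !mulr_gt0.
  apply: (@contraction_attracting _ _ _ (Num.min (x i - lo i) (hi i - x i)) (1 - a * (A * mq) / 2)).
  - by rewrite lt_min !subr_gt0 x1.
  - by lra.
  - exact: hx.
  move=> y; rewrite lt_min => /andP[y1 y2].
  have lip c : lo i < c < hi i -> `|diter f f1 r a q c| <= 1 - a * (A * mq) / 2.
    move=> /andP[c1 c2]; have /Phi1_in : lo i <= c <= hi i by rewrite (ltW c1) (ltW c2).
    exact: (contraction_of_slope X0 aA).
  rewrite -{1}hx; have [xy|yx|->] := ltgtP (x i) y; last by rewrite !subrr normr0 mulr0.
    have [c /andP[c1 c2] ->] := mvt_between hd xy.
    rewrite normrM ler_wpM2r// lip//; move: y2; rewrite ltr_norml ltrD2r => /andP[_ y3].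
    by rewrite (lt_trans x1 c1) (lt_trans c2 y3).
  rewrite distrC (distrC y); have [c /andP[c1 c2] ->] := mvt_between hd yx.
  rewrite normrM ler_wpM2r// lip//; move: y1; rewrite distrC ltr_norml ltrD2l ltrN2 => /andP[_ y3].
  by rewrite (lt_trans y3 c1) (lt_trans c2 x2).
have qx i : iter q G (x i) = x i + 2 * pi * 1%:~R.
  by have [_ H] := xP i; rewrite -{2}H /h subrK.
split; first by rewrite an.
  exact: (rotation_number_periodic Gs Gi q0 (qx 0%N)).
apply: (@counting_ge R _ m (fun i : 'I_m => trajectory G (x i))) => [i k ik|i]; last first.
  exists (x i) => //; exists q, 1 => //; exact: att.
have [n [l xk]] : trajectory G (x i) (x k) by rewrite ik; exists 0%N, 0; rewrite mulr0 addr0.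
(* Periodicity reduces the number of iterations modulo q, so that the uniform estimate for fewer
   than q iterations applies. *)
have {l}[n' [l [n'q {}xk]]] : exists n' (l : int), (n' < q)%N /\
    x k = iter n' G (x i) + 2 * pi * l%:~R.
  exists (n %% q)%N, (l + (n %/ q)%N%:Z); rewrite ltn_mod; split => //.
  rewrite xk {1}(divn_eq n q) addnC iterD (iter_period_mul Gs _ (qx i)).
  by rewrite iter_lift_shift// mulr1 intrD; ring.
have near : `|x k - x i - 2 * pi * (n'%:R / q%:R) - 2 * pi * l%:~R| <= E * a.
  have := HD n' r a (x i) n'q a_le1; rewrite -/G an => H.
  have -> : x k - x i - 2 * pi * (n'%:R / q%:R) - 2 * pi * l%:~R =
    (iter n' G (x i) - x i - 2 * pi * r * n'%:R) - a * kappa * n'%:R.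
    rewrite xk /r; move: (pi : R) pi0 => P P0; field; rewrite !lt0r_neq0//.
  rewrite (le_trans (ler_normB _ _))// /E [leRHS]mulrDl lerD// !normrM an.
  rewrite (ger0_norm (_ : 0 <= n'%:R))// [leLHS]mulrC -mulrA (mulrC a) ler_wpM2r//.
    by rewrite mulr_ge0// ltW.
  by rewrite ler_nat ltnW.
have [/andP[i1 i2] _] := xP i; have [/andP[k1 k2] _] := xP k.
(* The difference, counted in waves, between the wave of x_k and the one to which n' steps and l
   turns lead from x_i. It is an integer of absolute value less than 1, so k and i are congruent
   modulo m. *)
pose z : int := k%:Z - i%:Z - m%:Z * (n'%:Z + l * q%:Z).
have zE : z%:~R = k%:R - i%:R - m%:R * (n'%:R + l%:~R * q%:R) :> R.
  by rewrite /z !(intrD, intrM, mulrNz).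
have z1 : `|z%:~R : R| < 1.
  have p2 : 0 < 2 * pi :> R by rewrite mulr_gt0.
  have nr : `|mq * (x k - x i) - 2 * pi * (m%:R * (n'%:R + l%:~R * q%:R))| < pi / 8.
    have -> : mq * (x k - x i) - 2 * pi * (m%:R * (n'%:R + l%:~R * q%:R)) =
        mq * (x k - x i - 2 * pi * (n'%:R / q%:R) - 2 * pi * l%:~R).
      by rewrite natrM; move: (pi : R) => P; field; rewrite lt0r_neq0.
    rewrite normrM (gtr0_norm mq0) mulrC -ltr_pdivlMr// (le_lt_trans near)//.
    rewrite -mulrA -invfM; apply: le_lt_trans aE.
    by rewrite mulrC ler_wpM2l ?(ltW a0)// lerDr.
  rewrite -(ltr_pM2l p2) -{1}(gtr0_norm p2) -normrM zE mulr1.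
  move: i1 i2 k1 k2; rewrite !ltr_pdivrMr// !ltr_pdivlMr// => i1 i2 k1 k2.
  rewrite mulrBr !(mulrC mq) in nr.
  exact: (wave_gap pi0 i1 i2 k1 k2 nr).
have z0 : z = 0 by exact: int_norm_lt1 z1.
apply/val_inj/esym; apply: (@int_multiple_lt i k m (n'%:Z + l * q%:Z)); rewrite ?ltn_ord//.
by apply/eqP; rewrite -subr_eq0 opprD addrA; exact/eqP.
Unshelve. all: by end_near. Qed.

End many_attractors.

(** * Dominant harmonics *)

Section lacunary_coefficients.
Context {R : realType}.

(** Of the six powers of 4 per unit of frequency, four beat the constant 80, one beats the factor
    k^2 of two derivatives, and one remains for summation over the indices n, of which there are two
    per frequency. *)
Definition kap : R := 4^-1 ^+ 6.

(** The fourth power is dictated by the dominant frequency m q with m <= q: its amplitude may be as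
    small as kap^(q^4), while a perturbation that survives the averaging over q points, apart from
    the constant, has n + 1 >= 2 q. *)
Definition eps (n : nat) : R := kap ^+ (n.+1 ^ 4).

(** Even indices are the cosines, so the centre of the cube is an even function. *)
Definition amp (S : pred nat) (n : nat) : R :=
  if ~~ odd n && S (freq n) then kap ^+ (freq n ^ 2) else 0.

Definition coef S (t : nat -> R) (n : nat) : R := amp S n + t n * eps n.

Lemma kap_gt0 : 0 < kap. Proof. by rewrite exprn_gt0// invr_gt0. Qed.

Lemma kap_le1 : kap <= 1.
Proof. by rewrite exprn_ile1 ?invr_ge0// invf_le1// ler1n. Qed.

Lemma kapX_gt0 n : 0 < kap ^+ n. Proof. by rewrite exprn_gt0// kap_gt0. Qed.

Lemma kapX_le i j : (i <= j)%N -> kap ^+ j <= kap ^+ i.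
Proof. by move=> ij; apply: ler_wiXn2l => //; [exact: ltW kap_gt0|exact: kap_le1]. Qed.

Lemma eps_gt0 n : 0 < eps n. Proof. exact: kapX_gt0. Qed.

Lemma amp_ge0 S n : 0 <= amp S n.
Proof. by rewrite /amp; case: ifP => // _; exact/ltW/kapX_gt0. Qed.

Lemma amp_le S n : amp S n <= kap ^+ (freq n ^ 2).
Proof. by rewrite /amp; case: ifP => // _; exact/ltW/kapX_gt0. Qed.

Lemma eps_le n : eps n <= kap ^+ (freq n ^ 2).
Proof. by apply: kapX_le; rewrite /freq uphalfE; nia. Qed.

(** Beyond a frequency N with 4^(6 N) >= exp (2 |L|), one factor kap^k of kap^(k^2) for each unit of
    frequency k absorbs the exponential; below N the exponential is bounded. *)
Lemma rapid_kap : rapid (fun n => kap ^+ (freq n ^ 2)).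
Proof.
move=> L; have [N LN] : exists N : nat, expR (2 * `|L|) <= 4 ^+ 6 ^+ N.
  exists (Num.truncn (expR (2 * `|L|))).+1.
  apply: (@le_trans _ _ (Num.truncn (expR (2 * `|L|))).+1%:R); first exact/ltW/truncnS_gt.
  by rewrite -!natrX ler_nat; apply/ltnW/ltn_expl.
exists (expR (`|L| * (2 * N)%:R)) => n; rewrite gtr0_norm ?kapX_gt0//.
have nf : (n <= 2 * freq n)%N by rewrite /freq uphalfE; lia.
have Ln : L * n%:R <= `|L| * (2 * freq n)%:R.
  rewrite (le_trans (ler_wpM2r _ (ler_norm L)))// ler_wpM2l// ler_nat//.
have [fN|Nf] := leqP (freq n) N.
  apply: (@le_trans _ _ (1 * expR (L * n%:R))).
    by rewrite ler_wpM2r ?expR_ge0// exprn_ile1 ?kap_le1// ltW// kap_gt0.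
  rewrite mul1r ler_expR (le_trans Ln)// ler_wpM2l// ler_nat leq_mul2l fN orbT//.
apply: (@le_trans _ _ 1); last by rewrite -expR0 ler_expR mulr_ge0.
rewrite /kap exprVn exprVn mulrC ler_pdivrMr ?exprn_gt0// mul1r.
apply: (@le_trans _ _ (expR (2 * `|L|) ^+ freq n)).
  by rewrite -expRM_natr ler_expR (le_trans Ln)// natrM mulrA (mulrC `|L|).
apply: (@le_trans _ _ ((4 ^+ 6 ^+ N) ^+ freq n)).
  by rewrite lerXn2r// nnegrE ?expR_ge0// !exprn_ge0.
rewrite -(exprM (4 ^+ 6)); apply: ler_weXn2l; first by rewrite exprn_ege1// ler1n.
by rewrite leq_mul2r ltnW ?orbT.
Qed.

Lemma rapid_eps : rapid eps.
Proof.
apply: (le_rapid (C := 1) (L := 0) rapid_kap) => n.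
by rewrite mul0r expR0 mulr1 mul1r !gtr0_norm ?kapX_gt0// eps_le.
Qed.

Lemma rapid_coef S t : (forall n, 0 <= t n <= 1) -> rapid (coef S t).
Proof.
move=> t01; apply: (le_rapid (C := 2) (L := 0) rapid_kap) => n.
rewrite mul0r expR0 mulr1 (gtr0_norm (kapX_gt0 _)) /coef.
have /andP[t0 t1] := t01 n.
rewrite ger0_norm ?addr_ge0 ?amp_ge0 ?mulr_ge0 ?(ltW (eps_gt0 n))//.
have := amp_le S n; have := eps_le n.
have : t n * eps n <= eps n by rewrite ler_piMl// ltW// eps_gt0.
lra.
Qed.

Lemma rapid_amp S : rapid (amp S).
Proof.
have := @rapid_coef S (fun=> 0) (fun _ => _); rewrite lexx ler01 => /(_ (fun=> isT)).
by rewrite (_ : coef S _ = amp S)//; apply/funext => n; rewrite /coef mul0r addr0.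
Qed.

Lemma kapX_decay k : (0 < k)%N -> kap ^+ k * k%:R ^+ 2 <= (80 * 4 ^+ k)^-1.
Proof.
case: k => // k _; rewrite /kap exprVn exprVn mulrC ler_pdivrMr ?exprn_gt0//.
rewrite mulrC ler_pdivlMr ?mulr_gt0 ?exprn_gt0//.
have h1 : k.+1%:R ^+ 2 <= 4 ^+ k.+1 :> R.
  have -> : 4 = 2 ^+ 2 :> R by rewrite -natrX.
  rewrite -exprM mulnC exprM lerXn2r// ?nnegrE// -natrX ler_nat.
  exact/ltnW/ltn_expl.
have h2 : 80 <= (4 ^+ k.+1) ^+ 4 :> R.
  rewrite -exprM (_ : k.+1 * 4 = 4 + 4 * k)%N; last by lia.
  rewrite exprD; apply: (@le_trans _ _ (4 ^+ 4)); first by rewrite -natrX ler_nat.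
  by rewrite ler_peMr ?exprn_ge0// exprn_ege1// ler1n.
have -> : 4 ^+ 6 ^+ k.+1 = (4 ^+ k.+1) ^+ 4 * 4 ^+ k.+1 * 4 ^+ k.+1 :> R.
  by rewrite -!exprM -!exprD; congr (_ ^+ _); lia.
have p : 0 <= 4 ^+ k.+1 :> R by rewrite exprn_ge0.
rewrite mulrC ler_pM ?mulr_ge0//; last by rewrite ler_pM.
Qed.

Lemma eps_decay (m q n : nat) : (0 < q)%N -> (m <= q)%N -> (q <= freq n)%N ->
  eps n * (freq n)%:R ^+ 2 <= kap ^+ ((m * q) ^ 2) / 80 / 2 ^+ n.
Proof.
move=> q0 mq qn.
have fn := freq_le n; have nf : (2 * freq n <= n.+1)%N by rewrite /freq uphalfE; lia.
have e4 : ((m * q) ^ 2 + n.+1 <= n.+1 ^ 4)%N.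
  have h1 : (m * q <= q * q)%N by rewrite leq_mul2r mq orbT.
  have h2 : (2 * q <= n.+1)%N by apply: leq_trans nf; rewrite leq_mul2l.
  have h3 : (4 * (q * q) <= n.+1 * n.+1)%N by nia.
  have h4 : (2 <= n.+1)%N by nia.
  rewrite (_ : n.+1 ^ 4 = (n.+1 * n.+1) * (n.+1 * n.+1))%N; last by rewrite !expnS expn0; ring.
  rewrite (_ : (m * q) ^ 2 = (m * q) * (m * q))%N; last by rewrite !expnS expn0; ring.
  move: (m * q)%N (q * q)%N h1 h3 => u v h1 h3.
  have : (4 * u <= n.+1 * n.+1)%N by lia.
  have h5 : (n.+1 <= n.+1 * n.+1)%N by nia.
  move: (n.+1 * n.+1)%N h5 => w h5 h6; nia.
apply: (@le_trans _ _ (kap ^+ ((m * q) ^ 2) * (kap ^+ n.+1 * n.+1%:R ^+ 2))).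
  rewrite mulrA -exprD ler_pM ?(ltW (kapX_gt0 _)) ?exprn_ge0//; first exact: kapX_le.
  by rewrite lerXn2r// ?nnegrE// ler_nat (leq_trans fn).
rewrite -!mulrA ler_pM2l ?kapX_gt0// (le_trans (kapX_decay _))//.
rewrite invfM ler_pM2l ?invr_gt0// lef_pV2 ?posrE ?exprn_gt0//.
apply: (@le_trans _ _ (2 ^+ n.+1)); first by apply: ler_weXn2l => //; rewrite ler1n.
by rewrite lerXn2r ?nnegrE// ler_nat.
Qed.

(** For l > k one has l^2 >= k^2 + l, so passing to a higher frequency l gains a factor kap^l. Here
    n is even, whence 2^n = 4^l. *)
Lemma amp_decay S (k n : nat) : (k < freq n)%N ->
  amp S n * (freq n)%:R ^+ 2 <= kap ^+ (k ^ 2) / 80 / 2 ^+ n.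
Proof.
move=> kn; rewrite /amp; case: ifP => [/andP[on _]|_]; last first.
  by rewrite mul0r !mulr_ge0 ?(ltW (kapX_gt0 _)) ?invr_ge0 ?exprn_ge0.
have -> : 2 ^+ n = 4 ^+ freq n :> R.
  have -> : 4 = 2 ^+ 2 :> R by rewrite -natrX.
  by rewrite -exprM; congr (_ ^+ _); rewrite /freq uphalfE; lia.
rewrite -!mulrA; apply: (@le_trans _ _ (kap ^+ (k ^ 2) * (kap ^+ freq n * (freq n)%:R ^+ 2))).
  rewrite mulrA -exprD ler_wpM2r ?exprn_ge0//; apply: kapX_le.
  by move: (freq n) kn => l kn; nia.
rewrite ler_pM2l ?kapX_gt0// (le_trans (kapX_decay _))//; first exact: leq_ltn_trans kn.
by rewrite invfM.
Qed.

Section dominance.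
Variables (S : pred nat) (t : nat -> R) (m q : nat).
Hypothesis t01 : forall n, 0 <= t n <= 1.
Hypotheses (m0 : (0 < m)%N) (mq : (m <= q)%N) (Smq : S (m * q)).
Hypothesis Sq : forall k, (0 < k)%N -> S k -> (q %| k)%N -> (m * q <= k)%N.

Let q0 : (0 < q)%N. Proof. exact: leq_trans mq. Qed.
Let c : R := kap ^+ ((m * q) ^ 2).

(** The n-th remaining term is at most c / 40 / 2^n, half of it for the higher amplitudes and half
    for the perturbations, and the geometric sum is c / 20. Frequency 0 survives every averaging and
    is subtracted exactly; it is present for j = 0 only. *)
Lemma dominant_harmonic (j : nat) (x : R) : (j <= 2)%N ->
  `|tsum (fun n => (if (q %| freq n)%N then coef S t n else 0) * trig j n x) -
    (coef S t 0) *+ (j == 0) - c * trig j (2 * (m * q)) x| <= c * (m * q)%:R ^+ j / 20.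
Proof.
move=> j2; have rb := rapid_coef S t01; have c0 : 0 < c by exact: kapX_gt0.
have mq0 : (0 < m * q)%N by rewrite muln_gt0 m0 q0.
have g1 : geo (fun n => (if (q %| freq n)%N then coef S t n else 0) * trig j n x).
  apply: (le_geo (c := 1) (geo_trig j x rb)) => n; rewrite mul1r.
  by case: ifP => // _; rewrite mul0r normr0.
rewrite -(tsum_delta 0 (coef S t 0 *+ (j == 0))).
rewrite -(tsum_delta (2 * (m * q)) (c * trig j (2 * (m * q)) x)).
rewrite -tsumB//; last exact: geo_delta.
rewrite -tsumB; last exact: geo_delta; last by apply: geoD => //; apply/geoN/geo_delta.
set u := fun n => _.
have : forall n, `|u n| <= c / 40 / 2 ^+ n.
  move=> n; have r0 k : 0 <= c / 40 / 2 ^+ k by rewrite !mulr_ge0 ?(ltW c0) ?invr_ge0 ?exprn_ge0.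
  rewrite /u; have [->|n0] := eqVneq n 0%N.
    have -> : (0%N == (2 * (m * q))%N) = false by apply: ltn_eqF; rewrite muln_gt0.
    rewrite /= dvdn0 mulr1n mulr0n subr0.
    rewrite /trig/= /phase/= mul0r mul0r oppr0 !add0r.
    case: (j) => [|j']; rewrite (_ : _ - _ = 0) ?normr0 ?r0//.
      by rewrite expr0 mul0r cos0 !mulr1 mulr1n subrr.
    by rewrite expr0n/= mul0r mulr0 mulr0n subrr.
  rewrite mulr0n subr0.
  have fn0 : (0 < freq n)%N by rewrite /freq uphalfE; lia.
  case: ifPn => qn; last first.
    rewrite mul0r sub0r normrN; case: eqVneq => [nE|]; last by rewrite mulr0n normr0.
    exfalso; move: qn; rewrite nE /freq uphalfE.
    have -> : ((2 * (m * q)).+1./2 = m * q)%N by lia.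
    by rewrite dvdn_mull.
  have qfn : (q <= freq n)%N by exact: dvdn_leq.
  have -> : coef S t n * trig j n x - (c * trig j (2 * (m * q)) x) *+ (n == (2 * (m * q))%N) =
      (amp S n - c *+ (n == (2 * (m * q))%N) + t n * eps n) * trig j n x.
    by rewrite /coef; case: eqVneq => [<-|_]; rewrite ?mulr1n ?mulr0n; ring.
  have tr : `|trig j n x| <= (freq n)%:R ^+ 2.
    rewrite (le_trans (trig_le _ _ _))//; apply: ler_weXn2l => //.
    by rewrite ler1n.
  apply: (@le_trans _ _ (`|amp S n - c *+ (n == (2 * (m * q))%N)| * (freq n)%:R ^+ 2
      + eps n * (freq n)%:R ^+ 2)).
    rewrite normrM -mulrDl ler_pM// (le_trans (ler_normD _ _))// lerD2l normrM.
    have /andP[t0 t1] := t01 n; rewrite (ger0_norm t0) (gtr0_norm (eps_gt0 n)).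
    by rewrite ler_piMl// ltW// eps_gt0.
  have -> : c / 40 / 2 ^+ n = c / 80 / 2 ^+ n + c / 80 / 2 ^+ n by field; rewrite expf_neq0.
  rewrite lerD//; last exact: eps_decay.
  have r1 : 0 <= c / 80 / 2 ^+ n by rewrite !mulr_ge0 ?(ltW c0) ?invr_ge0 ?exprn_ge0.
  case: eqVneq => [nE|nE].
    have fE : freq n = (m * q)%N by rewrite nE /freq uphalfE; lia.
    rewrite mulr1n /amp fE Smq andbT (_ : ~~ odd n); last by rewrite nE oddM.
    by rewrite /c subrr normr0 mul0r.
  rewrite mulr0n subr0 (ger0_norm (amp_ge0 _ _)).
  have [Sn|Sn] := boolP (~~ odd n && S (freq n)); last by rewrite /amp (negbTE Sn) mul0r.
  apply: amp_decay; case/andP: Sn => on Sn.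
  rewrite ltn_neqAle Sq// andbT; apply: contra nE => /eqP ->.
  by rewrite /freq uphalfE; apply/eqP; lia.
move=> /geo_le[_ _ /le_trans]; apply.
have -> : 2 * (c / 40) = c * 1 / 20 by field.
by rewrite ler_wpM2r// ler_wpM2l ?(ltW c0)// exprn_ege1// ler1n.
Qed.

End dominance.
End lacunary_coefficients.

(** * Infinitesimal cyclicity of the functions in the cube *)

Section cyclicity_of_trigonometric_series.
Context {R : realType}.

Lemma lowest_terms (rho : R) (p : int) (q : nat) : (0 < q)%N -> rho = p%:~R / q%:R ->
  exists (p' : int) (q' : nat), [/\ (0 < q')%N, coprime `|p'| q' & rho = p'%:~R / q'%:R].
Proof.
move=> q0 rE; pose P n := `[< (0 < n)%N /\ exists p' : int, rho = p'%:~R / n%:R >].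
have exP : exists n, P n by exists q; apply/asboolP; split => //; exists p.
have [n /asboolP[n0 [p' pE]] nmin] := ex_minnP exP.
exists p', n; split => //; rewrite /coprime eqn_leq gcdn_gt0 n0 orbT andbT.
have d0 : (0 < gcdn `|p'| n)%N by rewrite gcdn_gt0 n0 orbT.
set d := gcdn _ _ in d0 *.
have [a aE] := dvdnP (dvdn_gcdl `|p'| n); have [b bE] := dvdnP (dvdn_gcdr `|p'| n).
rewrite -/d in aE bE.
have b0 : (0 < b)%N by move: n0; rewrite bE muln_gt0 => /andP[].
have dR : d%:R != 0 :> R by rewrite pnatr_eq0 -lt0n.
have bR : b%:R != 0 :> R by rewrite pnatr_eq0 -lt0n.
have : P b.
  apply/asboolP; split => //; exists (sgz p' * a%:Z).
  rewrite pE {1}(intEsg p') aE bE !intrM natrM PoszM intrM/=; field.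
  by rewrite dR bR.
by move=> /nmin; rewrite {1}bE; case: (d) d0 => // -[//|d'] _; nia.
Qed.

Variable (S : pred nat) (t : nat -> R).
Hypothesis t01 : forall n, 0 <= t n <= 1.

Local Notation b := (coef S t).

Let rb : rapid b. Proof. exact: rapid_coef. Qed.
Let K : R := \sum_(j < 4) trignorm b j.

Let tn_ge0 j : 0 <= trignorm b j.
Proof. by apply: tsum_ge0 => [|n]; [exact: geo_freqX|rewrite mulr_ge0// exprn_ge0]. Qed.

Let tnK j : (j < 4)%N -> trignorm b j <= K.
Proof.
move=> j4; rewrite /K (bigD1 (Ordinal j4))//= lerDl.
by apply: sumr_ge0.
Qed.

Let tK j : (j < 4)%N -> forall x, `|trigsum b j x| <= K.
Proof. by move=> j4 x; rewrite (le_trans (trigsum_le j x rb))// tnK. Qed.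

Let t_deriv j (x : R) : is_derive x 1 (trigsum b j) (trigsum b j.+1 x).
Proof. exact: is_derive_trigsum. Qed.

Let t2_lip x y : `|trigsum b 2 x - trigsum b 2 y| <= K * `|x - y|.
Proof. exact: (lipschitz_of_derive (t_deriv 2) (@tK 3 _)). Qed.

Let t_per x : trigsum b 0 (x + 2 * pi) = trigsum b 0 x.
Proof. exact: trigsum_periodic. Qed.

Lemma trig_even (j k : nat) (x : R) :
  trig j (2 * k) x = k%:R ^+ j * cos (k%:R * x + j%:R * (pi / 2)).
Proof.
rewrite /trig /phase oddM/= mul0r oppr0 add0r (_ : freq _ = k)//.
by rewrite /freq uphalfE; lia.
Qed.

Section harmonic.
Variables (m q : nat) (p : int).
Hypotheses (m0 : (0 < m)%N) (mq : (m <= q)%N) (Smq : S (m * q)).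
Hypothesis Sq : forall k, (0 < k)%N -> S k -> (q %| k)%N -> (m * q <= k)%N.
Hypothesis pq : coprime `|p| q.

Let q0 : (0 < q)%N. Proof. exact: leq_trans mq. Qed.
Let c : R := kap ^+ ((m * q) ^ 2).

Lemma rotation_average (j : nat) x : (j <= 2)%N ->
  `|\sum_(i < q) trigsum b j (x + 2 * pi * (p%:~R / q%:R) * i%:R) -
    q%:R * (b 0 *+ (j == 0)) - (q%:R * c) * trig j (2 * (m * q)) x| <=
    (q%:R * c) * (m * q)%:R ^+ j / 20.
Proof.
move=> j2; rewrite trigsum_rotation//.
rewrite (_ : _ - _ = q%:R * (tsum (fun n => (if (q %| freq n)%N then b n else 0) * trig j n x) -
    b 0 *+ (j == 0) - c * trig j (2 * (m * q)) x)); last by ring.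
rewrite normrM ger0_norm// -!mulrA ler_wpM2l// mulrA.
exact: dominant_harmonic.
Qed.

End harmonic.

Lemma trigsum_inf_cyclicity_le1 : (forall k, S k) ->
  forall rho, (inf_cyclicity (trigsum b 0) rho <= 1%:E)%E.
Proof.
move=> ST rho.
have [[p [q [q0 rE]]]|irr] := pselect (exists (p : int) (q : nat), (0 < q)%N /\ rho = p%:~R / q%:R).
  have [{}p [{}q [{}q0 pq {}rE]]] := lowest_terms q0 rE.
  have Sq1 k : (0 < k)%N -> S k -> (q %| k)%N -> (1 * q <= k)%N.
    by move=> k0 _; rewrite mul1n; exact: dvdn_leq.
  have avg j x (j2 : (j <= 2)%N) :=
    @rotation_average 1 q p (ltn0Sn 0) q0 (ST _) Sq1 pq j x j2.
  (* The averaged function is close to a constant plus q c cos (q x); the last factor q comes from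
     its derivative. *)
  have A0 : 0 < q%:R * kap ^+ ((1 * q) ^ 2) * q%:R :> R.
    by rewrite !mulr_gt0 ?kapX_gt0 ?ltr0n.
  rewrite rE; apply: (inf_cyclicity_le1 t_per (t_deriv 0) (t_deriv 1) t2_lip
    (@tK 0 _) (@tK 1 _) (@tK 2 _) q0 pq A0) => // x.
    have := avg 1%N x isT; rewrite trig_even mul1n !expr1 mulr0n mulr0 subr0 (mul1r (pi / 2))
        cosDpihalf.
    by rewrite !mulrN opprK !mulrA.
  have := avg 2%N x isT; rewrite trig_even mul1n mulr0n mulr0 subr0.
  have -> : 2%:R * (pi / 2) = pi :> R by field.
  by rewrite cosDpi !mulrN opprK expr2 !mulrA.
apply: (inf_cyclicity_irrational t_per (t_deriv 0) (@tK 0 _) (@tK 1 _)) => // p q q0 rE.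
by apply: irr; exists p, q.
Qed.

Lemma trigsum_inf_cyclicity_ge (m q : nat) : (0 < m)%N -> (m <= q)%N -> S (m * q) ->
  (forall k, (0 < k)%N -> S k -> (q %| k)%N -> (m * q <= k)%N) ->
  (m%:R%:E <= inf_cyclicity (trigsum b 0) (1%:R / q%:R))%E.
Proof.
move=> m0 mq Smq Sq; have q0 : (0 < q)%N by exact: leq_trans mq.
have avg j x (j2 : (j <= 2)%N) :=
    @rotation_average m q 1 m0 mq Smq Sq (coprime1n _) j x j2.
have A0 : 0 < q%:R * kap ^+ ((m * q) ^ 2) :> R.
  by rewrite !mulr_gt0 ?kapX_gt0 ?ltr0n.
apply: (inf_cyclicity_ge t_per (t_deriv 0) (t_deriv 1) t2_lip
    (@tK 0 _) (@tK 1 _) (@tK 2 _) (kappa := b 0) q0 m0 A0) => // x.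
  have := avg 0%N x isT; rewrite trig_even !expr0 mulr1n mul1r mul0r addr0.
  by rewrite mulr1.
have := avg 1%N x isT; rewrite trig_even !expr1 mulr0n mulr0 subr0 (mul1r (pi / 2)) cosDpihalf.
by rewrite !mulrN opprK !mulrA.
Qed.

End cyclicity_of_trigonometric_series.

Section factorial_gaps.
Context {R : realType}.

(* The rotation by 1 / m! leaves m * m! as lowest frequency, and the m maxima of
   that harmonic over a period 2 pi / m! yield m attracting trajectories. *)
Definition fact_freq : pred nat := fun k => `[< exists m, k = m * m`!  >]%N.

(** Write k = j j!. If j < m then k < (j + 1)! <= m!, which contradicts the divisibility; so j >=
    m. *)
Lemma fact_freq_min m k : (0 < k)%N -> fact_freq k -> (m`! %| k)%N -> (m * m`! <= k)%N.
Proof.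
move=> k0 /asboolP[j kE] mk; have := dvdn_leq k0 mk; rewrite kE in k0 * => mj.
have {}mj : (m <= j)%N.
  rewrite leqNgt; apply/negP => jm.
  have : (j.+1`! <= m`!)%N by exact: leq_fact.
  by rewrite factS; have := fact_gt0 j; nia.
by rewrite leq_mul// leq_fact.
Qed.

Lemma fact_freq_inf_cyclicity (t : nat -> R) m : (forall n, 0 <= t n <= 1) -> (0 < m)%N ->
  (m%:R%:E <= inf_cyclicity (trigsum (coef fact_freq t) 0) (1%:R / m`!%:R))%E.
Proof.
move=> t01 m0; apply: trigsum_inf_cyclicity_ge => //; first exact: fact_geq.
  by apply/asboolP; exists m.
exact: fact_freq_min.
Qed.

End factorial_gaps.

(** * Cubes of trigonometric series *)

Section trigonometric_independence.
Context {R : realType}.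

Lemma sum_trig_rotation (K i : nat) (x : R) : (0 < K)%N ->
  \sum_(j < K) trig 0 i (x + 2 * pi * (1%:~R / K%:R) * j%:R) =
  if (K %| freq i)%N then K%:R * trig 0 i x else 0.
Proof.
move=> K0; rewrite /trig; under eq_bigr do rewrite expr0 mul1r.
by rewrite (@sum_cos_rotation _ K _ 1)// ?coprime1n// expr0 mul1r.
Qed.

Lemma trig0_freq0 i (x : R) : freq i = 0%N -> trig 0 i x = 1.
Proof.
move=> fi; have -> : i = 0%N by move: fi; rewrite /freq uphalfE; lia.
by rewrite /trig expr0 /phase/= !(mul0r, oppr0, add0r) cos0 mulr1.
Qed.

Lemma trig0_odd k (x : R) : trig 0 (2 * k).+1 x = sin (k.+1%:R * x).
Proof.
rewrite /trig expr0 mul1r (_ : freq _ = k.+1); last by rewrite /freq uphalfE; lia.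
by rewrite /phase/= oddM/= mul1r mul0r addr0 cosBpihalf.
Qed.

Lemma trig0_even k (x : R) : trig 0 (2 * k) x = cos (k%:R * x).
Proof. by rewrite trig_even expr0 mul1r mul0r addr0. Qed.

(* Averaging over the rotations of order [K], the top frequency, leaves only
   frequencies 0 and [K]. *)
Lemma trig_independent (n : nat) (a : nat -> R) :
  (forall x, \sum_(i < n) a i * trig 0 i x = 0) -> forall i, (i < n)%N -> a i = 0.
Proof.
elim: n => [//|n IH] H.
suff an : a n = 0.
  move=> i; rewrite ltnS leq_eqVlt => /predU1P[->//|]; apply: IH => x.
  by have := H x; rewrite big_ord_recr/= an mul0r addr0.
have [n0|n0] := posnP n.
  by have := H 0; rewrite n0 big_ord1 trig0_freq0// mulr1.
pose K := freq n; have K0 : (0 < K)%N by rewrite /K /freq uphalfE; lia.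
have KR : K%:R != 0 :> R by rewrite pnatr_eq0 -lt0n.
have avg x : \sum_(i < n.+1) (if (K %| freq i)%N then a i * trig 0 i x else 0) = 0.
  apply: (mulfI KR); rewrite mulr0 mulr_sumr.
  transitivity (\sum_(j < K) \sum_(i < n.+1) a i * trig 0 i (x + 2 * pi * (1%:~R / K%:R) * j%:R)).
    rewrite exchange_big/=; apply: eq_bigr => i _.
    by rewrite -mulr_sumr sum_trig_rotation//; case: ifP; rewrite ?mulr0// mulrCA.
  by apply: big1 => j _; exact: H.
have freqK (i : 'I_n.+1) : (K %| freq i)%N -> freq i = 0%N \/ freq i = K.
  move=> Ki; have iK : (freq i <= K)%N.
    by rewrite /K /freq !uphalfE; have := ltn_ord i; lia.
  have [|fi] := posnP (freq i); [by left|right].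
  by apply/eqP; rewrite eqn_leq iK dvdn_leq.
have [k [nE|nE]] : exists k, n = (2 * k).+1 \/ n = (2 * k)%N.
  by exists n./2; have := odd_double_half n; case: (odd n); [left|right]; lia.
- have KE : K = k.+1 by rewrite /K /freq nE uphalfE; lia.
  (* Only sin (K x) and the constant remain; the difference of two opposite points removes the
     constant and leaves 2 a_n. *)
  have := congr2 (fun u v => u - v) (avg (pi / 2 / K%:R)) (avg (- (pi / 2) / K%:R)).
  rewrite -sumrB (bigD1 ord_max)//= dvdnn big1.
    rewrite subr0 addr0 nE !trig0_odd -KE !(mulrC K%:R) !divfK// sinN sin_pihalf.
    by move=> ?; lra.
  move=> i; rewrite -val_eqE/= => iN; case: ifP => Ki; last by rewrite subr0.
  have [fi|fi] := freqK _ Ki; first by rewrite !trig0_freq0// subrr.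
  exfalso; have im := ltn_ord i; move: iN fi im => /eqP.
  by move: (nat_of_ord i) => i'; rewrite KE /freq uphalfE nE => *; lia.
- have KE : K = k by rewrite /K /freq nE uphalfE; lia.
  (* Both points are zeros of sin (K x), so their difference removes it along with the constant and
     isolates cos (K x). *)
  have := congr2 (fun u v => u - v) (avg 0) (avg (pi / K%:R)).
  rewrite -sumrB (bigD1 ord_max)//= dvdnn big1.
    rewrite subr0 addr0 nE !trig0_even -KE !(mulrC K%:R) !divfK// mul0r cos0 cospi.
    by move=> ?; lra.
  move=> i; rewrite -val_eqE/= => iN; case: ifP => Ki; last by rewrite subr0.
  have [fi|fi] := freqK _ Ki; first by rewrite !trig0_freq0// subrr.
  have -> : nat_of_ord i = (2 * k.-1).+1.
    have im := ltn_ord i; move: iN fi im => /eqP.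
    by move: (nat_of_ord i) => i'; rewrite KE /freq uphalfE nE => *; lia.
  rewrite !trig0_odd prednK -?KE// (mulrC _ (pi / _)) divfK// sinpi mulr0 sin0.
  by rewrite mulr0 subrr.
Qed.

End trigonometric_independence.

Section trigonometric_cube.
Context {R : realType} {X : normedModType R}.
(** An abstraction of both function spaces: [F b] is the function with coefficients [b]. Splitting
    off finitely many terms and a weighted norm bound identify it as the sum of the series in X. *)
Variables (e : nat -> X) (F : (nat -> R) -> X) (C L : R).

Definition tail (b : nat -> R) (N n : nat) : R := if (n < N)%N then 0 else b n.

Hypothesis F_split : forall b N, rapid b ->
  F b = \sum_(i < N) b i *: e i + F (tail b N).
Hypothesis F_norm : forall b, rapid b -> `|F b| <= C * tsum (fun n => `|b n| * expR (L * n%:R)).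

Lemma rapid_tail b N : rapid b -> rapid (tail b N).
Proof.
move=> rb; apply: (le_rapid (C := 1) (L := 0) rb) => n.
by rewrite mul0r expR0 mulr1 mul1r /tail; case: ifP => // _; rewrite normr0.
Qed.

Lemma trig_series_cvg b : rapid b -> series (fun n => b n *: e n) @ \oo --> F b.
Proof.
(* The extra weight exp (2 n) pays once for the factor 2^-N in front of the tail and once for
   summability in n. *)
move=> rb; have [M bM] := rb (L + 2).
have M0 : 0 <= M by rewrite (le_trans _ (bM 0%N))// mulr_ge0// expR_ge0.
have tl N : `|F (tail b N)| <= `|C| * (2 * (M / 2 ^+ N)).
  rewrite (le_trans (F_norm (rapid_tail N rb)))//.
  have : forall n, `| `|tail b N n| * expR (L * n%:R)| <= M / 2 ^+ N / 2 ^+ n.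
    move=> n; rewrite normrM normr_id (gtr0_norm (expR_gt0 _)) /tail.
    case: ltnP => [_|Nn]; first by rewrite normr0 mul0r !mulr_ge0 ?invr_ge0 ?exprn_ge0.
    rewrite !ler_pdivlMr ?exprn_gt0// (le_trans _ (bM n))// -!mulrA ler_wpM2l//.
    rewrite (mulrDl L) expRD ler_wpM2l ?expR_ge0//.
    rewrite (_ : 2 * n%:R = n%:R + n%:R) ?expRD; last by ring.
    apply: (@le_trans _ _ (2 ^+ n * 2 ^+ n)).
      by rewrite ler_wpM2l ?exprn_ge0// ler_weXn2l// ler1n.
    by rewrite ler_pM ?exprn_ge0// pow2_le_expR.
  move=> /geo_le[_ _ H]; apply: (@le_trans _ _ (`|C| * `|tsum (fun n =>
      `|tail b N n| * expR (L * n%:R))|)).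
    by rewrite -normrM ler_norm.
  by rewrite ler_wpM2l.
apply/cvgrPdist_le => d d0; near=> N.
rewrite (F_split N rb) /series/= big_mkord addrAC subrr add0r (le_trans (tl N))//.
have -> : `|C| * (2 * (M / 2 ^+ N)) = geometric (`|C| * 2 * M) 2^-1 N.
  by rewrite /geometric/= exprVn; ring.
near: N.
have : geometric (`|C| * 2 * M) 2^-1 @ \oo --> (0 : R).
  by apply: cvg_geometric; rewrite ger0_norm ?invr_ge0// invf_lt1// ltr1n.
move=> /cvgrPdist_le/(_ _ d0); apply: filterS => N; rewrite sub0r normrN.
by move=> /(le_trans _); apply; rewrite ler_norm.
Unshelve. all: by end_near. Qed.

Hypothesis e_norm : forall n, `|e n| <= C * expR (L * n%:R).
Hypothesis e_indep : lin_indep e.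
Hypothesis e_dense : dense (lin_span e).

Let x n := eps n *: e n.

Let x_admissible : cube_admissible x.
Proof.
split.
- move=> n c H i iN; have := @e_indep n (fun i => c i * eps i) _ i iN.
  have E : \sum_(i < n) (c i * eps i) *: e i = 0.
    by rewrite -[RHS]H; apply: eq_bigr => j _; rewrite /x scalerA.
  by move=> /(_ E)/eqP; rewrite mulf_eq0 (gt_eqF (eps_gt0 _)) orbF => /eqP.
- move=> O O0 oO; have [y [Oy [n [c yE]]]] := e_dense O0 oO.
  exists y; split => //; exists n; exists (fun i => c i / eps i); rewrite yE.
  by apply: eq_bigr => i _; rewrite /x scalerA divfK// gt_eqF// eps_gt0.
- apply: geo_cvg; apply: (rapid_geo (C := C) (L := L) rapid_eps) => n.
  by rewrite normr_id normrZ mulrCA ler_wpM2l.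
Qed.

(** The cube with corner [F (amp S)] and edges [eps n *: e n] lies entirely in [E], so its parameter
    set is the whole Hilbert cube. *)
Lemma not_cube_null S (E : set X) :
  (forall t, (forall n, 0 <= t n <= 1) -> E (F (amp S) + F (fun n => t n * eps n))) ->
  ~ cube_null E.
Proof.
move=> H /(_ (F (amp S)) x unit_cube_law x_admissible unit_cube_lawP).
apply: hilbert_cube_not_negligible => t t01; split => //=.
rewrite /cube_map (_ : limn _ = F (fun n => t n * eps n)); first exact: H.
apply/cvg_lim => //.
rewrite (_ : (fun n => t n *: x n) = (fun n => (t n * eps n) *: e n)); last first.
  by apply/funext => n; rewrite /x scalerA.
apply: trig_series_cvg; apply: (le_rapid (C := 1) (L := 0) rapid_eps) => n.
rewrite mul0r expR0 mulr1 mul1r normrM ler_piMl//.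
by have /andP[t0 t1] := t01 n; rewrite ger0_norm.
Qed.

End trigonometric_cube.

Section Ck_trigonometric.
Context {R : realType} (k : nat).

Lemma derive1n_trigsum b i : rapid b -> derive1n i (trigsum b 0) = trigsum b i :> (R -> R).
Proof.
move=> rb; elim: i => [//|i IH]; rewrite derive1nS IH; apply/funext => x.
by rewrite derive1E; have [_ ->] := is_derive_trigsum i x rb.
Qed.

Lemma trigsum_Ck b : rapid b -> trigsum b 0 \in @Ck_pred R k.
Proof.
move=> rb; apply/asboolP; split => [x|i ik x|].
- exact: trigsum_periodic.
- by rewrite derive1n_trigsum//; have [] := is_derive_trigsum i x rb.
- rewrite derive1n_trigsum// => x; apply: differentiable_continuous.
  by apply/derivable1_diffP; have [] := is_derive_trigsum k x rb.
Qed.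

(** The value 0 for sequences that are not rapid makes the map total, as the abstract cube
    construction expects. *)
Definition Ck_trigsum b : CkS R k :=
  if pselect (rapid b) is left rb then MkCkS (trigsum_Ck rb) else 0.

Lemma Ck_trigsumE b : rapid b -> Ck_trigsum b = trigsum b 0 :> (R -> R).
Proof. by rewrite /Ck_trigsum; case: pselect. Qed.

Lemma rapid_delta n : rapid (fun m => (m == n)%:R : R).
Proof.
move=> L; exists (expR (L * n%:R)) => m; case: eqVneq => [->|_].
  by rewrite normr1 mul1r.
by rewrite normr0 mul0r expR_ge0.
Qed.

Definition Ck_trig (n : nat) : CkS R k := Ck_trigsum (fun m => (m == n)%:R).

Lemma trigsum_delta n j (x : R) : trigsum (fun m => (m == n)%:R) j x = trig j n x.
Proof.
rewrite -[RHS](tsum_delta n); apply: eq_tsum => m.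
by case: eqVneq => [->|_]; rewrite ?mul1r ?mulr1n// mul0r mulr0n.
Qed.

Lemma Ck_trigE n (x : R) : Ck_trig n x = trig 0 n x.
Proof. by rewrite /Ck_trig Ck_trigsumE ?trigsum_delta//; exact: rapid_delta. Qed.

Lemma Ck_sumE (n : nat) (g : nat -> CkS R k) (x : R) :
  (\sum_(i < n) g i) x = \sum_(i < n) g i x.
Proof. by elim/big_rec2: _ => // i y z _ <-. Qed.

Lemma trigsum_split b N j (x : R) : rapid b ->
  trigsum b j x = \sum_(i < N) b i * trig j i x + trigsum (tail b N) j x.
Proof.
move=> rb; elim: N => [|N IH].
  by rewrite big_ord0 add0r; apply: eq_tsum => n.
rewrite big_ord_recr/= IH -addrA; congr (_ + _).
rewrite -(trigsum_delta N) /trigsum -tsumZ; last exact/geo_trig/rapid_delta.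
rewrite -tsumD; last 2 first.
- by apply: geoZ; exact/geo_trig/rapid_delta.
- exact/geo_trig/rapid_tail.
apply: eq_tsum => n; rewrite /tail ltnS.
by case: (ltngtP n N) => [nN|nN|->] /=; ring.
Qed.

Lemma Ck_trigsum_split b N : rapid b ->
  Ck_trigsum b = \sum_(i < N) b i *: Ck_trig i + Ck_trigsum (tail b N).
Proof.
move=> rb; apply/val_inj/funext => x /=.
rewrite -[RHS]/((\sum_(i < N) b i *: Ck_trig i : CkS R k) x + Ck_trigsum (tail b N) x).
rewrite [X in _ = X + _](Ck_sumE N (fun i => b i *: Ck_trig i) x).
rewrite !Ck_trigsumE//; last exact: rapid_tail.
rewrite (trigsum_split N)//; congr (_ + _); apply: eq_bigr => i _.
by rewrite -[RHS]/(b i * Ck_trig i x) Ck_trigE.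
Qed.

Lemma Ck_trigsum_norm b : rapid b ->
  `|Ck_trigsum b| <= k.+1%:R * tsum (fun n => `|b n| * expR (k%:R * n%:R)).
Proof.
move=> rb; rewrite -[leLHS]/(Ck_norm _) /Ck_norm Ck_trigsumE//.
apply: (@le_trans _ _ (\sum_(i < k.+1) tsum (fun n => `|b n| * expR (k%:R * n%:R)))); last first.
  by rewrite sumr_const card_ord [leRHS]mulr_natl.
apply: ler_sum => i _; apply: sup_norm_le => [|x _]; first by exists 0.
rewrite derive1n_trigsum//; apply: tsum_norm => [|n].
  apply: (rapid_geo (C := 1) (L := k%:R) rb) => n.
  by rewrite mul1r normrM normr_id (gtr0_norm (expR_gt0 _)).
rewrite normrM ler_wpM2l// (le_trans (trig_le _ _ _))// (le_trans (freqX_le _ _))//.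
by rewrite ler_expR ler_wpM2r// ler_nat -ltnS.
Qed.

Lemma Ck_trig_norm n : `|Ck_trig n| <= k.+1%:R * expR (k%:R * n%:R).
Proof.
rewrite (le_trans (Ck_trigsum_norm (rapid_delta n)))// ler_wpM2l//.
rewrite -[leRHS](tsum_delta n); apply: ler_tsum => [||m]; last 1 first.
- case: eqVneq => [->|_]; first by rewrite normr1 mul1r mulr1n.
  by rewrite normr0 mul0r mulr0n.
- apply: (rapid_geo (C := 1) (L := k%:R) (rapid_delta n)) => m.
  by rewrite mul1r normrM normr_id (gtr0_norm (expR_gt0 _)).
- exact: geo_delta.
Qed.

Lemma Ck_trig_indep : lin_indep Ck_trig.
Proof.
move=> n c H; apply: trig_independent => x.
transitivity ((\sum_(i < n) c i *: Ck_trig i : CkS R k) x); last by rewrite H.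
rewrite [RHS](Ck_sumE n (fun i => c i *: Ck_trig i) x).
by apply: eq_bigr => i _; rewrite -[RHS]/(c i * Ck_trig i x) Ck_trigE.
Qed.

Lemma Ck_cube_coef S t : (forall n, 0 <= t n <= 1) ->
  (Ck_trigsum (amp S) + Ck_trigsum (fun n => t n * eps n) : CkS R k) =
  trigsum (coef S t) 0 :> (R -> R).
Proof.
move=> t01; have rt : rapid (fun n => t n * eps n : R).
  apply: (le_rapid (C := 1) (L := 0) rapid_eps) => n.
  rewrite mul0r expR0 mulr1 mul1r normrM ler_piMl//.
  by have /andP[t0 t1] := t01 n; rewrite ger0_norm.
apply/funext => x.
rewrite -[LHS]/(Ck_trigsum (amp S) x + Ck_trigsum (fun n => t n * eps n) x).
rewrite !Ck_trigsumE//; last exact: rapid_amp.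
rewrite /trigsum -tsumD; [|exact/geo_trig/rapid_amp|exact: geo_trig].
by apply: eq_tsum => n; rewrite /coef mulrDl.
Qed.

Lemma Ck_not_prevalent : dense (lin_span Ck_trig) ->
  ~ cube_prevalent (IC_infty (@CkS_fun R k)).
Proof.
move=> dns; apply: (@not_cube_null R (CkS R k) Ck_trig Ck_trigsum k.+1%:R k%:R
  _ _ _ _ dns predT) => [b N|b|n||t t01].
- exact: Ck_trigsum_split.
- exact: Ck_trigsum_norm.
- exact: Ck_trig_norm.
- exact: Ck_trig_indep.
(* The set tested for nullity is the double complement of the functions of finite cyclicity; the
   bound 1 serves at every rotation number. *)
move=> /=; apply; exists 1%N => // rho.
by rewrite Ck_cube_coef//; exact: trigsum_inf_cyclicity_le1.
Qed.

End Ck_trigonometric.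

(** * Entire trigonometric series *)

Section real_taylor.
Context {R : realType}.

Lemma derive_compare (r r' g g' : R -> R) (s : R) :
  (forall x : R, is_derive x 1 r (r' x)) -> (forall x : R, is_derive x 1 g (g' x)) ->
  r 0 = 0 -> g 0 = 0 -> 0 <= s -> (forall x, 0 <= x <= s -> `|r' x| <= g' x) ->
  `|r s| <= g s.
Proof.
move=> rd gd r0 g0; rewrite le_eqVlt => /predU1P[<-|s0] H; first by rewrite r0 g0 normr0.
rewrite ler_norml; apply/andP; split.
  have hd (x : R) : is_derive x 1 (fun y => r y + g y) (r' x + g' x) by exact: is_deriveD.
  have [c /andP[c0 cs] E] := mvt_between hd s0.
  have /H : 0 <= c <= s by rewrite !ltW.
  rewrite ler_norml => /andP[h1 h2].
  have : 0 <= (r' c + g' c) * (s - 0) by rewrite mulr_ge0//; lra.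
  by rewrite -E r0 g0; lra.
have hd (x : R) : is_derive x 1 (fun y => g y - r y) (g' x - r' x) by exact: is_deriveB.
have [c /andP[c0 cs] E] := mvt_between hd s0.
have /H : 0 <= c <= s by rewrite !ltW.
rewrite ler_norml => /andP[h1 h2].
have : 0 <= (g' c - r' c) * (s - 0) by rewrite mulr_ge0//; lra.
by rewrite -E r0 g0; lra.
Qed.

Lemma is_derive_exprn (c : R) n (x : R) :
  is_derive x 1 (fun y => c * y ^+ n.+1) (c * n.+1%:R * x ^+ n).
Proof.
have H := is_deriveZ c (is_deriveX n.+1 (is_derive_id x (1 : R))).
rewrite exprfctE in H.
have -> : c * n.+1%:R * x ^+ n = c *: (n.+1%:R * x ^+ n *: (1 : R)).
  by rewrite /GRing.scale/= mulr1 mulrA.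
exact: H.
Qed.

(** Induction along the tower of derivatives: the derivative of the remainder of order M + 1 is the
    remainder of order M of the shifted tower, and [derive_compare] integrates its bound. *)
Lemma real_taylor (M : nat) : forall (F : nat -> R -> R) (B : R),
  (forall m (x : R), is_derive x 1 (F m) (F m.+1 x)) ->
  (forall x, 0 <= x <= 1 -> `|F M x| <= B) ->
  forall s, 0 <= s <= 1 ->
  `|F 0%N s - \sum_(m < M) F m 0 / m`!%:R * s ^+ m| <= B / M`!%:R * s ^+ M.
Proof.
elim: M => [|M IH] F B FD FB s s01.
  by rewrite big_ord0 subr0 expr0 mulr1 divr1 FB.
have /andP[s0 s1] := s01.
pose r x := F 0%N x - \sum_(m < M.+1) F m 0 / m`!%:R * x ^+ m.
pose r' x := F 1%N x - \sum_(m < M) F m.+1 0 / m`!%:R * x ^+ m.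
have factE m (c : R) : c / m`!%:R = c / m.+1`!%:R * m.+1%:R.
  by rewrite factS natrM invfM mulrA [RHS]mulrAC divfK// pnatr_eq0.
have rd (x : R) : is_derive x 1 r (r' x).
  apply: is_deriveB.
  rewrite (_ : (fun y => _) = (fun y => F 0%N 0 + (\sum_(m < M)
      (fun y => F m.+1 0 / m.+1`!%:R * y ^+ m.+1)) y)); last first.
    apply/funext => y; rewrite big_ord_recl/= divr1 expr0 mulr1; congr (_ + _).
    by rewrite fct_sumE; apply: eq_bigr.
  rewrite -[X in is_derive _ _ _ X]add0r; apply: is_deriveD.
  have Hm (m : 'I_M) : is_derive x 1 (fun y : R => F m.+1 0 / m.+1`!%:R * y ^+ m.+1)
      (F m.+1 0 / m`!%:R * x ^+ m).
    by rewrite (factE m) ; exact: is_derive_exprn.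
  exact: is_derive_sum.
apply: (@derive_compare r r' (fun x => B / M.+1`!%:R * x ^+ M.+1)
  (fun x => B / M`!%:R * x ^+ M) s rd) => //.
- by move=> x; rewrite (factE M); exact: is_derive_exprn.
- rewrite /r big_ord_recl/= divr1 expr0 mulr1 big1 ?addr0 ?subrr// => m _.
  by rewrite expr0n/= mulr0.
- by rewrite expr0n/= mulr0.
- move=> x /andP[x0 xs].
  have x01 : 0 <= x <= 1 by rewrite x0 (le_trans xs s1).
  exact: (IH (fun m => F m.+1) B (fun m => FD m.+1) FB x x01).
Qed.

Lemma exprn_fact_le (x : R) n : 0 <= x -> x ^+ n / n`!%:R <= expR x.
Proof.
move=> x0; case: n => [|n]; first by rewrite expr0 divr1 -expR0 ler_expR.
by rewrite (le_trans _ (expR_ge1Dxn n x0))// lerDr.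
Qed.

End real_taylor.

(** * Complex cosine and entire trigonometric series *)

Section complex_norm.
Context {R : realType}.
Local Notation C := R[i].
Local Notation normc := (@Normc.normc R).

Lemma normcE_norm (z : C) : `|z| = (normc z)%:C%C.
Proof. by case: z => x y; rewrite normc_def. Qed.

Lemma normc_ge0 (z : C) : 0 <= normc z.
Proof. by case: z => x y; exact: sqrtr_ge0. Qed.

Lemma Re_le_normc (z : C) : `|complex.Re z| <= normc z.
Proof. by have := normc_ge_Re z; rewrite normcE_norm lecR. Qed.

Lemma Im_le_normc (z : C) : `|complex.Im z| <= normc z.
Proof.
case: z => x y /=; rewrite -(sqrtr_sqr y) ler_wsqrtr// lerDr sqr_ge0//.
Qed.

Lemma normcB_le (z w : C) : normc (z - w) <= normc z + normc w.
Proof. by rewrite (le_trans (le_normcD _ _))// normcN. Qed.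

Lemma normc_real (x : R) : normc x%:C%C = `|x|.
Proof. by rewrite /Normc.normc/= expr0n/= addr0 sqrtr_sqr. Qed.

Lemma normc_imag (x : R) : normc (0 +i* x)%C = `|x|.
Proof. by rewrite /Normc.normc/= expr0n/= add0r sqrtr_sqr. Qed.

Lemma normc_le_ReIm (z : C) : normc z <= `|complex.Re z| + `|complex.Im z|.
Proof.
case: z => x y; have -> : (x +i* y)%C = x%:C%C + (0 +i* y)%C.
  by apply/eqP; rewrite eq_complex/= addr0 add0r !eqxx.
by rewrite (le_trans (le_normcD _ _))// normc_real normc_imag/= addr0 add0r.
Qed.

Lemma normcX (z : C) n : normc (z ^+ n) = normc z ^+ n.
Proof.
elim: n => [|n IH]; first by rewrite !expr0 Normc.normc1.
by rewrite !exprS Normc.normcM IH.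
Qed.

Lemma normc_sum (I : Type) (r : seq I) (F : I -> C) :
  normc (\sum_(i <- r) F i) <= \sum_(i <- r) normc (F i).
Proof.
elim: r => [|i r IH]; first by rewrite !big_nil Normc.normc0.
by rewrite !big_cons (le_trans (le_normcD _ _))// lerD2l.
Qed.

Lemma ReB (z w : C) : complex.Re (z - w) = complex.Re z - complex.Re w.
Proof. by case: z w => [? ?] [? ?]. Qed.

Lemma ReD (z w : C) : complex.Re (z + w) = complex.Re z + complex.Re w.
Proof. by case: z w => [? ?] [? ?]. Qed.

Lemma ImB (z w : C) : complex.Im (z - w) = complex.Im z - complex.Im w.
Proof. by case: z w => [? ?] [? ?]. Qed.

Lemma ImD (z w : C) : complex.Im (z + w) = complex.Im z + complex.Im w.
Proof. by case: z w => [? ?] [? ?]. Qed.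

Lemma ReM (z w : C) : complex.Re (z * w) =
  complex.Re z * complex.Re w - complex.Im z * complex.Im w.
Proof. by case: z w => [? ?] [? ?]. Qed.

Lemma ReZc (x : R) (z : C) : complex.Re (x%:C%C * z) = x * complex.Re z.
Proof. by rewrite ReM/= mul0r subr0. Qed.

Lemma ImZc (x : R) (z : C) : complex.Im (x%:C%C * z) = x * complex.Im z.
Proof. by case: z => a b /=; rewrite mul0r addr0. Qed.

Lemma ImM (z w : C) : complex.Im (z * w) =
  complex.Re z * complex.Im w + complex.Im z * complex.Re w.
Proof. by case: z w => [? ?] [? ?]. Qed.

Lemma Re_sum (I : Type) (r : seq I) (F : I -> C) :
  complex.Re (\sum_(i <- r) F i) = \sum_(i <- r) complex.Re (F i).
Proof. by elim: r => [|i r IH]; rewrite ?big_nil ?big_cons ?ReD ?IH. Qed.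

Lemma Im_sum (I : Type) (r : seq I) (F : I -> C) :
  complex.Im (\sum_(i <- r) F i) = \sum_(i <- r) complex.Im (F i).
Proof. by elim: r => [|i r IH]; rewrite ?big_nil ?big_cons ?ImD ?IH. Qed.

Lemma natc (n : nat) : n%:R = (n%:R)%:C%C :> C.
Proof. by rewrite -(rmorph_nat (real_complex R)). Qed.

End complex_norm.

Section complex_cosine.
Context {R : realType}.
Local Notation C := R[i].
Local Notation normc := (@Normc.normc R).

Definition cosh (y : R) : R := (expR y + expR (- y)) / 2.
Definition sinh (y : R) : R := (expR y - expR (- y)) / 2.

(* cos (z + t) *)
Definition ccos (t : R) (z : C) : C :=
  ((cos (complex.Re z + t) * cosh (complex.Im z)) +i*
   (- (sin (complex.Re z + t) * sinh (complex.Im z))))%C.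

Lemma normc_ccos t z : normc (ccos t z) <= 2 * expR `|complex.Im z|.
Proof.
have e1 : expR (complex.Im z) <= expR `|complex.Im z| by rewrite ler_expR ler_norm.
have e2 : expR (- complex.Im z) <= expR `|complex.Im z|.
  by rewrite ler_expR -normrN ler_norm.
have p1 := expR_gt0 (complex.Im z); have p2 := expR_gt0 (- complex.Im z).
rewrite (le_trans (normc_le_ReIm _))//= normrN (normrM (cos _)) (normrM (sin _)) mulr_natl mulr2n
    lerD//.
  have h1 : `|cosh (complex.Im z)| <= expR `|complex.Im z|.
    by rewrite /cosh ger0_norm; lra.
  by rewrite -[leRHS]mul1r ler_pM ?cos_max.
have h2 : `|sinh (complex.Im z)| <= expR `|complex.Im z|.
  by rewrite /sinh ler_norml; apply/andP; split; lra.
by rewrite -[leRHS]mul1r ler_pM ?sin_max.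
Qed.

Lemma is_derive_cosh (y : R) : is_derive y 1 cosh (sinh y).
Proof. by rewrite /cosh; apply: is_derive_eq; rewrite /sinh /GRing.scale/=; field. Qed.

Lemma is_derive_sinh (y : R) : is_derive y 1 sinh (cosh y).
Proof. by rewrite /sinh; apply: is_derive_eq; rewrite /cosh /GRing.scale/=; field. Qed.

Lemma is_derive_affine (g g' : R -> R) (a u : R) (s : R) :
  (forall x : R, is_derive x 1 g (g' x)) ->
  is_derive s 1 (fun x => g (a + x * u)) (g' (a + s * u) * u).
Proof.
move=> gd; have H : is_derive s 1 (fun x : R => a + x * u) u.
  have := is_deriveD (is_derive_cst a s (1 : R)) (is_deriveZ u (is_derive_id s (1 : R))).
  rewrite add0r /GRing.scale/= mulr1.
  rewrite (_ : cst a + u \*: id = fun x => a + x * u)//.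
  by apply/funext => x; rewrite !fctE /GRing.scale/= mulrC.
exact: (is_derive1_comp (gd _) H).
Qed.

(** Differentiation along a real segment after applying the real linear form Re (o .), so that the
    real Taylor estimate applies. As for the real cosine, a derivative adds a quarter turn. *)
Lemma is_derive_ccos t (o z w : C) (s : R) :
  is_derive s 1 (fun x => complex.Re (o * ccos t (z + x%:C%C * w)))
    (complex.Re (o * w * ccos (t + pi / 2) (z + s%:C%C * w))).
Proof.
case: o z w => [p q] [a b] [u v].
have E (x : R) : complex.Re ((p +i* q)%C * ccos t ((a +i* b)%C + x%:C%C * (u +i* v)%C)) =
    p * (cos (a + t + x * u) * cosh (b + x * v)) + q * (sin (a + t + x * u) * sinh (b + x * v)).
  by rewrite /ccos /= !mul0r subr0 addr0 mulrN opprK (addrAC a).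
under eq_fun do rewrite E.
have Hc := is_derive_affine (a + t) u s (@is_derive_cos R).
have Hs := is_derive_affine (a + t) u s (@is_derive_sin R).
have Hch := is_derive_affine b v s is_derive_cosh.
have Hsh := is_derive_affine b v s is_derive_sinh.
have H1 := is_deriveZ p (is_deriveM Hc Hch).
have H2 := is_deriveZ q (is_deriveM Hs Hsh).
have H := is_deriveD H1 H2.
set d := (X in is_derive _ _ _ X).
set d' := (X in is_derive _ _ _ X) in H.
have -> : d = d'.
  rewrite /d /d' /ccos /= !mul0r subr0 addr0 (addrA _ t) cosDpihalf sinDpihalf.
  rewrite (addrAC a) /GRing.scale/=.
  by ring.
exact: H.
Qed.

(** The real estimate is applied with o = 1 and o = - i, which give the real and imaginary parts of
    the remainder; the constant 4 adds their two bounds. *)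
Lemma ccos_taylor M t (z w : C) :
  normc (ccos t (z + w) - \sum_(m < M) (m`!%:R^-1)%:C%C * w ^+ m * ccos (t + m%:R * (pi / 2)) z)
    <= normc w ^+ M / M`!%:R * (4 * expR (`|complex.Im z| + normc w)).
Proof.
set D := (X in normc X).
have key (o : C) : normc o = 1 -> `|complex.Re (o * D)| <=
    normc w ^+ M / M`!%:R * (2 * expR (`|complex.Im z| + normc w)).
  move=> o1; pose F m (s : R) :=
      complex.Re (o * w ^+ m * ccos (t + m%:R * (pi / 2)) (z + s%:C%C * w)).
  have Fd m (x : R) : is_derive x 1 (F m) (F m.+1 x).
    rewrite /F; have := is_derive_ccos (t + m%:R * (pi / 2)) (o * w ^+ m) z w x.
    rewrite -(mulrA o) -exprSr.
    by rewrite (_ : t + m%:R * (pi / 2) + pi / 2 = t + m.+1%:R * (pi / 2))// -natr1; ring.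
  pose B := normc w ^+ M * (2 * expR (`|complex.Im z| + normc w)).
  have FB x : 0 <= x <= 1 -> `|F M x| <= B.
    move=> /andP[x0 x1]; rewrite /F (le_trans (Re_le_normc _))// !Normc.normcM o1 mul1r normcX.
    rewrite ler_wpM2l ?exprn_ge0 ?normc_ge0// (le_trans (normc_ccos _ _))// ler_wpM2l//.
    rewrite ler_expR ImD (le_trans (ler_normD _ _))// lerD2l.
    rewrite (le_trans (Im_le_normc _))// Normc.normcM normc_real ger0_norm//.
    by rewrite ler_piMl// normc_ge0.
  have := real_taylor Fd FB (s := 1); rewrite lexx ler01 => /(_ isT).
  rewrite expr1n mulr1 /B (mulrAC _ _ M`!%:R^-1); apply: le_trans.
  rewrite le_eqVlt; apply/orP; left; apply/eqP; congr (`|_|).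
  rewrite /D mulrBr ReB; congr (_ - _).
    by rewrite /F expr0 mulr1 mul0r addr0 mul1r.
  rewrite mulr_sumr Re_sum; apply: eq_bigr => m _; rewrite expr1n mulr1 /F mul0r addr0.
  have -> : o * ((m`!%:R^-1)%:C%C * w ^+ m * ccos (t + m%:R * (pi / 2)) z) =
      (m`!%:R^-1)%:C%C * (o * w ^+ m * ccos (t + m%:R * (pi / 2)) z) by ring.
  by rewrite ReZc mulrC.
rewrite (le_trans (normc_le_ReIm _))//.
have k1 := key 1 (Normc.normc1 R); rewrite mul1r in k1.
have k2 := key (0 +i* (-1))%C; rewrite normc_imag normrN1 in k2.
have {}k2 := k2 erefl.
have E : complex.Re ((0 +i* -1)%C * D) = complex.Im D.
  by rewrite ReM/= mul0r mulN1r opprK add0r.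
by rewrite E in k2; move: k1 k2; set X := normc w ^+ M / _; set Y := expR _; lra.
Qed.

End complex_cosine.

Section complex_sums.
Context {R : realType}.
Local Notation C := R[i].
Local Notation normc := (@Normc.normc R).
Implicit Types u v : nat -> C.

Definition csum u : C :=
  (tsum (fun n => complex.Re (u n)) +i* tsum (fun n => complex.Im (u n)))%C.

Definition cgeo u := geo (fun n => normc (u n)).

Lemma cgeo_Re u : cgeo u -> geo (fun n => complex.Re (u n)).
Proof.
move=> ug; apply: (le_geo (c := 1) ug) => n.
by rewrite mul1r (ger0_norm (normc_ge0 _)) Re_le_normc.
Qed.

Lemma cgeo_Im u : cgeo u -> geo (fun n => complex.Im (u n)).
Proof.
move=> ug; apply: (le_geo (c := 1) ug) => n.
by rewrite mul1r (ger0_norm (normc_ge0 _)) Im_le_normc.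
Qed.

Lemma cgeoD u v : cgeo u -> cgeo v -> cgeo (fun n => u n + v n).
Proof.
move=> ug vg; apply: (le_geo (c := 1) (geoD ug vg)) => n.
by rewrite mul1r !ger0_norm ?addr_ge0 ?normc_ge0// le_normcD.
Qed.

Lemma cgeoZr u c : cgeo u -> cgeo (fun n => u n * c).
Proof.
move=> ug; apply: (le_geo (c := normc c) ug) => n.
by rewrite Normc.normcM normrM !(ger0_norm (normc_ge0 _)) mulrC.
Qed.

Lemma csumB u v : cgeo u -> cgeo v -> csum (fun n => u n - v n) = csum u - csum v.
Proof.
move=> ug vg; apply/eqP; rewrite eq_complex; apply/andP; split; apply/eqP => /=.
  by under eq_tsum do rewrite ReB; rewrite tsumB//; exact: cgeo_Re.
by under eq_tsum do rewrite ImB; rewrite tsumB//; exact: cgeo_Im.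
Qed.

Lemma csumD u v : cgeo u -> cgeo v -> csum (fun n => u n + v n) = csum u + csum v.
Proof.
move=> ug vg; apply/eqP; rewrite eq_complex; apply/andP; split; apply/eqP => /=.
  by under eq_tsum do rewrite ReD; rewrite tsumD//; exact: cgeo_Re.
by under eq_tsum do rewrite ImD; rewrite tsumD//; exact: cgeo_Im.
Qed.

Lemma csumZr u c : cgeo u -> csum (fun n => u n * c) = csum u * c.
Proof.
move=> ug; have gR := cgeo_Re ug; have gI := cgeo_Im ug.
apply/eqP; rewrite eq_complex; apply/andP; split; apply/eqP.
  rewrite ReM/= -!(mulrC (complex.Re c)) -!(mulrC (complex.Im c)) -!tsumZ// -tsumB; last 2 first.
  - exact: geoZ.
  - exact: geoZ.
  by apply: eq_tsum => n; rewrite ReM mulrC (mulrC (complex.Im _)).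
rewrite ImM/= -!(mulrC (complex.Re c)) -!(mulrC (complex.Im c)) -!tsumZ// -tsumD; last 2 first.
- exact: geoZ.
- exact: geoZ.
by apply: eq_tsum => n; rewrite ImM; ring.
Qed.

Lemma csum_sum (I : Type) (r : seq I) (u : I -> nat -> C) : (forall i, cgeo (u i)) ->
  cgeo (fun n => \sum_(i <- r) u i n) /\
  csum (fun n => \sum_(i <- r) u i n) = \sum_(i <- r) csum (u i).
Proof.
move=> ug; elim: r => [|i r [gr IH]].
  split; first by exists 0 => n; rewrite big_nil Normc.normc0 normr0 mul0r.
  apply/eqP; rewrite eq_complex/= big_nil/=.
  by apply/andP; split; apply/eqP; rewrite -[RHS]tsum0; apply: eq_tsum => n; rewrite big_nil.
have E n : \sum_(j <- i :: r) u j n = u i n + \sum_(j <- r) u j n by rewrite big_cons.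
have -> : (fun n => \sum_(j <- i :: r) u j n) = (fun n => u i n + \sum_(j <- r) u j n).
  exact/funext.
by split; [exact: cgeoD|rewrite csumD// IH big_cons].
Qed.

Lemma normc_csum u (v : nat -> R) : geo v -> (forall n, normc (u n) <= v n) ->
    normc (csum u) <= 2 * tsum v.
Proof.
move=> vg uv; rewrite (le_trans (normc_le_ReIm _))//= mulr_natl mulr2n lerD//.
  by apply: tsum_norm => // n; rewrite (le_trans (Re_le_normc _)).
by apply: tsum_norm => // n; rewrite (le_trans (Im_le_normc _)).
Qed.

End complex_sums.

Section entire_trigonometric_series.
Context {R : realType}.
Local Notation C := R[i].
Local Notation normc := (@Normc.normc R).
Implicit Types (b : nat -> R) (z w : C).

Definition ctrig (n : nat) z : C := ccos (phase n) (((freq n)%:R : R)%:C%C * z).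

Definition ctrigsum b z : C := csum (fun n => (b n)%:C%C * ctrig n z).

Definition cweight b (L : R) : R := tsum (fun n => `|b n| * expR (L * n%:R)).

Lemma geo_cweight b L : rapid b -> geo (fun n => `|b n| * expR (L * n%:R)).
Proof.
move=> rb; apply: (rapid_geo (C := 1) (L := L) rb) => n.
by rewrite mul1r normrM normr_id (gtr0_norm (expR_gt0 _)).
Qed.

Lemma cweight_ge0 b L : rapid b -> 0 <= cweight b L.
Proof.
by move=> rb; apply: tsum_ge0 => [|n]; [exact: geo_cweight|rewrite mulr_ge0// expR_ge0].
Qed.

Lemma cweight_le b L L' : rapid b -> L <= L' -> cweight b L <= cweight b L'.
Proof.
move=> rb LL; apply: ler_tsum => [||n]; [exact: geo_cweight..|].
by rewrite ler_wpM2l// ler_expR ler_wpM2r.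
Qed.

Lemma normc_ctrig n z : normc (ctrig n z) <= 2 * expR (`|complex.Im z| * n%:R).
Proof.
rewrite (le_trans (normc_ccos _ _))// ler_wpM2l// ler_expR ImZc normrM ger0_norm//.
by rewrite mulrC ler_wpM2l// ler_nat freq_le.
Qed.

Lemma cgeo_ctrig b z : rapid b -> cgeo (fun n => (b n)%:C%C * ctrig n z).
Proof.
move=> rb; apply: (rapid_geo (C := 2) (L := `|complex.Im z|) rb) => n.
rewrite (ger0_norm (normc_ge0 _)) Normc.normcM normc_real mulrCA ler_wpM2l//.
exact: normc_ctrig.
Qed.

Lemma normc_ctrigsum b z : rapid b -> normc (ctrigsum b z) <= 4 * cweight b `|complex.Im z|.
Proof.
move=> rb; have -> : (4 : R) = 2 * 2 by rewrite -natrM.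
rewrite -mulrA -(tsumZ 2); last exact: geo_cweight.
apply: normc_csum => [|n]; first exact/geoZ/geo_cweight.
rewrite Normc.normcM normc_real mulrCA ler_wpM2l//.
exact: normc_ctrig.
Qed.

Let term b m z n : C := (b n)%:C%C * ((m`!%:R^-1)%:C%C * ((freq n)%:R : R)%:C%C ^+ m *
  ccos (phase n + m%:R * (pi / 2)) (((freq n)%:R : R)%:C%C * z)).

(** The m-th Taylor coefficient of [ctrigsum b] at z. *)
Definition ccoef b m z : C := csum (term b m z).

Let cgeo_term b m z : rapid b -> cgeo (term b m z).
Proof.
move=> rb; apply: (rapid_geo (C := 2) (L := `|complex.Im z| + 1) rb) => n.
rewrite (ger0_norm (normc_ge0 _)) /term !Normc.normcM normc_real [leRHS]mulrCA ler_wpM2l//.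
rewrite normcX !normc_real (ger0_norm (_ : 0 <= m`!%:R^-1)) ?invr_ge0// (ger0_norm (_ :
    0 <= (freq n)%:R))//.
apply: (@le_trans _ _ (expR n%:R * (2 * expR (`|complex.Im z| * n%:R)))); last first.
  by rewrite mulrCA ler_wpM2l// mulrDl expRD mul1r mulrC.
rewrite ler_pM ?mulr_ge0 ?invr_ge0 ?exprn_ge0 ?normc_ge0//.
  rewrite mulrC (le_trans (exprn_fact_le _ _))// ler_expR ler_nat freq_le//.
rewrite (le_trans (normc_ccos _ _))// ler_wpM2l// ler_expR ImZc normrM ger0_norm//.
by rewrite mulrC ler_wpM2l// ler_nat freq_le.
Qed.

(** Taylor term by term. The factor k^M / M! produced by the frequency k is at most exp k, which
    costs 1 in the exponential weight and makes the bound uniform in M. *)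
Lemma ctrigsum_expansion b M z w : rapid b ->
  normc (ctrigsum b (z + w) - \sum_(m < M) ccoef b m z * w ^+ m) <=
  normc w ^+ M * (8 * cweight b (`|complex.Im z| + normc w + 1)).
Proof.
move=> rb.
have g2 (m : 'I_M) : cgeo (fun n => term b m z n * w ^+ m) by exact/cgeoZr/cgeo_term.
have [gs ss] := csum_sum (index_enum 'I_M) g2.
have -> : \sum_(m < M) ccoef b m z * w ^+ m = csum (fun n => \sum_(m < M) term b m z n * w ^+ m).
  by rewrite ss; apply: eq_bigr => m _; rewrite csumZr//; exact: cgeo_term.
rewrite /ctrigsum -csumB//; last exact: cgeo_ctrig.
have -> : normc w ^+ M * (8 * cweight b (`|complex.Im z| + normc w + 1)) =
    2 * (normc w ^+ M * 4 * cweight b (`|complex.Im z| + normc w + 1)) by ring.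
rewrite -tsumZ; last exact: geo_cweight.
apply: normc_csum => [|n]; first exact/geoZ/geo_cweight.
have := ccos_taylor M (phase n) (((freq n)%:R : R)%:C%C * z) (((freq n)%:R : R)%:C%C * w).
set k : R := (freq n)%:R; set S := \sum_(m < M) _ => T.
have -> : (b n)%:C%C * ctrig n (z + w) - \sum_(m < M) term b m z n * w ^+ m =
    (b n)%:C%C * (ccos (phase n) (k%:C%C * z + k%:C%C * w) - S).
  rewrite mulrBr /ctrig mulrDr; congr (_ - _); rewrite mulr_sumr; apply: eq_bigr => m _.
  by rewrite /term -/k exprMn; ring.
rewrite Normc.normcM normc_real mulrCA ler_wpM2l// (le_trans T)//.
have k0 : 0 <= k by [].
have kn : k <= n%:R by rewrite ler_nat freq_le.
rewrite Normc.normcM normc_real ImZc normrM (ger0_norm k0) exprMn.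
have -> : k ^+ M * normc w ^+ M / M`!%:R * (4 * expR (k * `|complex.Im z| + k * normc w)) =
    normc w ^+ M * 4 * (k ^+ M / M`!%:R * expR (k * `|complex.Im z| + k * normc w)) by ring.
rewrite ler_wpM2l ?mulr_ge0 ?exprn_ge0 ?normc_ge0//.
rewrite [X in _ <= expR X]mulrDl mul1r [leRHS]expRD [leRHS]mulrC ler_pM ?expR_ge0 ?divr_ge0
    ?exprn_ge0//.
  by rewrite (le_trans (exprn_fact_le _ _))// ler_expR.
by rewrite ler_expR -mulrDr mulrC ler_wpM2l// addr_ge0// normc_ge0.
Qed.

Lemma ctrigsum_real b (x : R) : rapid b -> ctrigsum b x%:C%C = (trigsum b 0 x)%:C%C.
Proof.
move=> rb; apply/eqP; rewrite eq_complex; apply/andP; split; apply/eqP.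
  apply: eq_tsum => n; rewrite ReZc; congr (_ * _).
  rewrite /ctrig /ccos ReZc ImZc/= mulr0 /cosh oppr0 expR0 /trig expr0 mul1r mul0r addr0.
  by rewrite (_ : (1 + 1) / 2 = 1 :> R) ?mulr1//; field.
rewrite -[RHS]tsum0; apply: eq_tsum => n; rewrite ImZc /ctrig /ccos ReZc ImZc/=.
by rewrite mulr0 /sinh oppr0 subrr mul0r mulr0 oppr0 mulr0.
Qed.

Lemma ctrigsum_periodic b z : ctrigsum b (z + (2 * pi)%:C%C) = ctrigsum b z.
Proof.
rewrite /ctrigsum; congr csum; apply/funext => n; congr (_ * _).
rewrite /ctrig /ccos mulrDr ReD ImD !ReZc !ImZc/= mulr0 addr0 addrAC.
by rewrite (mulrC _ (2 * pi)) (cos_periodic_int (freq n)%:Z) (sin_periodic_int (freq n)%:Z).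
Qed.

Lemma ctrigsum_delta n z : ctrigsum (fun m => (m == n)%:R) z = ctrig n z.
Proof.
apply/eqP; rewrite eq_complex; apply/andP; split; apply/eqP.
  rewrite -[RHS](tsum_delta n); apply: eq_tsum => m; rewrite ReZc.
  by case: eqVneq => [->|_]; rewrite ?mul1r// mul0r.
rewrite -[RHS](tsum_delta n); apply: eq_tsum => m; rewrite ImZc.
by case: eqVneq => [->|_]; rewrite ?mul1r// mul0r.
Qed.

Lemma ctrigsum_split b N z : rapid b ->
  ctrigsum b z = \sum_(i < N) (b i)%:C%C * ctrig i z + ctrigsum (tail b N) z.
Proof.
move=> rb; elim: N => [|N IH].
  by rewrite big_ord0 add0r; congr csum; apply/funext => n.
rewrite big_ord_recr/= IH -addrA; congr (_ + _).
rewrite -(ctrigsum_delta N) /ctrigsum mulrC -csumZr; last exact/cgeo_ctrig/rapid_delta.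
rewrite -csumD; last 2 first.
- by apply: cgeoZr; exact/cgeo_ctrig/rapid_delta.
- exact/cgeo_ctrig/rapid_tail.
congr csum; apply/funext => n; rewrite /tail ltnS.
by case: (ltngtP n N) => [nN|nN|->] /=; ring.
Qed.

End entire_trigonometric_series.

Section complex_topology.
Context {R : realType}.
Local Notation C := R[i].
Local Notation normc := (@Normc.normc R).

Lemma complex_gt0 (e : C) : 0 < e -> exists2 r : R, 0 < r & e = r%:C%C.
Proof. by case: e => r s; rewrite ltcE/= => /andP[/eqP -> r0]; exists r. Qed.

Lemma near_normc (z : C) (d : R) : 0 < d -> \forall w \near (z : R[i]^o), normc (w - z) < d.
Proof.
move=> d0; apply/nbhs_ballP; exists d%:C%C => /=; first by rewrite ltcR.
by move=> w; rewrite /ball/= -opprB normrN normcE_norm ltcR.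
Qed.

Lemma cvg_normc {T : Type} {G : set_system T} {FG : Filter G} (u : T -> R[i]^o) (l : R[i]^o) :
  (forall e : R, 0 < e -> \forall n \near G, normc (u n - l) <= e) -> u @ G --> l.
Proof.
move=> H; apply/cvgrPdist_le => e /complex_gt0[r r0 ->].
apply: filterS (H r r0) => n nr.
suff : `|(l - u n : C)| <= r%:C%C by [].
by rewrite normcE_norm lecR -normcN opprB.
Qed.

Lemma normc_eq0 (z : C) : normc z <= 0 -> z = 0.
Proof.
move=> z0; apply: Normc.eq0_normc; apply/eqP.
by rewrite eq_le z0 normc_ge0.
Qed.

End complex_topology.

(** * The cube in the space of analytic functions *)

Section Comega_trigonometric.
Context {R : realType} (delta : {posnum R}).
Local Notation C := R[i].
Local Notation normc := (@Normc.normc R).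
Implicit Types (b : nat -> R) (z w : C).

Let d : R := delta%:num.
Let d0 : 0 < d. Proof. by rewrite /d. Qed.

(** The normal form required of the elements of the space: zero outside the closed strip. *)
Definition strip_cut (F : C -> C) : C -> Rcomplex R :=
  fun z => if `|complex.Im z| <= d then F z else 0.

Lemma ccoef0 b z : rapid b -> ccoef b 0 z = ctrigsum b z.
Proof.
move=> rb; have := ctrigsum_expansion 1 z 0 rb.
rewrite big_ord1 expr0 mulr1 addr0 Normc.normc0 expr1 mul0r => /normc_eq0/eqP.
by rewrite subr_eq0 => /eqP.
Qed.

Lemma ctrigsum_lip b z w : rapid b -> normc w <= 1 ->
  normc (ctrigsum b (z + w) - ctrigsum b z) <=
    normc w * (8 * cweight b (`|complex.Im z| + 1 + 1)).
Proof.
move=> rb w1; have := ctrigsum_expansion 1 z w rb.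
rewrite big_ord1 expr0 mulr1 ccoef0// expr1 => /le_trans; apply.
by rewrite ler_wpM2l ?normc_ge0// ler_wpM2l// cweight_le// lerD// lerD.
Qed.

Lemma continuous_ctrigsum b : rapid b -> continuous (ctrigsum b : R[i]^o -> R[i]^o).
Proof.
move=> rb z; apply: (@cvg_normc R _ (nbhs z) _) => e e0.
set K := 8 * cweight b (`|complex.Im z| + 1 + 1).
have K0 : 0 <= K by rewrite mulr_ge0// cweight_ge0.
have m0 : 0 < Num.min 1 (e / (K + 1)) by rewrite lt_min ltr01 divr_gt0//; lra.
apply: filterS (near_normc z m0) => w; rewrite lt_min => /andP[w1 we].
have := ctrigsum_lip z rb (ltW w1); rewrite -/K (addrC z) subrK => /le_trans; apply.
rewrite (@le_trans _ _ (normc (w - z) * (K + 1)))//; first by rewrite ler_wpM2l ?normc_ge0//; lra.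
by rewrite -ler_pdivlMr ?ltW//; lra.
Qed.

(** On the disc of radius 1/2 the remainder of order n is at most K / 2^n, with K independent of
    n. *)
Lemma ctrigsum_analytic b z : rapid b -> \forall w \near (z : R[i]^o),
  series (fun n => ccoef b n z * (w - z) ^+ n : R[i]^o) @ \oo --> (ctrigsum b w : R[i]^o).
Proof.
move=> rb; have h0 : 0 < 2^-1 :> R by rewrite invr_gt0.
apply: filterS (near_normc z h0) => w wz; apply: cvg_normc => e e0.
set K := 8 * cweight b (`|complex.Im z| + 1 + 1).
have K0 : 0 <= K by rewrite mulr_ge0// cweight_ge0.
near=> n.
rewrite /series/= big_mkord -opprB normcN.
have := ctrigsum_expansion n z (w - z) rb; rewrite (addrC z) subrK => /le_trans; apply.
apply: (@le_trans _ _ (K * 2^-1 ^+ n)).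
  rewrite mulrC ler_pM ?exprn_ge0 ?normc_ge0//.
  - by rewrite mulr_ge0// cweight_ge0.
  - rewrite ler_wpM2l// cweight_le// lerD// lerD// (le_trans (ltW wz))//.
    by rewrite invf_le1// ler1n.
  - by rewrite lerXn2r ?nnegrE ?normc_ge0 ?ltW.
near: n.
have : geometric K 2^-1 @ \oo --> (0 : R).
  by apply: cvg_geometric; rewrite ger0_norm ?invr_ge0// invf_lt1// ltr1n.
move=> /cvgrPdist_le/(_ _ e0); apply: filterS => N; rewrite sub0r normrN.
by move=> /(le_trans _); apply; rewrite ler_norm.
Unshelve. all: by end_near. Qed.

Lemma strip_cut_in (F : C -> C) z : `|complex.Im z| <= d -> strip_cut F z = F z.
Proof. by rewrite /strip_cut => ->. Qed.

Lemma strip_cut_ctrigsum b : rapid b -> strip_cut (ctrigsum b) \in strip_pred delta.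
Proof.
move=> rb; apply/asboolP; split.
- move=> z zd; exists (ccoef b ^~ z).
  have dz0 : 0 < d - `|complex.Im z| by rewrite subr_gt0.
  apply: filterS2 (ctrigsum_analytic z rb) (near_normc z dz0) => w H wz.
  rewrite strip_cut_in//.
  have := le_lt_trans (Im_le_normc (w - z)) wz; rewrite ImB => h.
  have := ler_normD (complex.Im w - complex.Im z) (complex.Im z); rewrite subrK.
  by move=> /le_trans; apply; lra.
- apply/subspace_continuousP => z zd.
  suff : strip_cut (ctrigsum b) x @[x --> within (closed_strip d) (nbhs z)] -->
    (strip_cut (ctrigsum b) z : R[i]^o) by [].
  rewrite strip_cut_in//.
  apply: (@cvg_trans _ ((ctrigsum b : R[i]^o -> R[i]^o) @ within (closed_strip d) (nbhs z))).
    apply: near_eq_cvg; rewrite near_withinE; apply: filterE => w wd.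
    by rewrite strip_cut_in.
  by apply: cvg_within_filter; exact: continuous_ctrigsum.
- by move=> z zd; rewrite /strip_cut ifF//; apply/negbTE/negP.
- split.
  + move=> z; rewrite /strip_cut ctrigsum_periodic.
    by rewrite ImD/= addr0.
  + move=> x; rewrite strip_cut_in ?ctrigsum_real//=.
    by rewrite normr0 ltW.
  + exists (4 * cweight b d) => z _; rewrite /strip_cut; case: ifP => zd.
      rewrite -[leLHS]/(normc _) (le_trans (normc_ctrigsum _ rb))// ler_wpM2l//.
      exact: cweight_le.
    by rewrite normr0 mulr_ge0// cweight_ge0.
Qed.

Definition Comega_trigsum b : ComegaS delta :=
  if pselect (rapid b) is left rb then MkComegaS (strip_cut_ctrigsum rb) else 0.

Lemma Comega_trigsumE b z : rapid b -> `|complex.Im z| <= d ->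
  Comega_trigsum b z = ctrigsum b z.
Proof. by rewrite /Comega_trigsum; case: pselect => //= rb _; exact: strip_cut_in. Qed.

Definition Comega_trig (n : nat) : ComegaS delta := Comega_trigsum (fun m => (m == n)%:R).

Lemma Comega_trigE n z : `|complex.Im z| <= d -> Comega_trig n z = ctrig n z.
Proof.
by move=> zd; rewrite /Comega_trig Comega_trigsumE ?ctrigsum_delta//; exact: rapid_delta.
Qed.

Lemma Comega_sumE (n : nat) (g : nat -> ComegaS delta) z :
  (\sum_(i < n) g i) z = \sum_(i < n) g i z.
Proof. by elim/big_rec2: _ => // i y x _ <-. Qed.

Lemma Comega_eq (F G : ComegaS delta) :
  (forall z, `|complex.Im z| <= d -> F z = G z) -> F = G.
Proof.
move=> FG; apply/val_inj/funext => z /=.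
have [/FG//|zd] := pselect (`|complex.Im z| <= d).
have /asboolP[_ _ -> // _] := continuationP F.
by have /asboolP[_ _ -> // _] := continuationP G.
Qed.

Lemma Comega_trig_sumE (n : nat) b z : `|complex.Im z| <= d ->
  (\sum_(i < n) b i *: Comega_trig i : ComegaS delta) z = \sum_(i < n) (b i)%:C%C * ctrig i z.
Proof.
move=> zd; rewrite (Comega_sumE n (fun i => b i *: Comega_trig i)); apply: eq_bigr => i _.
by rewrite -[LHS]/(b i *: Comega_trig i z) Rcomplex_scaleE Comega_trigE.
Qed.

Lemma Comega_trigsum_split b N : rapid b ->
  Comega_trigsum b = \sum_(i < N) b i *: Comega_trig i + Comega_trigsum (tail b N).
Proof.
move=> rb; apply: Comega_eq => z zd.
rewrite -[RHS]/((\sum_(i < N) b i *: Comega_trig i : ComegaS delta) z +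
  Comega_trigsum (tail b N) z).
rewrite Comega_trig_sumE// !Comega_trigsumE//; last exact: rapid_tail.
exact: ctrigsum_split.
Qed.

Lemma Comega_trigsum_norm b : rapid b ->
  `|Comega_trigsum b| <= 4 * tsum (fun n => `|b n| * expR (d * n%:R)).
Proof.
move=> rb; apply: sup_norm_le => [|z /ltW zd]; first exact: open_strip_neq0.
rewrite Comega_trigsumE// (le_trans (normc_ctrigsum _ rb))// ler_wpM2l//.
exact: cweight_le.
Qed.

Lemma Comega_trig_norm n : `|Comega_trig n| <= 4 * expR (d * n%:R).
Proof.
apply: sup_norm_le => [|z /ltW zd]; first exact: open_strip_neq0.
rewrite Comega_trigE// (le_trans (normc_ctrig _ _))// ler_pM ?expR_ge0 ?ler_nat//.
by rewrite ler_expR ler_wpM2r.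
Qed.

Lemma ctrig_real n (x : R) : ctrig n x%:C%C = (trig 0 n x)%:C%C.
Proof.
by rewrite -ctrigsum_delta ctrigsum_real ?trigsum_delta//; exact: rapid_delta.
Qed.

Lemma Comega_trig_indep : lin_indep Comega_trig.
Proof.
move=> n c H; apply: trig_independent => x.
have := congr1 (fun G : ComegaS delta => complex.Re (G x%:C%C)) H.
rewrite Comega_trig_sumE/= ?normr0 ?ltW// => E; rewrite -[RHS]E.
rewrite Re_sum; apply: eq_bigr => i _.
by rewrite ReZc ctrig_real.
Qed.

Lemma Comega_cube_coef S t : (forall n, 0 <= t n <= 1) ->
  real_restriction (Comega_trigsum (amp S) + Comega_trigsum (fun n => t n * eps n)) =
  trigsum (coef S t) 0.
Proof.
move=> t01; have rt : rapid (fun n => t n * eps n : R).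
  apply: (le_rapid (C := 1) (L := 0) rapid_eps) => n.
  rewrite mul0r expR0 mulr1 mul1r normrM ler_piMl//.
  by have /andP[t0 t1] := t01 n; rewrite ger0_norm.
have ra := @rapid_amp R S.
have rE b x : rapid b -> complex.Re (Comega_trigsum b x%:C%C) = trigsum b 0 x.
  by move=> rb; rewrite Comega_trigsumE ?ctrigsum_real//= normr0 ltW.
apply/funext => x.
rewrite /real_restriction -[LHS]/(complex.Re (Comega_trigsum (amp S) x%:C%C +
  Comega_trigsum (fun n => t n * eps n) x%:C%C)).
rewrite ReD !rE//.
rewrite /trigsum -tsumD; [|exact/geo_trig/rapid_amp|exact: geo_trig].
by apply: eq_tsum => n; rewrite /coef mulrDl.
Qed.

Lemma Comega_not_cube_null (S : pred nat) (E : set (ComegaS delta)) :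
  dense (lin_span Comega_trig) ->
  (forall F : ComegaS delta, (exists2 t, forall n, 0 <= t n <= 1 &
     real_restriction F = trigsum (coef S t) 0) -> E F) ->
  ~ cube_null E.
Proof.
move=> dns H; apply: (@not_cube_null R (ComegaS delta) Comega_trig Comega_trigsum 4 d
  _ _ _ _ dns S) => [b N|b|n||t t01].
- exact: Comega_trigsum_split.
- exact: Comega_trigsum_norm.
- exact: Comega_trig_norm.
- exact: Comega_trig_indep.
- by apply: H; exists t => //; exact: Comega_cube_coef.
Qed.

Lemma IC_ess_not_prevalent : dense (lin_span Comega_trig) ->
  ~ cube_prevalent (IC_ess (@real_restriction R delta) 1).
Proof.
move=> dns; apply: (@Comega_not_cube_null fact_freq) => // F [t t01 FE] [Q].
(* Since m! >= m, the denominator m! is past Q, while the cyclicity there is at least m >= 2. *)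
pose m := maxn 2 Q => /(_ 1%N m`! (fact_gt0 _) (coprime1n _)).
rewrite FE => /(_ (leq_trans (leq_maxr 2 Q) (fact_geq m))).
move=> /(le_trans (fact_freq_inf_cyclicity t01 _)) => /(_ (leq_trans (ltn0Sn 1) (leq_maxl 2 Q))).
rewrite lee_fin ler_nat => m1.
by have := leq_trans (leq_maxl 2 Q) m1.
Qed.

Lemma IC_fin_not_prevalent : dense (lin_span Comega_trig) ->
  ~ cube_prevalent (IC_fin (@real_restriction R delta)).
Proof.
move=> dns; apply: (@Comega_not_cube_null fact_freq) => // F [t t01 FE] [N _].
move=> /(_ (1%:R / N.+1`!%:R)); rewrite FE.
move=> /(le_trans (fact_freq_inf_cyclicity t01 _)) => /(_ (ltn0Sn N)).
by rewrite lee_fin ler_nat ltnn.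
Qed.

End Comega_trigonometric.

(** * Trigonometric approximation in a strip *)

Section rotation_averages.
Context {R : realType}.
Local Notation C := R[i].
Local Notation normc := (@Normc.normc R).
Implicit Types (F G : C -> C) (z w : C).

Definition node (N j : nat) : R := 2 * pi * j%:R / N%:R.

Definition average N (g : nat -> C) : C := (N%:R^-1)%:C%C * \sum_(j < N) g j.

Lemma normc_average N (g : nat -> C) (e : nat -> R) : (forall j, (j < N)%N -> normc (g j) <= e j) ->
  normc (average N g) <= N%:R^-1 * \sum_(j < N) e j.
Proof.
move=> ge; rewrite Normc.normcM normc_real ger0_norm ?invr_ge0// ler_wpM2l ?invr_ge0//.
by rewrite (le_trans (normc_sum _ _))// ler_sum// => j _; exact: ge.
Qed.

Lemma normc_average_le N (g : nat -> C) (e : R) : (0 < N)%N ->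
  (forall j, (j < N)%N -> normc (g j) <= e) -> normc (average N g) <= e.
Proof.
move=> N0 /normc_average/le_trans; apply; rewrite sumr_const card_ord -[X in _ * X]mulr_natl.
by rewrite mulKf// pnatr_eq0 -lt0n.
Qed.

Lemma averageB N (g h : nat -> C) : average N g - average N h = average N (fun j => g j - h j).
Proof. by rewrite /average -mulrBr sumrB. Qed.

Lemma averageMl N (g : nat -> C) (c : C) : c * average N g = average N (fun j => c * g j).
Proof. by rewrite /average mulrCA mulr_sumr. Qed.

Lemma eq_average N (g h : nat -> C) : (forall j, (j < N)%N -> g j = h j) ->
    average N g = average N h.
Proof. by move=> gh; congr (_ * _); apply: eq_bigr => j _; exact: gh. Qed.

Lemma shift_int G (p : R) (m : int) z : (forall z, G (z + p%:C%C) = G z) ->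
  G (z + (p * m%:~R)%:C%C) = G z.
Proof.
move=> pG; have H n y : G (y + (p * n%:R)%:C%C) = G y.
  elim: n y => [|n IH] y; first by rewrite mulr0 addr0.
  by rewrite -[n.+1]addn1 natrD mulrDr mulr1 rmorphD addrA pG IH.
case: m => n; first exact: H.
by rewrite NegzE mulrNz mulrN -(H n.+1) rmorphN subrK.
Qed.

Definition rotation_mean N G z : C := average N (fun j => G (z + (node N j)%:C%C)).

(** The Cauchy-Riemann operator as a finite difference: it compares the increment along i h with i
    times the increment along h, and is o(h) where G is complex differentiable. *)
Definition dbar G z (h : R) : C :=
  G (z + (0 +i* h)%C) - G z - (0 +i* 1)%C * (G (z + h%:C%C) - G z).

Lemma reduce_mod (p : R) : 0 < p -> forall x, exists m : int, 0 <= x - p * m%:~R < p.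
Proof.
move=> p0 x; exists (Num.floor (x / p)); rewrite subr_ge0 ltrBlDr mulrC.
have /andP[mx xm] := real_floor_itv (num_real (x / p)).
rewrite -ler_pdivlMr// mx/= (_ : _ + _ = (Num.floor (x / p) + 1)%:~R * p) -?ltr_pdivrMr//.
by rewrite intrD mulrDl mul1r addrC.
Qed.

Lemma archi_div (a rho : R) : 0 < rho -> exists2 N0 : nat, (0 < N0)%N &
  forall N, (N0 <= N)%N -> a / N%:R <= rho.
Proof.
move=> rho0; have [a0|a0] := leP a 0.
  by exists 1%N => // N _; rewrite (le_trans _ (ltW rho0))// mulr_le0_ge0 ?invr_ge0.
exists (Num.truncn (a / rho)).+1 => // N NN.
have N0 : 0 < N%:R :> R by rewrite ltr0n; exact: leq_trans NN.
rewrite ler_pdivrMr// mulrC -ler_pdivrMr//.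
have /andP[_ /ltW/le_trans] := truncn_itv (ltW (divr_gt0 a0 rho0)); apply.
by rewrite ler_nat.
Qed.

Variable d : R.

Definition strip_uniform G := forall e : R, 0 < e -> exists2 rho : R, 0 < rho &
  forall z w, `|complex.Im z| <= d -> `|complex.Im w| <= d -> normc (w - z) <= rho ->
    normc (G w - G z) <= e.

(* The Cauchy-Riemann equations, as a difference estimate uniform on the
   narrower closed strips. *)
Definition strip_cr G := forall d' e : R, d' < d -> 0 < e -> exists2 rho : R, 0 < rho &
  forall z h, `|complex.Im z| <= d' -> 0 <= h <= rho -> normc (dbar G z h) <= e * h.

Section one_function.
Variable G : C -> C.
Hypothesis G_per : forall z, G (z + (2 * pi)%:C%C) = G z.

Lemma rotation_mean_shift N z : (0 < N)%N ->
  rotation_mean N G (z + (2 * pi / N%:R)%:C%C) = rotation_mean N G z.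
Proof.
move=> N0; congr (_ * _); pose g j := G (z + (node N j)%:C%C).
have NR : N%:R != 0 :> R by rewrite pnatr_eq0 -lt0n.
transitivity (\sum_(j < N) g j.+1).
  apply: eq_bigr => j _; congr G; rewrite -addrA -rmorphD; congr (_ + _%:C%C).
  by rewrite /node -natr1 -[2 * pi * _ / _]mulrA; move: (pi : R) => P; ring.
apply: (@addrI _ (g 0%N)).
have := big_ord_recl N (fun j => g (nat_of_ord j)) : \sum_(j < N.+1) g j = _.
rewrite big_ord_recr/= => <-; rewrite addrC; congr (_ + _).
rewrite /g /node mulfK// mulr0 mul0r addr0; exact: G_per.
Qed.

(** The mean is exactly invariant under the shift by 2 pi / N, so any horizontal displacement
    reduces to one shorter than 2 pi / N, where uniform continuity applies to each term. *)
Lemma rotation_mean_horizontal N (e rho : R) z w : (0 < N)%N -> 2 * pi / N%:R <= rho ->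
  (forall z w, `|complex.Im z| <= d -> `|complex.Im w| <= d -> normc (w - z) <= rho ->
    normc (G w - G z) <= e) ->
  complex.Im w = complex.Im z -> `|complex.Im z| <= d ->
  normc (rotation_mean N G w - rotation_mean N G z) <= e.
Proof.
move=> N0 Nrho H wz zd; set p := 2 * pi / N%:R in Nrho.
have p0 : 0 < p by rewrite divr_gt0 ?ltr0n// mulr_gt0// pi_gt0.
have [m /andP[r0 rp]] := reduce_mod p0 (complex.Re w - complex.Re z).
set r := _ - p * m%:~R in r0 rp.
have -> : w = z + r%:C%C + (p * m%:~R)%:C%C.
  rewrite -addrA -rmorphD subrK; apply/eqP; rewrite eq_complex ReD ImD/= addr0 wz eqxx andbT.
  by rewrite addrC subrK.
rewrite shift_int; last by move=> y; exact: rotation_mean_shift.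
rewrite /rotation_mean averageB; apply: normc_average_le => // j _.
apply: H; rewrite ?ImD/= ?addr0//.
rewrite (_ : _ - _ = r%:C%C); last by ring.
by rewrite normc_real ger0_norm// (le_trans (ltW rp)).
Qed.

Hypothesis G_unif : strip_uniform G.
Hypothesis G_cr : strip_cr G.

Lemma dbar_rotation_mean N z h : dbar (rotation_mean N G) z h =
  average N (fun j => dbar G (z + (node N j)%:C%C) h).
Proof.
rewrite /dbar /rotation_mean !averageB averageMl averageB; apply: eq_average => j _.
by rewrite (addrAC z (0 +i* h)%C) (addrAC z h%:C%C).
Qed.

(** The segment is climbed in n steps of height h. A vertical increment is a [dbar], at most e1 h,
    plus i times a horizontal increment, at most e2. *)
Lemma rotation_mean_vertical (d' e1 e2 rho1 rho2 : R) (N n : nat) (y1 y2 : R) : d' <= d ->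
  (forall z h, `|complex.Im z| <= d' -> 0 <= h <= rho1 -> normc (dbar G z h) <= e1 * h) ->
  (forall z w, `|complex.Im z| <= d -> `|complex.Im w| <= d -> normc (w - z) <= rho2 ->
    normc (G w - G z) <= e2) ->
  (0 < N)%N -> 2 * pi / N%:R <= rho2 -> (0 < n)%N -> (y2 - y1) / n%:R <= rho1 ->
  - d' <= y1 -> y1 <= y2 -> y2 <= d' ->
  normc (rotation_mean N G (0 +i* y2)%C - rotation_mean N G (0 +i* y1)%C) <=
    e1 * (y2 - y1) + n%:R * e2.
Proof.
move=> d'd H1 H2 N0 Nrho n0 hrho y1d y12 y2d; set h := (y2 - y1) / n%:R in hrho.
have nR : n%:R != 0 :> R by rewrite pnatr_eq0 -lt0n.
have h0 : 0 <= h by rewrite divr_ge0// subr_ge0.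
have nh : h * n%:R = y2 - y1 by rewrite divfK.
suff K k : (k <= n)%N -> normc (rotation_mean N G (0 +i* (y1 + h * k%:R))%C -
    rotation_mean N G (0 +i* y1)%C) <= k%:R * (e1 * h + e2).
  have := K n (leqnn n); rewrite nh (addrC y1) subrK => /le_trans; apply.
  by rewrite mulrDr (mulrCA _ e1) (mulrC _ h) nh.
elim: k => [|k IH] kn.
  by rewrite mulr0 addr0 subrr Normc.normc0 mul0r.
set z := (0 +i* (y1 + h * k%:R))%C in IH.
have zd : `|complex.Im z| <= d'.
  rewrite ler_norml/=; apply/andP; split; first by rewrite (le_trans y1d)// lerDl mulr_ge0.
  rewrite (le_trans _ y2d)// -lerBrDl -nh ler_wpM2l// ler_nat ltnW//.
have -> : (0 +i* (y1 + h * k.+1%:R))%C = z + (0 +i* h)%C.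
  by apply/eqP; rewrite eq_complex/= addr0 eqxx -natr1 mulrDr mulr1 addrA eqxx.
have -> : rotation_mean N G (z + (0 +i* h)%C) - rotation_mean N G (0 +i* y1)%C =
    (rotation_mean N G z - rotation_mean N G (0 +i* y1)%C) + (dbar (rotation_mean N G) z h +
      (0 +i* 1)%C * (rotation_mean N G (z + h%:C%C) - rotation_mean N G z)).
  by rewrite /dbar; ring.
rewrite (le_trans (le_normcD _ _))// -natr1 mulrDl mul1r lerD ?IH//; first exact: ltnW.
rewrite (le_trans (le_normcD _ _))// lerD//.
  rewrite dbar_rotation_mean; apply: normc_average_le => // j _; apply: H1; rewrite ?h0//.
  by rewrite ImD/= addr0.
rewrite Normc.normcM normc_imag normr1 mul1r.
apply: (rotation_mean_horizontal N0 Nrho H2); last exact: le_trans d'd.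
by rewrite ImD/= addr0.
Qed.

(** From z one moves horizontally to the imaginary axis, then by uniform continuity to the height t
    y inside a narrower strip, where the Cauchy-Riemann estimate holds, then down to 0. The number n
    of vertical steps is fixed before the horizontal accuracy e / (6 n), and N comes last. For d = 0
    the horizontal move alone is enough. *)
Lemma rotation_mean_cvg (e : R) : 0 <= d -> 0 < e -> exists2 N0 : nat, (0 < N0)%N &
  forall N z, (N0 <= N)%N -> `|complex.Im z| <= d ->
    normc (rotation_mean N G z - rotation_mean N G 0) <= e.
Proof.
move=> d0 e0; have e30 : 0 < e / 3 by lra.
have [rho1 rho10 H1] := G_unif e30.
have [dE|dn0] := eqVneq d 0.
  have [N0 N00 N0P] := archi_div (2 * pi) rho10.
  exists N0 => // N z NN zd.
  apply: (@le_trans _ _ (e / 3)); last by lra.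
  apply: (rotation_mean_horizontal (leq_trans N00 NN) (N0P _ NN) H1); rewrite /= ?normr0//.
  by move: zd; rewrite dE normr_le0 => /eqP ->.
have {dn0}dp : 0 < d by rewrite lt0r dn0.
pose t := d / (d + rho1); have t0 : 0 < t by rewrite divr_gt0// addr_gt0.
have tE : 1 - t = rho1 / (d + rho1) by rewrite /t; field; rewrite gt_eqF// addr_gt0.
have t1 : t < 1 by rewrite -subr_gt0 tE divr_gt0// addr_gt0.
have dt : d * (1 - t) <= rho1.
  by rewrite tE mulrCA ler_piMr ?ltW// ler_pdivrMr ?addr_gt0// mul1r lerDl ltW.
have d'd : d * t < d by rewrite gtr_pMr.
have e10 : 0 < e / (12 * (d + 1)) by rewrite divr_gt0// mulr_gt0//; lra.
have [rho2 rho20 H2] := G_cr d'd e10.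
have [n n0 nP] := archi_div (2 * d) rho20.
have nR : 0 < n%:R :> R by rewrite ltr0n.
have e20 : 0 < e / (6 * n%:R) by rewrite divr_gt0// mulr_gt0.
have [rho3 rho30 H3] := G_unif e20.
have [N0 N00 N0P] := archi_div (2 * pi) rho30.
exists N0 => // N z NN zd; have Np := leq_trans N00 NN.
pose y := complex.Im z.
have yd : `|t * y| <= d * t by rewrite normrM gtr0_norm// mulrC ler_wpM2r// ltW.
have V y1 y2 : y1 <= y2 -> `|y1| <= d * t -> `|y2| <= d * t ->
    normc (rotation_mean N G (0 +i* y2)%C - rotation_mean N G (0 +i* y1)%C) <= e / 3.
  move=> y12; rewrite !ler_norml => /andP[a1 a2] /andP[b1 b2].
  have hn : (y2 - y1) / n%:R <= rho2.
    rewrite (le_trans _ (nP n (leqnn n)))// ler_wpM2r ?invr_ge0//; lra.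
  apply: le_trans (rotation_mean_vertical (ltW d'd) H2 H3 Np (N0P _ NN) n0 hn a1 y12 b2) _.
  have -> : n%:R * (e / (6 * n%:R)) = e / 6 by field; rewrite gt_eqF.
  have -> : e / 3 = e / 6 + e / 6 by field.
  rewrite lerD2r mulrAC ler_pdivrMr; last by rewrite mulr_gt0//; lra.
  rewrite (_ : e / 6 * (12 * (d + 1)) = e * (2 * d + 2)); last by field.
  by rewrite ler_wpM2l ?(ltW e0)//; lra.
have -> : rotation_mean N G z - rotation_mean N G 0 =
    (rotation_mean N G z - rotation_mean N G (0 +i* y)%C) +
    (rotation_mean N G (0 +i* y)%C - rotation_mean N G (0 +i* (t * y))%C) +
    (rotation_mean N G (0 +i* (t * y))%C - rotation_mean N G 0) by ring.
have -> : e = e / 3 + e / 3 + e / 3 by field.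
rewrite (le_trans (le_normcD _ _))// lerD//; last first.
  have dt0 : `|0 : R| <= d * t by rewrite normr0 ltW// mulr_gt0.
  have [y0|/ltW y0] := leP 0 y.
    by apply: (V 0 (t * y)) => //; rewrite mulr_ge0// ltW.
  rewrite -normcN opprB; apply: (V (t * y) 0) => //.
  by rewrite mulr_ge0_le0// ltW.
rewrite (le_trans (le_normcD _ _))// lerD//.
  apply: (@le_trans _ _ (e / (6 * n%:R))).
    by apply: (rotation_mean_horizontal Np (N0P _ NN) H3).
  rewrite ler_pdivrMr ?mulr_gt0// (_ : e / 3 * (6 * n%:R) = e * (2 * n%:R)); last by field.
  rewrite ler_peMr ?(ltW e0)//; have : (1 : R) <= n%:R by rewrite ler1n.
  lra.
rewrite /rotation_mean averageB; apply: normc_average_le => // j _.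
apply: H1; [by rewrite ImD/= addr0 (le_trans yd)// ltW|by rewrite ImD/= addr0|].
rewrite (_ : _ - _ = (0 +i* ((1 - t) * y))%C); last first.
  by apply/eqP; rewrite eq_complex/=; apply/andP; split; apply/eqP; ring.
rewrite normc_imag normrM ger0_norm ?subr_ge0 ?(ltW t1)// (le_trans _ dt)// mulrC.
by rewrite ler_wpM2r// subr_ge0 ltW.
Qed.

End one_function.

End rotation_averages.

(** * The Fejer kernel and its discretized means *)

Section fejer_kernel.
Context {R : realType}.
Implicit Types (s : R).

Definition fejer n s : R :=
  ((\sum_(l < n) cos (l%:R * s)) ^+ 2 + (\sum_(l < n) sin (l%:R * s)) ^+ 2) / n%:R.

Lemma fejer_ge0 n s : 0 <= fejer n s.
Proof. by rewrite divr_ge0// addr_ge0// sqr_ge0. Qed.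

(** The geometric sum of exp (i l s) times 1 - exp (i s) telescopes; taking squared moduli gives the
    identity. It expresses concentration at 0: against 1 - cos s the kernel is at most 2 / n. *)
Lemma fejer_mul n s : fejer n s * (1 - cos s) = (1 - cos (n%:R * s)) / n%:R.
Proof.
rewrite /fejer mulrAC; congr (_ / _).
set X := \sum_(l < n) cos _; set Y := \sum_(l < n) sin _.
have [XE YE] : X * (1 - cos s) + Y * sin s = 1 - cos (n%:R * s) /\
    Y * (1 - cos s) - X * sin s = - sin (n%:R * s).
  rewrite /X /Y; elim: n {X Y} => [|n [IHX IHY]].
    by rewrite !big_ord0 !mul0r cos0 sin0; split; ring.
  have nE : n.+1%:R * s = n%:R * s + s by rewrite -natr1 mulrDl mul1r.
  rewrite !big_ord_recr/= nE cosD sinD.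
  by split; lra.
have t1 := cos2Dsin2 s; have t2 := cos2Dsin2 (n%:R * s).
have h : (X ^+ 2 + Y ^+ 2) * (2 * (1 - cos s)) = 2 * (1 - cos (n%:R * s)).
  have -> : 2 * (1 - cos s) = (1 - cos s) ^+ 2 +
      sin s ^+ 2 by rewrite -(addrK (cos s ^+ 2) (sin s ^+ 2)) [sin s ^+ 2 + _]addrC t1; ring.
  have -> : (X ^+ 2 + Y ^+ 2) * ((1 - cos s) ^+ 2 + sin s ^+ 2) =
     (X * (1 - cos s) + Y * sin s) ^+ 2 + (Y * (1 - cos s) - X * sin s) ^+ 2 by ring.
  rewrite XE YE sqrrN -(addrK (cos (n%:R * s) ^+ 2) (sin (n%:R * s) ^+ 2)) [sin _ ^+ 2 +
      _]addrC t2; ring.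
by apply: (@mulfI _ 2) => //; rewrite -h; ring.
Qed.

Definition distn (l m : nat) := ((l - m) + (m - l))%N.

Lemma fejerE n s : fejer n s = n%:R^-1 * \sum_(l < n) \sum_(m < n) cos ((distn l m)%:R * s).
Proof.
rewrite /fejer mulrC; congr (_ * _).
rewrite !expr2 !mulr_suml -big_split/=; apply: eq_bigr => l _.
rewrite !mulr_sumr -big_split/=; apply: eq_bigr => m _.
rewrite /distn -cosB -mulrBl; have [lm|lm] := leqP l m.
  have -> : (l - m)%N = 0%N by lia.
  by rewrite add0n natrB// -cosN -mulNr opprB.
have -> : (m - l)%N = 0%N by lia.
by rewrite addn0 natrB// ltnW.
Qed.

(** The frequencies |l - m| < n <= N are not divisible by N unless l = m, so the discretized kernel
    has mean exactly 1. *)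
Lemma sum_fejer N n : (0 < n)%N -> (n <= N)%N -> \sum_(j < N) fejer n (node N j) = N%:R.
Proof.
move=> n0 nN; have N0 := leq_trans n0 nN.
under eq_bigr do rewrite fejerE.
rewrite -mulr_sumr exchange_big/=.
under eq_bigr do rewrite exchange_big/=.
have E (l m : 'I_n) : \sum_(j < N) cos ((distn l m)%:R * node N j) = N%:R *+ (m == l) :> R.
  have := @sum_cos_rotation R N (distn l m) 1 0 0 N0 (coprime1n _).
  rewrite mulr0 addr0 cos0 mulr1 => H.
  transitivity (if (N %| distn l m)%N then N%:R else 0 : R).
    rewrite -H; apply: eq_bigr => j _; rewrite addr0 add0r /node; congr (cos (_ * _)).
    by rewrite mul1r mulrAC.
  have [->|ml] := eqVneq m l; first by rewrite /distn subnn addn0 dvdn0.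
  rewrite gtnNdvd//; move: ml; rewrite -val_eqE/= /distn; have := ltn_ord l; have := ltn_ord m; lia.
rewrite (eq_bigr (fun=> N%:R)) => [|l _]; last first.
  under eq_bigr do rewrite E.
  by rewrite (bigD1 l)//= eqxx big1 ?addr0// => m /negbTE->.
rewrite sumr_const card_ord -[X in _ * X]mulr_natl mulKf// pnatr_eq0 -lt0n//.
Qed.

End fejer_kernel.

Section trigonometric_polynomials.
Context {R : realType}.
Local Notation C := R[i].
Local Notation normc := (@Normc.normc R).
Implicit Types (F G : C -> C) (z w : C).

Definition trig_poly F := exists n (a : nat -> R),
  forall z, F z = \sum_(i < n) (a i)%:C%C * ctrig i z.

Lemma trig_polyD F G : trig_poly F -> trig_poly G -> trig_poly (fun z => F z + G z).
Proof.
have pad n N (a : nat -> R) z : (n <= N)%N ->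
    \sum_(i < n) (a i)%:C%C * ctrig i z = \sum_(i < N) (if (i < n)%N then a i else 0)%:C%C *
        ctrig i z.
  move=> nN; rewrite (big_ord_widen _ (fun i => (a i)%:C%C * ctrig i z) nN) big_mkcond/=.
  by apply: eq_bigr => i _; case: ifP => // _; rewrite mul0r.
move=> [n [a Fa]] [m [b Gb]]; exists (maxn n m).
exists (fun i => (if (i < n)%N then a i else 0) + (if (i < m)%N then b i else 0)) => z.
rewrite Fa Gb (pad n (maxn n m)) ?leq_maxl// (pad m (maxn n m)) ?leq_maxr// -big_split/=.
by apply: eq_bigr => i _; rewrite rmorphD mulrDl.
Qed.

Lemma trig_polyZ (c : R) F : trig_poly F -> trig_poly (fun z => c%:C%C * F z).
Proof.
move=> [n [a Fa]]; exists n, (fun i => c * a i) => z.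
by rewrite Fa mulr_sumr; apply: eq_bigr => i _; rewrite rmorphM mulrA.
Qed.

Lemma trig_poly_ctrig n : trig_poly (ctrig n).
Proof.
exists n.+1, (fun i => (i == n)%:R) => z; rewrite big_ord_recr/= eqxx mul1r big1 ?add0r// => i _.
by rewrite ltn_eqF// mul0r.
Qed.

Lemma trig_poly_sum (I : Type) (r : seq I) (F : I -> C -> C) :
  (forall i, trig_poly (F i)) -> trig_poly (fun z => \sum_(i <- r) F i z).
Proof.
move=> H; elim: r => [|i r IH].
  by exists 0%N, (fun=> 0) => z; rewrite big_nil big_ord0.
under eq_fun do rewrite big_cons.
exact: trig_polyD.
Qed.

(** The indices of the basis functions of frequency k; frequency 0 has only the constant. *)
Definition harmonics k := if k == 0%N then [:: 0%N] else [:: (2 * k)%N; (2 * k).-1].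

(** The addition theorem for cos (w - z) with w - z = t real. It involves no conjugation, so the
    factors depending on z are entire and can serve as basis functions. *)
Lemma ccos_addition (t : R) z :
  ccos 0 (z + t%:C%C) * ccos 0 z + ccos (- (pi / 2)) (z + t%:C%C) * ccos (- (pi / 2)) z =
  (cos t)%:C%C.
Proof.
have h : cosh (complex.Im z) ^+ 2 - sinh (complex.Im z) ^+ 2 = 1.
  rewrite /cosh /sinh; have : expR (complex.Im z) * expR (- complex.Im z) = 1.
    by rewrite -expRD subrr expR0.
  set u := expR _; set v := expR _ => uv.
  by rewrite (_ : _ - _ = u * v)//; field.
have t1 := cos2Dsin2 (complex.Re z).
rewrite /ccos ReD ImD/= !addr0 !cosB !sinB cos_pihalf sin_pihalf cosD sinD.
move: (cos _) (sin _) (cosh _) (sinh _) h t1 (cos t) (sin t) => c s ch sh h t1 ct st.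
apply/eqP; rewrite eq_complex/=; apply/andP; split; apply/eqP; last by ring.
transitivity ((c ^+ 2 + s ^+ 2) * (ch ^+ 2 - sh ^+ 2) * ct); first by ring.
by rewrite h t1 !mul1r.
Qed.

Lemma ctrig_addition k (s : R) z :
  (cos (k%:R * s))%:C%C = \sum_(i <- harmonics k) ctrig i (z + s%:C%C) * ctrig i z.
Proof.
rewrite /harmonics; case: eqVneq => [->|k0].
  have ct0 w : ctrig 0 w = 1 :> C.
    have p0 : phase 0 = 0 :> R by rewrite /phase mul0r oppr0.
    have f0 : (freq 0)%:R = 0 :> R by [].
    rewrite /ctrig p0 f0 /ccos ReZc ImZc !mul0r addr0 cos0 sin0 /cosh oppr0 expR0.
    by apply/eqP; rewrite eq_complex/=; apply/andP; split; apply/eqP; field.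
  by rewrite big_seq1 !ct0 mulr1 mulr0n mul0r cos0.
rewrite big_cons big_seq1 /ctrig.
have -> : freq (2 * k) = k by rewrite /freq uphalfE; lia.
have -> : freq (2 * k).-1 = k by rewrite /freq uphalfE; lia.
have -> : phase (2 * k) = 0 :> R by rewrite /phase oddM/= mul0r oppr0.
have -> : phase (2 * k).-1 = - (pi / 2) :> R.
  by rewrite /phase (_ : odd _ = true) ?mul1r//; lia.
by rewrite mulrDr -rmorphM ccos_addition.
Qed.

End trigonometric_polynomials.

Section product_estimates.
Context {R : realType}.
Local Notation C := R[i].
Local Notation normc := (@Normc.normc R).
Implicit Types (F G : C -> C) (z w : C).

Variables (d M B : R) (F G : C -> C).
Hypotheses (M0 : 0 < M) (B0 : 0 < B).
Hypothesis F_bnd : forall z, `|complex.Im z| <= d -> normc (F z) <= M.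
Hypothesis F_lip : forall z w, `|complex.Im z| <= d -> normc w <= 1 ->
  normc (F (z + w) - F z) <= normc w * M.
Hypothesis F_cr : forall z h, `|complex.Im z| <= d -> 0 <= h <= 1 ->
    normc (dbar F z h) <= M * h ^+ 2.
Hypothesis G_bnd : forall z, `|complex.Im z| <= d -> normc (G z) <= B.
Hypothesis G_unif : strip_uniform d G.

Lemma strip_uniform_mul : strip_uniform d (fun z => F z * G z).
Proof.
move=> e e0; have e10 : 0 < e / (2 * M) by rewrite divr_gt0// mulr_gt0.
have [rho rho0 H] := G_unif e10.
have f0 : 0 < e / (2 * M * B) by rewrite divr_gt0// !mulr_gt0.
exists (Num.min (Num.min rho 1) (e / (2 * M * B))); first by rewrite !lt_min rho0 ltr01.
move=> z w zd wd; rewrite !le_min => /andP[/andP[h1 h2] h3].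
have -> : F w * G w - F z * G z = F w * (G w - G z) + (F (z + (w - z)) - F z) * G z.
  by rewrite (addrC z) subrK; ring.
rewrite (le_trans (le_normcD _ _))// !Normc.normcM.
have -> : e = M * (e / (2 * M)) + e / (2 * M * B) * M * B by field; rewrite !gt_eqF.
rewrite lerD// ler_pM ?normc_ge0 ?F_bnd ?H ?G_bnd//.
by rewrite (le_trans (F_lip zd h2))// ler_wpM2r// ltW.
Qed.

Lemma strip_cr_mul : strip_cr d G -> strip_cr d (fun z => F z * G z).
Proof.
move=> G_cr d' e d'd e0; have e10 : 0 < e / (6 * M) by rewrite divr_gt0// mulr_gt0.
have [rho rho0 H] := G_unif e10.
have [rho' rho'0 H'] := G_cr d' _ d'd e10.
have f0 : 0 < e / (2 * M * B) by rewrite divr_gt0// !mulr_gt0.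
exists (Num.min (Num.min (Num.min rho rho') 1) (Num.min (d - d') (e / (2 * M * B)))).
  by rewrite !lt_min rho0 rho'0 ltr01 subr_gt0 d'd.
move=> z h zd' /andP[h0]; rewrite !le_min => /andP[/andP[/andP[h1 h2] h3] /andP[h4 h5]].
have zd : `|complex.Im z| <= d by rewrite (le_trans zd')// ltW.
have wd : `|complex.Im (z + (0 +i* h)%C)| <= d.
  by rewrite ImD/= (le_trans (ler_normD _ _))// (ger0_norm h0); lra.
have vd : `|complex.Im (z + h%:C%C)| <= d by rewrite ImD/= addr0.
have h01 : 0 <= h <= 1 by rewrite h0.
have nh : normc (0 +i* h)%C = h by rewrite normc_imag ger0_norm.
have nh' : normc h%:C%C = h by rewrite normc_real ger0_norm.
set zi := z + (0 +i* h)%C in wd; set zh := z + h%:C%C in vd.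
(* The discrete Leibniz rule. In the two products of increments, that of [F] is O(h) and that of
   [G], only uniformly continuous, is small, so they are o(h). *)
have -> : dbar (fun z => F z * G z) z h = F z * dbar G z h + dbar F z h * G z +
    (F zi - F z) * (G zi - G z) - (0 +i* 1)%C * ((F zh - F z) * (G zh - G z)).
  by rewrite /dbar -/zi -/zh; ring.
have -> : e * h = M * (e / (6 * M) * h) + M * h * (e / (2 * M * B)) * B + h * M * (e / (6 * M)) +
    h * M * (e / (6 * M)) by field; rewrite !gt_eqF.
rewrite (le_trans (normcB_le _ _))// lerD//; last first.
  rewrite !Normc.normcM normc_imag normr1 mul1r ler_pM ?normc_ge0//.
    by rewrite (le_trans (F_lip _ _)) ?nh'.
  by apply: H => //; rewrite /zh addrC addKr nh'.
rewrite (le_trans (le_normcD _ _))// lerD//; last first.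
  rewrite Normc.normcM ler_pM ?normc_ge0//; first by rewrite (le_trans (F_lip _ _)) ?nh.
  by apply: H => //; rewrite /zi addrC addKr nh.
rewrite (le_trans (le_normcD _ _))// !Normc.normcM lerD//.
  by rewrite ler_pM ?normc_ge0 ?F_bnd// H'// h0.
set q := e / _ in h5 *.
rewrite ler_pM ?normc_ge0 ?G_bnd// (le_trans (F_cr zd h01))// expr2 mulrA ler_wpM2l//.
by rewrite mulr_ge0// ltW.
Qed.

End product_estimates.

Section strip_approximation.
Context {R : realType}.
Local Notation C := R[i].
Local Notation normc := (@Normc.normc R).
Implicit Types (F G : C -> C) (z w : C).

Lemma average_sum N (I : Type) (r : seq I) (g : I -> nat -> C) :
  average N (fun j => \sum_(i <- r) g i j) = \sum_(i <- r) average N (g i).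
Proof. by rewrite /average exchange_big/= mulr_sumr. Qed.

Lemma distn_lt (n : nat) (l m : 'I_n) : (distn l m < n)%N.
Proof. by rewrite /distn; have := ltn_ord l; have := ltn_ord m; lia. Qed.

Lemma sum_harmonics_le (f : nat -> R) (c : R) k n : 0 <= c -> (k < n)%N ->
  (forall i, (i < 2 * n)%N -> f i <= c) -> \sum_(i <- harmonics k) f i <= 2 * c.
Proof.
move=> c0 kn H; rewrite /harmonics; case: eqVneq => k0.
  rewrite big_seq1 mulr_natl mulr2n -[leLHS]add0r lerD// H//; lia.
by rewrite big_cons big_seq1 mulr_natl mulr2n lerD// H//; lia.
Qed.

Lemma ctrig_estimates n (d : R) : exists2 M : R, 0 < M &
  [/\ forall z, `|complex.Im z| <= d -> normc (ctrig n z) <= M,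
      forall z w, `|complex.Im z| <= d -> normc w <= 1 ->
        normc (ctrig n (z + w) - ctrig n z) <= normc w * M
    & forall z h, `|complex.Im z| <= d -> 0 <= h <= 1 ->
        normc (dbar (ctrig n) z h) <= M * h ^+ 2].
Proof.
pose b m : R := (m == n)%:R; have rb : rapid b by exact: rapid_delta.
have bE z : ctrig n z = ctrigsum b z by rewrite ctrigsum_delta.
pose W := 8 * cweight b (d + 1 + 1); have W0 : 0 <= W by rewrite mulr_ge0// cweight_ge0.
have E0 : 0 < expR (d * n%:R) :> R by exact: expR_gt0.
have WM : W <= 2 * expR (d * n%:R) + 2 * W by lra.
exists (2 * expR (d * n%:R) + 2 * W); first by lra.
split=> [z zd|z w zd w1|z h zd /andP[h0 h1]].
- rewrite (le_trans (normc_ctrig _ _))// -[leLHS]addr0 lerD//; last lra.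
  by rewrite ler_wpM2l// ler_expR ler_wpM2r.
- rewrite !bE (le_trans (ctrigsum_lip z rb w1))// ler_wpM2l ?normc_ge0// (le_trans _ WM)//.
  by rewrite ler_wpM2l// cweight_le// lerD// lerD.
(* [dbar] annihilates functions that are affine over the complex numbers, so only second-order
   remainders contribute. *)
pose Er w := ctrigsum b (z + w) - (ctrigsum b z + ccoef b 1 z * w).
have ErP w : normc w = h -> normc (Er w) <= h ^+ 2 * W.
  move=> wh; have := ctrigsum_expansion 2 z w rb.
  rewrite 2!big_ord_recl big_ord0 addr0/= expr0 mulr1 expr1 ccoef0// wh => /le_trans; apply.
  by rewrite ler_wpM2l ?sqr_ge0// ler_wpM2l// cweight_le// lerD// lerD.
have ih : (0 +i* h)%C = (0 +i* 1)%C * h%:C%C :> C.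
  by apply/eqP; rewrite eq_complex/=; apply/andP; split; apply/eqP; ring.
have -> : dbar (ctrig n) z h = Er (0 +i* h)%C - (0 +i* 1)%C * Er h%:C%C.
  have E (p q r k u i : C) : p - r - i * (q - r) = p - (r + k * (i * u)) - i * (q - (r + k * u)).
    by ring.
  by rewrite /dbar /Er !bE ih; exact: E.
rewrite (le_trans (normcB_le _ _))// Normc.normcM normc_imag normr1 mul1r.
apply: (@le_trans _ _ (h ^+ 2 * W + h ^+ 2 * W)).
  by rewrite lerD ?ErP// ?normc_imag ?normc_real ger0_norm.
rewrite -mulrDr mulrC ler_wpM2r ?sqr_ge0//; lra.
Qed.

Variables (d B : R) (G : C -> C).
Hypotheses (d0 : 0 <= d) (B0 : 0 < B).
Hypothesis G_per : forall z, G (z + (2 * pi)%:C%C) = G z.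
Hypothesis G_bnd : forall z, `|complex.Im z| <= d -> normc (G z) <= B.
Hypothesis G_unif : strip_uniform d G.
Hypothesis G_cr : strip_cr d G.
Hypothesis G_real : forall x : R, complex.Im (G x%:C%C) = 0.

(** Uniform continuity for s near 0 modulo 2 pi, boundedness elsewhere. The form c (1 - cos s) is
    the one that [fejer_mul] can average. *)
Let shift_estimate (e : R) : 0 < e -> exists2 c : R, 0 < c &
  forall z s, `|complex.Im z| <= d -> 0 <= s <= 2 * pi ->
    normc (G (z + s%:C%C) - G z) <= e + c * (1 - cos s).
Proof.
move=> e0; have [rho rho0 H] := G_unif e0; have p0 := pi_gt0 R.
pose r : R := Num.min rho pi.
have r0 : 0 < r by rewrite lt_min rho0.
have rpi : r <= pi by rewrite ge_min lexx orbT.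
have rrho : r <= rho by rewrite ge_min lexx.
have rin : r \in `[0, pi] by rewrite in_itv/= rpi ltW.
have zin : (0 : R) \in `[0, pi] by rewrite in_itv/= lexx ltW.
have k0 : 0 < 1 - cos r by rewrite subr_gt0 -cos0 ltr_cos.
have c0 : 0 < 2 * B / (1 - cos r) by rewrite divr_gt0// mulr_gt0.
exists (2 * B / (1 - cos r)) => // z s zd /andP[s0 s2].
have zsd : `|complex.Im (z + s%:C%C)| <= d by rewrite ImD/= addr0.
have cs : 0 <= 2 * B / (1 - cos r) * (1 - cos s).
  by rewrite mulr_ge0 ?(ltW c0)// subr_ge0 cos_le1.
have [sr|rs] := leP s r.
  rewrite -[leLHS]addr0 lerD// H// addrC addKr normc_real ger0_norm//.
  exact: le_trans rrho.
have [sr|{}sr] := leP (2 * pi - r) s.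
  have -> : G (z + s%:C%C) = G (z + (s - 2 * pi)%:C%C).
    by rewrite -[RHS]G_per -addrA -rmorphD subrK.
  rewrite -[leLHS]addr0 lerD// H//; first by rewrite ImD/= addr0.
  by rewrite addrC addKr normc_real ler0_norm ?subr_le0//; lra.
have csr : cos s <= cos r.
  have [sp|ps] := leP s pi; first by rewrite ltW// ltr_cos// in_itv/= s0 sp.
  have -> : cos s = cos (2 * pi - s).
    by rewrite -(cosN s) -(cos_periodic_int 1 (- s)) mulr1z mulr1 addrC.
  have sin : 2 * pi - s \in `[0, pi] by rewrite in_itv/=; apply/andP; split; lra.
  by rewrite ltW// ltr_cos//; lra.
apply: (@le_trans _ _ (B + B)).
  by rewrite (le_trans (normcB_le _ _))// lerD// G_bnd.
rewrite -[leLHS]add0r lerD ?(ltW e0)// mulrAC ler_pdivlMr//.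
by rewrite (_ : B + B = 2 * B) ?ler_wpM2l ?mulr_ge0 ?(ltW B0)//; [lra|ring].
Qed.

Let fejer_mean N n z := average N (fun j => (fejer n (node N j))%:C%C * G (z + (node N j)%:C%C)).

Let node_in N j : (j < N)%N -> 0 <= (node N j : R) <= 2 * pi.
Proof.
move=> jN; have N0 : 0 < N%:R :> R by rewrite ltr0n (leq_ltn_trans _ jN).
have p0 : 0 < 2 * pi :> R by rewrite mulr_gt0// pi_gt0.
apply/andP; split; first by rewrite divr_ge0// mulr_ge0// ltW.
by rewrite /node ler_pdivrMr// ler_wpM2l ?(ltW p0)// ler_nat ltnW.
Qed.

Let fejer_mean_close (e c : R) N n z : (0 < n)%N -> (n <= N)%N -> 0 < c ->
  (forall s, 0 <= s <= 2 * pi -> normc (G (z + s%:C%C) - G z) <= e + c * (1 - cos s)) ->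
  normc (fejer_mean N n z - G z) <= e + 2 * c / n%:R.
Proof.
move=> n0 nN c0 H; have nR : 0 < n%:R :> R by rewrite ltr0n.
have NR : N%:R != 0 :> R by rewrite pnatr_eq0 -lt0n (leq_trans n0).
have -> : G z = average N (fun j => (fejer n (node N j))%:C%C * G z).
  rewrite /average -mulr_suml -rmorph_sum/= sum_fejer// mulrA -rmorphM mulVf//.
  by rewrite mul1r.
rewrite /fejer_mean averageB.
apply: le_trans (normc_average (e := fun j => e * fejer n (node N j) + 2 * c / n%:R) _) _.
  move=> j jN; rewrite -mulrBr Normc.normcM normc_real (ger0_norm (fejer_ge0 _ _)).
  apply: le_trans (ler_wpM2l (fejer_ge0 _ _) (H _ (node_in jN))) _.
  rewrite mulrDr mulrC lerD2l mulrCA fejer_mul mulrA (mulrC 2) ler_wpM2r ?invr_ge0 ?(ltW nR)//.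
  by rewrite ler_wpM2l ?(ltW c0)//; rewrite lerBlDr -lerBlDl (_ : 1 - 2 = - 1 :> R) ?cos_geN1//;
      ring.
rewrite big_split/= -mulr_sumr sum_fejer// sumr_const card_ord -[X in _ + X]mulr_natr -mulrDl.
by rewrite mulrC mulfK.
Qed.

(** The addition theorem separates the kernel, so the Fejer mean becomes a trigonometric sum whose
    coefficients are rotation means, still dependent on z. *)
Let fejer_meanE N n z : fejer_mean N n z = (n%:R^-1)%:C%C * \sum_(l < n) \sum_(m < n)
  \sum_(i <- harmonics (distn l m)) rotation_mean N (fun z => ctrig i z * G z) z * ctrig i z.
Proof.
transitivity ((n%:R^-1)%:C%C * average N (fun j => \sum_(l < n) \sum_(m < n)
    \sum_(i <- harmonics (distn l m)) ctrig i (z + (node N j)%:C%C) * G (z + (node N j)%:C%C) *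
        ctrig i z)).
  rewrite averageMl; apply: eq_average => j _.
  rewrite fejerE rmorphM -mulrA; congr (_ * _).
  rewrite rmorph_sum mulr_suml; apply: eq_bigr => l _.
  rewrite rmorph_sum mulr_suml; apply: eq_bigr => m _ /=.
  rewrite (ctrig_addition _ _ z) mulr_suml; apply: eq_bigr => i _; exact: mulrAC.
congr (_ * _); rewrite average_sum; apply: eq_bigr => l _.
rewrite average_sum; apply: eq_bigr => m _.
rewrite average_sum; apply: eq_bigr => i _.
by rewrite mulrC /rotation_mean averageMl; apply: eq_average => j _; rewrite mulrC.
Qed.

(** The order n of the kernel is fixed first; then N is taken so large that the finitely many
    coefficient functions are nearly constant on the strip. Freezing them at 0, where they are real,
    gives [P]. *)
Lemma strip_approx (e : R) : 0 < e -> exists2 P, trig_poly P &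
  forall z, `|complex.Im z| <= d -> normc (G z - P z) <= e.
Proof.
move=> e0; have e30 : 0 < e / 3 by lra.
have [c c0 Hc] := shift_estimate e30.
have [n n0 /(_ n (leqnn n)) nP] := archi_div (2 * c) e30.
have nR : 0 < n%:R :> R by rewrite ltr0n.
have [M M0 Mb] : exists2 M : R, 0 < M & forall i z, (i < 2 * n)%N ->
    `|complex.Im z| <= d -> normc (ctrig i z) <= M.
  exists (2 * expR (d * (2 * n)%:R)) => [|i z i2 zd]; first by rewrite mulr_gt0// expR_gt0.
   rewrite (le_trans (normc_ctrig _ _))// ler_wpM2l// ler_expR.
  by rewrite ler_pM// ler_nat ltnW.
(* There are n^2 pairs (l, m) with at most two harmonics each, every basis function is at most M,
   and the sum is divided by n: the total error is e / 3. *)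
have ef0 : 0 < e / (6 * n%:R * M) by rewrite divr_gt0// !mulr_gt0.
set ef := e / _ in ef0.
have exN i : exists Ni : nat, forall N z, (Ni <= N)%N -> `|complex.Im z| <= d ->
    normc (rotation_mean N (fun z => ctrig i z * G z) z -
           rotation_mean N (fun z => ctrig i z * G z) 0) <= ef.
  have [Mi Mi0 [H1 H2 H3]] := ctrig_estimates i d.
  have := @rotation_mean_cvg R d (fun z => ctrig i z * G z) _ _ _ ef d0 ef0.
  case=> [z|||N0 _ N0P]; last by exists N0.
  - by rewrite G_per -!ctrigsum_delta ctrigsum_periodic.
  - exact: (strip_uniform_mul Mi0 B0 H1 H2 G_bnd G_unif).
  - exact: (strip_cr_mul Mi0 B0 H1 H2 H3 G_bnd G_unif G_cr).
have [Ni NiP] := choice exN.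
pose N := (n + \sum_(i < 2 * n) Ni i)%N.
have nN : (n <= N)%N by exact: leq_addr.
have NiN i : (i < 2 * n)%N -> (Ni i <= N)%N.
  by move=> i2; rewrite (leq_trans _ (leq_addl _ _))// (bigD1 (Ordinal i2))//= leq_addr.
pose a i := complex.Re (rotation_mean N (fun z => ctrig i z * G z) 0).
have aE i : (a i)%:C%C = rotation_mean N (fun z => ctrig i z * G z) 0.
  apply/eqP; rewrite eq_complex /a/= eqxx/= eq_sym; apply/eqP.
  rewrite /rotation_mean /average ImZc Im_sum big1 ?mulr0// => j _.
  by rewrite add0r ctrig_real ImZc G_real mulr0.
pose P z := (n%:R^-1)%:C%C * \sum_(l < n) \sum_(m < n)
  \sum_(i <- harmonics (distn l m)) (a i)%:C%C * ctrig i z.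
exists P.
  apply: trig_polyZ; do 3 apply: trig_poly_sum => ?.
  exact/trig_polyZ/trig_poly_ctrig.
move=> z zd.
have -> : G z - P z = (fejer_mean N n z - P z) - (fejer_mean N n z - G z) by ring.
have -> : e = e / 3 + (e / 3 + e / 3) by field.
rewrite (le_trans (normcB_le _ _))// lerD//; last first.
  apply: le_trans (fejer_mean_close n0 nN c0 (fun s => Hc z s zd)) _.
  by rewrite lerD2l.
rewrite fejer_meanE /P -mulrBr Normc.normcM normc_real ger0_norm ?invr_ge0//.
rewrite mulrC ler_pdivrMr// -sumrB.
apply: le_trans (normc_sum _ _) _.
apply: (@le_trans _ _ (\sum_(l < n) \sum_(m < n) (2 * (ef * M)))); last first.
  rewrite !sumr_const !card_ord -mulrnA -[leLHS]mulr_natr natrM /ef.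
  rewrite (_ : _ * _ = e / 3 * n%:R)//; field.
  by rewrite !gt_eqF.
apply: ler_sum => l _; rewrite -sumrB; apply: le_trans (normc_sum _ _) _.
apply: ler_sum => m _; rewrite -sumrB; apply: le_trans (normc_sum _ _) _.
have T i : (i < 2 * n)%N -> normc (rotation_mean N (fun z => ctrig i z * G z) z * ctrig i z -
    (a i)%:C%C * ctrig i z) <= ef * M.
  move=> i2; rewrite -mulrBl Normc.normcM aE ler_pM ?normc_ge0 ?Mb//.
  by apply: NiP => //; exact: NiN.
have eM : 0 <= ef * M by rewrite mulr_ge0 ?ltW.
by apply: (sum_harmonics_le (n := n)) => //; exact: distn_lt.
Qed.

End strip_approximation.

Section density.
Context {R : realType} {X : normedModType R}.

Lemma dense_lin_span (e : nat -> X) :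
  (forall f (r : R), 0 < r -> exists n (c : nat -> R), `|f - \sum_(i < n) c i *: e i| <= r) ->
  dense (lin_span e).
Proof.
move=> H O [f Of] oO; have /nbhs_ballP[r /= r0 rO] : nbhs f O by exact: open_nbhs_nbhs.
have [n [c fc]] := H f (r / 2) (divr_gt0 r0 (ltr0Sn _ 1)).
exists (\sum_(i < n) c i *: e i); split; last by exists n, c.
apply: rO; rewrite -ball_normE/= (le_lt_trans fc)//.
by rewrite ltr_pdivrMr// ltr_pMr// ltr1n.
Qed.

End density.

Section strip_compactness.
Context {R : realType}.
Local Notation C := R[i].
Local Notation normc := (@Normc.normc R).

(** One period of the closed strip is a compact rectangle, so local radii have a common positive
    lower bound; periodicity covers the rest of the strip. *)
Lemma strip_uniformize (d : R) (P : R -> C -> Prop) :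
  (forall z0, `|complex.Im z0| <= d -> exists2 rho, 0 < rho & forall z r,
     normc (z - z0) < rho -> `|complex.Im z| <= d -> 0 < r -> r <= rho -> P r z) ->
  (forall r z (m : int), P r z -> P r (z + (2 * pi * m%:~R)%:C%C)) ->
  exists2 r : R, 0 < r & forall z, `|complex.Im z| <= d -> P r z.
Proof.
move=> H Pper.
pose K : set (R * R) := `[0, 2 * pi]%classic `*` `[- d, d]%classic.
have cK : compact K by apply: compact_setX; exact: segment_compact.
have [r [r0 rP]] : exists r : R, 0 < r /\ K `<=` (fun p => P r (p.1 +i* p.2)%C).
  move/compact_near_coveringP/near_covering_withinP : cK => cov.
  have near0 : forall x, K x -> \forall x' \near x & r \near (0 : R)^'+,
      K x' -> 0 < r -> P r (x'.1 +i* x'.2)%C.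
    move=> [x y] [/= _]; rewrite in_itv/= => /andP[y1 y2].
    have [|rho rho0 Hrho] := H (x +i* y)%C; first by rewrite /= ler_norml y1.
    have h0 : 0 < rho / 2 by rewrite divr_gt0.
    exists ([set p : R * R | `|x - p.1| < rho / 2 /\ `|y - p.2| < rho / 2], [set r | r <= rho]) =>
        /=.
      split; last exact: nbhs_right_le.
      exists (ball x (rho / 2), ball y (rho / 2)) => /=.
        by split; exact: nbhsx_ballx.
      by move=> [x' y'] [/= ? ?].
    move=> [[x' y'] r]/= [[hx hy] rr] [/= _]; rewrite in_itv/= => yd r0.
    apply: Hrho => //; last by rewrite /= ler_norml.
    apply: (le_lt_trans (normc_le_ReIm _)).
    by rewrite ReB ImB/= distrC (distrC y') (splitr rho) ltrD.
  have near1 : \forall r \near (0 : R)^'+, K `<=` (fun p => 0 < r -> P r (p.1 +i* p.2)%C).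
    exact: cov.
  near (0 : R)^'+ => r; have r0 : 0 < r by near: r; exact: nbhs_right_gt.
  exists r; split => // p Kp.
  have h : K `<=` (fun p => 0 < r -> P r (p.1 +i* p.2)%C) by near: r.
  exact: h.
exists r => // z zd; have p0 : 0 < 2 * pi :> R by rewrite mulr_gt0// pi_gt0.
have [m /andP[x0 xp]] := reduce_mod p0 (complex.Re z).
set x := _ - _ in x0 xp.
have -> : z = (x +i* complex.Im z)%C + (2 * pi * m%:~R)%:C%C.
  by apply/eqP; rewrite eq_complex/= subrK addr0 !eqxx.
apply/Pper/(rP (_, _)); split; rewrite /= in_itv/=; last by rewrite -ler_norml.
by rewrite x0 ltW.
Unshelve. all: by end_near. Qed.

End strip_compactness.

Section power_series.
Context {R : realType}.
Local Notation C := R[i].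
Local Notation normc := (@Normc.normc R).
Implicit Types (u w : C) (c : nat -> C).

(** The second-order remainder of the n-th power; for n = 0 the truncated predecessor is multiplied
    by 0. *)
Let taylor_rem u w n : C := (u + w) ^+ n - u ^+ n - (u ^+ n.-1 *+ n) * w.

Let taylor_remS u w n :
  taylor_rem u w n.+1 = (u + w) * taylor_rem u w n + (u ^+ n.-1 *+ n) * w ^+ 2.
Proof.
rewrite /taylor_rem !exprS/= expr0 mulr1; case: n => [|n]; first by rewrite !mulr0n !expr0; ring.
by rewrite !exprS/= !mulrS; ring.
Qed.

(** The factor s^2 on the left avoids the exponent n - 2. *)
Let taylor_rem_le (s : R) u w n : 0 < s -> normc u <= s -> normc (u + w) <= s ->
  normc (taylor_rem u w n) * s ^+ 2 <= n%:R ^+ 2 * s ^+ n * normc w ^+ 2.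
Proof.
move=> s0 us uws; elim: n => [|n IH].
  by rewrite /taylor_rem !expr0 mulr0n mul0r subrr subr0 Normc.normc0 mul0r expr0n/= !mul0r.
rewrite taylor_remS; apply: (@le_trans _ _ (s * (n%:R ^+ 2 * s ^+ n * normc w ^+ 2) +
    n%:R * s ^+ n.+1 * normc w ^+ 2)).
  apply: le_trans (ler_wpM2r (sqr_ge0 s) (le_normcD _ _)) _; rewrite mulrDl lerD//.
    rewrite Normc.normcM -[leLHS]mulrA; apply: ler_pM => //; first exact: normc_ge0.
    by rewrite mulr_ge0 ?normc_ge0 ?sqr_ge0.
  rewrite Normc.normcM normcX -mulr_natl natc Normc.normcM normc_real normr_nat normcX.
  case: n {IH} => [|n]/=; first by rewrite !mul0r.
  rewrite [leRHS](_ : _ = n.+1%:R * s ^+ n * normc w ^+ 2 * s ^+ 2); last by rewrite !exprS; ring.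
  rewrite ler_wpM2r ?sqr_ge0// ler_wpM2r ?sqr_ge0// ler_wpM2l//.
  by rewrite lerXn2r ?nnegrE ?normc_ge0 ?(ltW s0).
have -> : s * (n%:R ^+ 2 * s ^+ n * normc w ^+ 2) + n%:R * s ^+ n.+1 * normc w ^+ 2 =
    (n%:R ^+ 2 + n%:R) * s ^+ n.+1 * normc w ^+ 2 by rewrite (exprS s n); ring.
rewrite ler_wpM2r ?sqr_ge0// ler_wpM2r ?exprn_ge0 ?(ltW s0)// -natr1.
have : 0 <= n%:R :> R by [].
nra.
Qed.


Let sum_sqr_half N : \sum_(n < N) (n%:R ^+ 2 / 2 ^+ n : R) <= 6.
Proof.
suff -> : \sum_(n < N) (n%:R ^+ 2 / 2 ^+ n : R) =
    6 - (N%:R ^+ 2 + 2 * N%:R + 3) * 2 / 2 ^+ N.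
  by rewrite gerBl divr_ge0 ?exprn_ge0// mulr_ge0// !addr_ge0 ?mulr_ge0 ?sqr_ge0.
elim: N => [|N IH]; first by rewrite big_ord0 expr0; field.
rewrite big_ord_recr/= IH (exprS 2 N) -natr1; field.
by rewrite expf_neq0.
Qed.

(** [dbar] sees only the second-order remainders of the powers. With s half the radius of
    convergence at hand, the coefficients are bounded by B / s^n; on the disc of radius q = s / 2
    the remainders are then dominated by n^2 / 2^n, uniformly over the partial sums. *)
Lemma power_series_dbar c (G : C -> C) (z0 : C) :
  (\forall z \near (z0 : R[i]^o), series (fun n => c n * (z - z0) ^+ n : R[i]^o) @ \oo --> (G z :
      R[i]^o)) ->
  exists K rho : R, [/\ 0 <= K, 0 < rho & forall z h, normc (z - z0) <= rho -> 0 <= h <= rho ->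
    normc (dbar G z h) <= K * h ^+ 2].
Proof.
move=> /nbhs_ballP[_ /= /complex_gt0[r r0 ->] rG].
have {rG} cvgG z : normc (z - z0) < r -> series (fun n => c n * (z - z0) ^+ n :
    R[i]^o) @ \oo --> (G z : R[i]^o).
  move=> zr; apply: rG; rewrite /ball/=.
  by suff : `|(z0 - z : C)| < r%:C%C by []; rewrite normcE_norm ltcR -normcN opprB.
pose s := r / 2; have s0 : 0 < s by rewrite divr_gt0.
have sr : s < r by rewrite ltr_pdivrMr// ltr_pMr// ltr1n.
have [B B0 cB] : exists2 B : R, 0 <= B & forall n, normc (c n) * s ^+ n <= B.
  have sz : normc ((z0 + s%:C%C) - z0) < r by rewrite addrC addKr normc_real gtr0_norm.
  have /cvgP/cvg_series_cvg_0/cvgP/cvg_seq_bounded := cvgG _ sz.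
  move=> [M [Mr MB]]; exists (normc (M + 1)); first exact: normc_ge0.
  move=> n; have : M < M + 1 by rewrite ltrDl.
  move=> /MB/(_ n Logic.I) /=.
  have -> : `|c n * ((z0 + s%:C%C) - z0) ^+ n| = (normc (c n) * s ^+ n)%:C%C.
    by rewrite normcE_norm Normc.normcM normcX addrC addKr normc_real gtr0_norm.
  move=> h; have := le_trans h (real_ler_norm _); rewrite normcE_norm lecR; apply.
  by rewrite rpredD// rpred1.
pose q := s / 2; have q0 : 0 < q by rewrite divr_gt0.
pose K := 2 * B / q ^+ 2 * 6.
exists K, (q / 2); split; [|by rewrite divr_gt0|move=> z h zq /andP[h0 hq]].
  by rewrite mulr_ge0// divr_ge0 ?sqr_ge0// mulr_ge0.
pose S N z : C := \sum_(n < N) c n * (z - z0) ^+ n.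
set u := z - z0 in zq.
have uq : normc u <= q by rewrite (le_trans zq)// ler_pdivrMr// ler_pMr// ler1n.
have nh : normc h%:C%C = h by rewrite normc_real ger0_norm.
have nih : normc (0 +i* h)%C = h by rewrite normc_imag ger0_norm.
have hqq w : normc w = h -> normc (u + w) <= q.
  by move=> wh; rewrite (le_trans (le_normcD _ _))// wh (splitr q) lerD.
have ih : (0 +i* h)%C = (0 +i* 1)%C * h%:C%C :> C.
  by apply/eqP; rewrite eq_complex/=; apply/andP; split; apply/eqP; ring.
have remB w n : normc w = h ->
    normc (c n * taylor_rem u w n) <= B / q ^+ 2 * (n%:R ^+ 2 / 2 ^+ n) * h ^+ 2.
  move=> wh; have := @taylor_rem_le q u w n q0 uq (hqq w wh); rewrite wh => T.
  have := ler_wpM2l (normc_ge0 (c n)) T; rewrite mulrA -Normc.normcM -ler_pdivlMr ?exprn_gt0//.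
  move=> /le_trans; apply; rewrite ler_pdivrMr ?exprn_gt0//.
  have -> : q ^+ n = s ^+ n / 2 ^+ n by rewrite expr_div_n.
  rewrite [leRHS](_ : _ = B * (n%:R ^+ 2 / 2 ^+ n * h ^+ 2)); last by field; apply/andP; split;
      rewrite ?expf_neq0// gt_eqF.
  rewrite [leLHS](_ : _ = normc (c n) * s ^+ n * (n%:R ^+ 2 / 2 ^+ n * h ^+ 2)); last by ring.
  by rewrite ler_wpM2r// mulr_ge0 ?sqr_ge0// divr_ge0 ?sqr_ge0 ?exprn_ge0.
have dS N : normc (dbar (S N) z h) <= K * h ^+ 2.
  have -> : dbar (S N) z h = \sum_(n < N) c n * taylor_rem u (0 +i* h)%C n -
      (0 +i* 1)%C * \sum_(n < N) c n * taylor_rem u h%:C%C n.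
    rewrite /dbar /S mulr_sumr -!sumrB mulr_sumr -sumrB; apply: eq_bigr => n _.
    rewrite (addrAC z (0 +i* h)%C (- z0)) (addrAC z h%:C%C (- z0)) -/u /taylor_rem ih.
    have E (a x y v k i t : C) : a * x - a * v - i * (a * y - a * v) =
      a * (x - v - k * (i * t)) - i * (a * (y - v - k * t)) by ring.
    exact: E.
  have T w : normc w = h -> normc (\sum_(n < N) c n * taylor_rem u w n) <= B / q ^+ 2 * 6 * h ^+ 2.
    move=> wh; rewrite (le_trans (normc_sum _ _))//.
    apply: (@le_trans _ _ (\sum_(n < N) B / q ^+ 2 * (n%:R ^+ 2 / 2 ^+ n) * h ^+ 2)).
      by apply: ler_sum => n _; exact: remB.
    by rewrite -mulr_suml -mulr_sumr ler_wpM2r ?sqr_ge0// ler_wpM2l// divr_ge0// sqr_ge0.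
  rewrite (le_trans (normcB_le _ _))// Normc.normcM normc_imag normr1 mul1r.
  rewrite (_ : K * h ^+ 2 = B / q ^+ 2 * 6 * h ^+ 2 + B / q ^+ 2 * 6 * h ^+ 2) ?lerD ?T//.
  by rewrite /K; ring.
(* For fixed h, [dbar] involves only the points z, z + h and z + i h, so pointwise convergence of
   the partial sums transfers their common bound. *)
apply/ler_addgt0Pr => e e0; have e40 : 0 < e / 4 by rewrite divr_gt0.
have near_S w : normc (w - z0) < r -> \forall N \near \oo, normc (G w - S N w) <= e / 4.
  move=> /cvgG/cvgrPdist_le/(_ (e / 4)%:C%C); rewrite ltcR => /(_ e40).
  apply: filterS => N; rewrite /series/= big_mkord.
  by rewrite normcE_norm lecR.
have lt w : normc w = h -> normc (z + w - z0) < r.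
  move=> wh; rewrite addrAC (le_lt_trans (hqq w wh))//.
  by rewrite (lt_trans _ sr)// ltr_pdivrMr// ltr_pMr// ltr1n.
have ltz : normc (z - z0) < r.
  by rewrite (le_lt_trans uq)// (lt_trans _ sr)// ltr_pdivrMr// ltr_pMr// ltr1n.
have [N1 _ H1] := near_S _ ltz; have [N2 _ H2] := near_S _ (lt _ nh).
have [N3 _ H3] := near_S _ (lt _ nih); pose N := (N1 + N2 + N3)%N.
have n1 := H1 N (leq_trans (leq_addr N2 N1) (leq_addr N3 _)).
have n2 := H2 N (leq_trans (leq_addl N1 N2) (leq_addr N3 _)).
have n3 := H3 N (leq_addl _ _).
have -> : dbar G z h = dbar (S N) z h + ((G (z + (0 +i* h)%C) - S N (z + (0 +i* h)%C)) -
    (G z - S N z) - (0 +i* 1)%C * ((G (z + h%:C%C) - S N (z + h%:C%C)) - (G z - S N z))).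
  by rewrite /dbar; ring.
rewrite (le_trans (le_normcD _ _))// lerD//.
have -> : e = e / 4 + e / 4 + (e / 4 + e / 4) by field.
rewrite (le_trans (normcB_le _ _))// lerD//.
  by rewrite (le_trans (normcB_le _ _))// lerD.
rewrite Normc.normcM normc_imag normr1 mul1r.
by rewrite (le_trans (normcB_le _ _))// lerD.
Qed.

End power_series.

(** * Density of trigonometric polynomials in both spaces *)

Section Comega_density.
Context {R : realType} (delta : {posnum R}).
Local Notation C := R[i].
Local Notation normc := (@Normc.normc R).

Section one_function.
Variable F : ComegaS delta.

Let d : R := delta%:num.
Let d0 : 0 < d. Proof. by rewrite /d. Qed.
Let G : C -> C := continuation F.

Let G_per z : G (z + (2 * pi)%:C%C) = G z.
Proof. by have /asboolP[_ _ _ [pF _ _]] := continuationP F; exact: pF. Qed.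

Let G_perZ z (m : int) : G (z + (2 * pi * m%:~R)%:C%C) = G z.
Proof. exact: shift_int. Qed.

Let G_real (x : R) : complex.Im (G x%:C%C) = 0.
Proof. by have /asboolP[_ _ _ [_ rF _]] := continuationP F; exact: rF. Qed.

Let G_unif : strip_uniform d G.
Proof.
move=> e e0; have e20 : 0 < e / 2 by rewrite divr_gt0.
have [] := @strip_uniformize R d (fun rho z => forall w,
  `|complex.Im w| <= d -> normc (w - z) <= rho -> normc (G w - G z) <= e).
- move=> z0 z0d; have /asboolP[_ /subspace_continuousP cF _ _] := continuationP F.
  have /cvgrPdist_le/(_ (e / 2)%:C%C) := cF z0 z0d; rewrite ltcR => /(_ e20).
  rewrite near_withinE => /nbhs_ballP[_ /= /complex_gt0[r r0 ->] rF].
  have {rF} H w : normc (w - z0) < r -> `|complex.Im w| <= d -> normc (G w - G z0) <= e / 2.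
    move=> wr wd; have : ball (z0 : R[i]^o) r%:C%C w.
      suff : `|(z0 - w : C)| < r%:C%C by [].
      by rewrite normcE_norm ltcR -normcN opprB.
    move=> /rF/(_ wd) h; have {h} : `|(G z0 - G w : C)| <= (e / 2)%:C%C by [].
    by rewrite normcE_norm lecR -normcN opprB.
  exists (r / 2) => [|z rho zr zd rho0 rhor w wd wz]; first by rewrite divr_gt0.
  have -> : G w - G z = (G w - G z0) - (G z - G z0) by ring.
  have zr' : normc (z - z0) < r by rewrite (lt_trans zr)// ltr_pdivrMr// ltr_pMr// ltr1n.
  have wr : normc (w - z0) < r.
    have -> : w - z0 = (w - z) + (z - z0) by ring.
    rewrite (le_lt_trans (le_normcD _ _))// (splitr r) ler_ltD//.
    exact: le_trans rhor.
  by rewrite (le_trans (normcB_le _ _))// (splitr e) lerD// H.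
- move=> rho z m H w wd wz; pose w' := w - (2 * pi * m%:~R)%:C%C.
  have wE : w = w' + (2 * pi * m%:~R)%:C%C by rewrite subrK.
  rewrite wE !G_perZ; apply: H.
    by move: wd; rewrite wE ImD/= addr0.
  by rewrite /w' -addrA -opprD (addrC _ z).
- by move=> rho rho0 H; exists rho => // z w zd wd; exact: H.
Qed.

Let G_cr : strip_cr d G.
Proof.
move=> d' e d'd e0.
have [] := @strip_uniformize R d' (fun rho z => forall h, 0 <= h <= rho ->
    normc (dbar G z h) <= e * h).
- move=> z0 z0d; have /asboolP[aF _ _ _] := continuationP F.
  have [c /power_series_dbar[K [rho [K0 rho0 H]]]] := aF z0 (le_lt_trans z0d d'd).
  (* The quadratic bound K h^2 is at most e h once h <= e / (K + 1). *)
  have m0 : 0 < Num.min rho (e / (K + 1)) by rewrite lt_min rho0 divr_gt0//; lra.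
  exists (Num.min rho (e / (K + 1))) => // z r; rewrite lt_min le_min.
  move=> /andP[zr _] _ r0 /andP[rr re] h /andP[h0 hr].
  rewrite (le_trans (H z h (ltW zr) _)) ?h0 ?(le_trans hr rr)//.
  rewrite expr2 mulrA ler_wpM2r// (le_trans _ (_ : h * (K + 1) <= _))//.
    by rewrite mulrC ler_wpM2l//; lra.
  by rewrite -ler_pdivlMr ?(le_trans hr)//; lra.
- move=> r z m H h /H; rewrite /dbar !(addrAC z (2 * pi * m%:~R)%:C%C) !G_perZ.
  exact.
- by move=> r r0 H; exists r => // z h zd; exact: H.
Qed.

Lemma Comega_approx (e : R) : 0 < e -> exists n (c : nat -> R),
  `|F - \sum_(i < n) c i *: Comega_trig delta i| <= e.
Proof.
move=> e0; have /asboolP[_ _ _ [_ _ [M FM]]] := continuationP F.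
have M0 : 0 <= M by rewrite (le_trans _ (FM 0 I)).
have B0 : 0 < M + 1 by lra.
have G_bnd z : `|complex.Im z| <= d -> normc (G z) <= M + 1.
  by move=> _; rewrite (le_trans (FM z I))//; lra.
have [P [n [c PE]] FP] := strip_approx (ltW d0) B0 G_per G_bnd G_unif G_cr G_real e0.
exists n, c; apply: sup_norm_le => [|z /ltW zd]; first exact: open_strip_neq0.
rewrite -[leLHS]/(normc (F z - (\sum_(i < n) c i *: Comega_trig delta i : ComegaS delta) z)).
by rewrite Comega_trig_sumE// -PE; exact: FP.
Qed.

End one_function.

Lemma dense_Comega_trig : dense (lin_span (Comega_trig delta)).
Proof. by apply: dense_lin_span => F r r0; exact: Comega_approx. Qed.

End Comega_density.

Section Ck_density.
Context {R : realType}.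
Local Notation C := R[i].
Local Notation normc := (@Normc.normc R).

(** The case d = 0, with f extended constantly in the imaginary direction: the Cauchy-Riemann
    condition is vacuous, as the narrower strips are empty. *)
Lemma continuous_trig_approx (f : R -> R) (e : R) : (forall x, f (x + 2 * pi) = f x) ->
  continuous f -> 0 < e -> exists n (c : nat -> R),
  forall x, `|f x - \sum_(j < n) c j * trig 0 j x| <= e.
Proof.
move=> pf cf e0; pose G (z : C) : C := (f (complex.Re z))%:C%C.
have [M fM] := periodic_bounded pf cf.
have M0 : 0 <= M by rewrite (le_trans _ (fM 0 I)).
have B0 : 0 < M + 1 by lra.
have G_per z : G (z + (2 * pi)%:C%C) = G z by rewrite /G ReD/= pf.
have G_bnd z : `|complex.Im z| <= 0 -> normc (G z) <= M + 1.
  by move=> _; rewrite normc_real (le_trans (fM _ I))//; lra.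
have G_real x : complex.Im (G x%:C%C) = 0 by [].
have G_cr : strip_cr 0 G.
  by move=> d' e' d'0 _; exists 1 => // z h zd; have :=
      le_lt_trans (le_trans (normr_ge0 _) zd) d'0; rewrite ltxx.
have G_unif : strip_uniform 0 G.
  move=> r r0; have r20 : 0 < r / 2 by rewrite divr_gt0.
  have [] := @strip_uniformize R 0 (fun rho z => forall w, normc (w - z) <= rho ->
      normc (G w - G z) <= r).
  - move=> z0 _; have /cvgrPdist_le/(_ (r / 2) r20) := cf (complex.Re z0).
    move=> /nbhs_ballP[s s0 sf]; have {}s0 : 0 < s := s0.
    have {sf} H w : normc (w - z0) < s -> `|f (complex.Re z0) - f (complex.Re w)| <= r / 2.
      by move=> ws; apply: sf; rewrite /ball/= distrC -ReB (le_lt_trans (Re_le_normc _)).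
    exists (s / 2) => [|z rho zs _ rho0 rhos w wz]; first by rewrite divr_gt0.
    have zs' : normc (z - z0) < s by rewrite (lt_trans zs)// ltr_pdivrMr// ltr_pMr// ltr1n.
    have ws : normc (w - z0) < s.
      have -> : w - z0 = (w - z) + (z - z0) by ring.
      rewrite (le_lt_trans (le_normcD _ _))// (splitr s) ler_ltD//.
      exact: le_trans rhos.
    have -> : G w - G z = (f (complex.Re w) - f (complex.Re z))%:C%C by rewrite rmorphB.
    rewrite normc_real; have -> : f (complex.Re w) - f (complex.Re z) = (f (complex.Re z0) -
        f (complex.Re z)) -
      (f (complex.Re z0) - f (complex.Re w)) by ring.
    by rewrite (le_trans (ler_normB _ _))// (splitr r) lerD// H.
  - move=> rho z m H w wz; pose w' := w - (2 * pi * m%:~R)%:C%C.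
    have wE : w = w' + (2 * pi * m%:~R)%:C%C by rewrite subrK.
    rewrite wE !(shift_int _ _ G_per); apply: H.
    by rewrite /w' -addrA -opprD (addrC _ z).
  - by move=> rho rho0 H; exists rho => // z w zd _; exact: H.
have [P [n [c PE]] GP] := strip_approx (lexx 0) B0 G_per G_bnd G_unif G_cr G_real e0.
exists n, c => x; have := GP x%:C%C; rewrite /= normr0 => /(_ (lexx 0)).
have -> : P x%:C%C = (\sum_(j < n) c j * trig 0 j x)%:C%C.
  by rewrite PE rmorph_sum; apply: eq_bigr => j _; rewrite ctrig_real -rmorphM.
by rewrite /G -rmorphB normc_real.
Qed.

(* Coefficients of the antiderivative with constant term [a] of the sum with
   coefficients [c] (minus its constant term): the basis functions of index
   2k - 1 and 2k are sin (k x) and cos (k x). *)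
Definition antiderivative (a : R) (c : nat -> R) (j : nat) : R :=
  if j == 0%N then a else
  if odd j then c j.+1 / (freq j)%:R else - (c j.-1 / (freq j)%:R).

(** Integration exchanges sine and cosine of the same frequency, so the number of terms is odd to
    keep these pairs together. *)
Lemma antiderivativeP (a : R) (c : nat -> R) K i (x : R) :
  \sum_(j < (2 * K).+1) antiderivative a c j * trig i.+1 j x =
  \sum_(j < (2 * K).+1) c j * trig i j x - c 0%N * trig i 0 x.
Proof.
elim: K => [|K IH].
  by rewrite !big_ord1 subrr /trig (_ : freq 0 = 0%N)// expr0n/= mul0r mulr0.
rewrite (_ : (2 * K.+1).+1 = (2 * K).+3); last by lia.
rewrite 2!big_ord_recr [in RHS]big_ord_recr [in RHS]big_ord_recr/= IH.
have f1 : freq (2 * K).+1 = K.+1 by rewrite /freq uphalfE; lia.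
have f2 : freq (2 * K).+2 = K.+1 by rewrite /freq uphalfE; lia.
have o1 : odd (2 * K).+1 by rewrite /= oddM.
have o2 : odd (2 * K).+2 = false by rewrite /= oddM.
have ph1 : phase (2 * K).+1 = - (pi / 2) :> R by rewrite /phase o1 mul1r.
have ph2 : phase (2 * K).+2 = 0 :> R by rewrite /phase o2 mul0r oppr0.
suff key : antiderivative a c (2 * K).+1 * trig i.+1 (2 * K).+1 x +
    antiderivative a c (2 * K).+2 * trig i.+1 (2 * K).+2 x =
    c (2 * K).+1 * trig i (2 * K).+1 x + c (2 * K).+2 * trig i (2 * K).+2 x.
  by rewrite -addrA key; ring.
rewrite /antiderivative o1 o2 /trig f1 f2 ph1 ph2 !add0r.
have KR : K.+1%:R != 0 :> R by rewrite pnatr_eq0.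
set k := K.+1%:R in KR *.
have E1 : i.+1%:R * (pi / 2) = i%:R * (pi / 2) + pi / 2 :> R by rewrite -natr1; ring.
have -> : cos (k * x + (- (pi / 2) + i.+1%:R * (pi / 2))) = cos (k * x + i%:R * (pi / 2)).
  by congr (cos (_ + _)); rewrite E1; ring.
have -> : cos (k * x + i.+1%:R * (pi / 2)) = - cos (k * x + (- (pi / 2) + i%:R * (pi / 2))).
  by rewrite -cosDpi; congr cos; rewrite E1; field.
by rewrite /= exprS; field; rewrite addrC natr1.
Qed.

Lemma is_derive_trig_sum (c : nat -> R) n i (x : R) :
  is_derive x 1 (fun y => \sum_(j < n) c j * trig i j y) (\sum_(j < n) c j * trig i.+1 j x).
Proof.
rewrite (_ : (fun y => _) = \sum_(j < n) (fun y => c j * trig i j y)); last first.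
  by apply/funext => y; rewrite fct_sumE.
apply: is_derive_sum => j; exact: is_deriveZ (is_derive_trig i j x).
Qed.

Lemma trig_sum_periodic (c : nat -> R) n i x :
  \sum_(j < n) c j * trig i j (x + 2 * pi) = \sum_(j < n) c j * trig i j x.
Proof.
apply: eq_bigr => j _; congr (_ * _); rewrite /trig; congr (_ * _).
by rewrite mulrDr addrAC (mulrC _ (2 * pi)) (cos_periodic_int (freq j)%:Z).
Qed.

Lemma periodic_reduce (g : R -> R) (e : R) : (forall x, g (x + 2 * pi) = g x) ->
  (forall x, 0 <= x <= 2 * pi -> `|g x| <= e) -> forall x, `|g x| <= e.
Proof.
move=> pg H x; have p0 : 0 < 2 * pi :> R by rewrite mulr_gt0// pi_gt0.
have [m /andP[x0 xp]] := reduce_mod p0 x.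
by rewrite -(periodic_int (- m) _ pg) H// mulrNz mulrN x0 ltW.
Qed.

(** The approximant of the derivatives is integrated. Its constant term c_0 has no periodic
    antiderivative and is dropped; it is small because a derivative of a periodic function has mean
    0. *)
Lemma trig_approx k : forall (fs : nat -> R -> R) (e : R),
  (forall i x, fs i (x + 2 * pi) = fs i x) ->
  (forall i, (i < k)%N -> forall x : R, is_derive x 1 (fs i) (fs i.+1 x)) ->
  continuous (fs k) -> 0 < e -> exists n (c : nat -> R),
  forall i x, (i <= k)%N -> `|fs i x - \sum_(j < n) c j * trig i j x| <= e.
Proof.
elim: k => [|k IH] fs e fper fd fc e0.
  have [n [c H]] := continuous_trig_approx (fper 0%N) fc e0.
  by exists n, c => i x; rewrite leqn0 => /eqP ->.
have p0 : 0 < 2 * pi :> R by rewrite mulr_gt0// pi_gt0.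
set p := 2 * pi in p0.
(* Dropping c_0 doubles the error r of the derivatives, and integrating over one period multiplies
   it by at most p. *)
have r0 : 0 < e / (2 * (p + 1)) by rewrite divr_gt0// mulr_gt0//; lra.
set r := e / _ in r0.
have re : 2 * r * (p + 1) = e by rewrite /r; field; rewrite gt_eqF//; lra.
have [n [c0 H0]] := IH (fun i => fs i.+1) r (fun i => fper i.+1) (fun i => fd i.+1) fc r0.
pose c j := if (j < n)%N then c0 j else 0.
pose N := (2 * n).+1.
have {H0} H i x : (i <= k)%N -> `|fs i.+1 x - \sum_(j < N) c j * trig i j x| <= r.
  move=> ik; have := H0 i x ik; congr (`|_ - _| <= _).
  have nN : (n <= N)%N by rewrite /N; lia.
  rewrite (big_ord_widen _ (fun j => c0 j * trig i j x) nN) big_mkcond/=.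
  by apply: eq_bigr => j _; rewrite /c; case: ifP => // _; rewrite mul0r.
(* The integration constant that makes the approximant exact at 0. *)
pose a := fs 0%N 0 - \sum_(j < N) antiderivative 0 c j * trig 0 j 0.
pose q := antiderivative a c.
have qd i x : \sum_(j < N) q j * trig i.+1 j x =
    \sum_(j < N) c j * trig i j x - c 0%N * trig i 0 x by exact: antiderivativeP.
have fs0 (x : R) : is_derive x 1 (fs 0%N) (fs 1%N x) by exact: fd.
have t00 x : trig 0 0 x = 1 :> R by rewrite trig0_freq0.
have c0r : `|c 0%N| <= r.
  (* The derivative of [g] is at most r in absolute value, while periodicity of the first two terms
     makes its increment over a period equal to - c_0 p. *)
  pose g x := fs 0%N x - \sum_(j < N) q j * trig 0 j x - c 0%N * x.
  have gd (x : R) : is_derive x 1 g (fs 1%N x - \sum_(j < N) c j * trig 0 j x).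
    have -> : fs 1%N x - \sum_(j < N) c j * trig 0 j x =
      fs 1%N x - \sum_(j < N) q j * trig 1 j x - c 0%N * 1%:R * x ^+ 0.
      by rewrite qd t00 expr0; ring.
    have cd : is_derive x 1 (fun y => c 0%N * y) (c 0%N * 1%:R * x ^+ 0) :=
        is_derive_exprn (c 0%N) 0 x.
    exact: (is_deriveB (is_deriveB (fs0 x) (is_derive_trig_sum q N 0 x)) cd).
  have := @lipschitz_of_derive R _ _ r gd (fun x => H 0%N x (leq0n _)) p 0.
  have -> : g p - g 0 = - (c 0%N * p).
    have := fper 0%N 0; have := trig_sum_periodic q N 0 0; rewrite !add0r -/p => tp fp.
    by rewrite /g tp fp; ring.
  by rewrite subr0 normrN normrM (gtr0_norm p0) ler_pM2r.
have H1 i x : (i <= k)%N -> `|fs i.+1 x - \sum_(j < N) q j * trig i.+1 j x| <= 2 * r.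
  move=> ik; rewrite qd opprB addrA addrAC (le_trans (ler_normD _ _))// mulr_natl mulr2n lerD ?H//.
  rewrite normrM (le_trans _ c0r)// ler_piMr// (le_trans (trig_le _ _ _))//.
  by rewrite (_ : freq 0 = 0%N)// expr0n; case: (i == 0%N).
exists N, q => -[|i] x ik; last by rewrite (le_trans (H1 _ _ ik))// -re; nra.
apply: (periodic_reduce (g := fun x => fs 0%N x - \sum_(j < N) q j * trig 0 j x)) =>
    [y|y /andP[y0 yp]].
  by rewrite fper trig_sum_periodic.
have gd (u : R) : is_derive u 1 (fun x => fs 0%N x - \sum_(j < N) q j * trig 0 j x)
    (fs 1%N u - \sum_(j < N) q j * trig 1 j u) := is_deriveB (fs0 u) (is_derive_trig_sum q N 0 u).
have := @lipschitz_of_derive R _ _ (2 * r) gd (fun x => H1 0%N x (leq0n _)) y 0.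
have -> : fs 0%N 0 - \sum_(j < N) q j * trig 0 j 0 = 0.
  rewrite /q /N big_ord_recl [X in fs 0%N 0 - (X * _ + _)]/antiderivative/= t00 mulr1.
  by rewrite /a /N big_ord_recl [X in _ - (X * _ + _)]/antiderivative/= mul0r add0r subrK subrr.
rewrite !subr0 (ger0_norm y0) => /le_trans; apply; rewrite -re.
have rr : 0 <= 2 * r by rewrite mulr_ge0// ltW.
by apply: (ler_wpM2l rr); rewrite (le_trans yp)// lerDl.
Qed.

Lemma dense_Ck_trig k : dense (lin_span (@Ck_trig R k)).
Proof.
apply: dense_lin_span => f r r0; have /asboolP[pf df cf] := CkS_funP f.
(* The norm is a sum of k + 1 sup norms, each of which receives an equal share. *)
have e0 : 0 < r / k.+1%:R by rewrite divr_gt0.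
have [||n [c H]] := @trig_approx k (fun i => derive1n i f) _ _ _ cf e0.
- by move=> i x; exact: derive1n_periodic.
- move=> i ik x; rewrite derive1nS; apply: DeriveDef; first exact: df.
  by rewrite derive1E.
exists n, c; set y := \sum_(i < n) _.
(* A finite sequence padded with zeros is rapid, so the formula for the derivatives of trigonometric
   series covers polynomials. *)
pose b j := if (j < n)%N then c j else 0.
have rb : rapid b.
  move=> L; exists (\sum_(j < n) `|c j| * expR (L * j%:R)) => m; rewrite /b; case: ifP => mn.
    rewrite (bigD1 (Ordinal mn))//= lerDl; apply: sumr_ge0 => j _.
    by rewrite mulr_ge0// expR_ge0.
  by rewrite normr0 mul0r; apply: sumr_ge0 => j _; rewrite mulr_ge0// expR_ge0.
have tE i x : trigsum b i x = \sum_(j < n) c j * trig i j x.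
  rewrite (trigsum_split n)// (_ : tail b n = fun=> 0); last first.
    by apply/funext => m; rewrite /tail /b; case: (m < n)%N.
  rewrite [X in _ + X](_ : _ = 0) ?addr0.
    by apply: eq_bigr => j _; rewrite /b ltn_ord.
  by rewrite -[RHS](@tsum0 R); apply: eq_tsum => m; rewrite mul0r.
have yE : y = trigsum b 0 :> (R -> R).
  apply/funext => x; rewrite tE [LHS](Ck_sumE n (fun i => c i *: Ck_trig k i) x).
  by apply: eq_bigr => i _; rewrite -[LHS]/(c i * Ck_trig k i x) Ck_trigE.
have fyE : f - y = -1 *: (y : R -> R) + (f : R -> R) :> (R -> R).
  by apply/funext => x; rewrite -[LHS]/(f x - y x) -[RHS]/(-1 * y x + f x) mulN1r addrC.
apply: (@le_trans _ _ (\sum_(i < k.+1) r / k.+1%:R)); last first.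
  by rewrite sumr_const card_ord -[leLHS]mulr_natr divfK// pnatr_eq0.
apply: ler_sum => i _; have ik : (i <= k)%N by rewrite -ltnS.
apply: sup_norm_le => [|x _]; first by exists 0.
rewrite fyE (derive1n_lin _ (CkS_funP y) (CkS_funP f))//.
rewrite -[X in `|X|]/(-1 * derive1n i y x + derive1n i f x).
by rewrite yE derive1n_trigsum// mulN1r addrC tE H.
Qed.

End Ck_density.

Theorem theorem5 (R : realType) :
  (forall k : nat, (2 <= k)%N ->
     ~ cube_prevalent (IC_infty (@CkS_fun R k)))
  /\
  (forall delta : {posnum R},
     ~ cube_prevalent (IC_ess (@real_restriction R delta) 1)
     /\ ~ cube_prevalent (IC_fin (@real_restriction R delta))).
Proof.
split=> [k _|delta]; first exact/Ck_not_prevalent/dense_Ck_trig.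
by split; [apply: IC_ess_not_prevalent|apply: IC_fin_not_prevalent]; exact: dense_Comega_trig.
Qed.
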